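(* Let $(M,g)$ be a three-dimensional strongly spin Lorentzian manifold. Then $(M,g)$ admits a skew-torsion parallel spinor if and only if it admits a nowhere vanishing isotropic one-form $u\in\Omega^1(M)$ satisfying $$\nabla^gu=\mathfrak{f}\ast_gu$$ for a function $\mathfrak{f}\in C^{\infty}(M)$.
   Context: $(M,g)$ is connected, oriented and time-oriented of signature $(2,1)$; strongly spin means spin and such that every spin structure reduces to the identity component of the spin group. $\nabla^g$ is the Levi-Civita connection, $(\nabla^gu)(w,\cdot)=\nabla^g_wu$, $\ast_g$ is the Hodge star and the two-form $\ast_gu$ is viewed as a skew $(0,2)$-tensor. An irreducible paired spinor bundle on $(M,g)$ is a rank-two real bundle $S$ of irreducible Clifford modules over $\mathrm{Cl}(T^{\ast}M,g^{\ast})$ (convention $v^2=g^{\ast}(v,v)$) with a non-degenerate skew-symmetric pairing for which one-forms act skew-adjointly; it is associated to a spin structure, so metric connections lift to $S$. A skew-torsion parallel spinor is a non-zero section $\varepsilon$ of such an $S$ parallel with respect to the lift to $S$ of some metric connection with totally skew-symmetric torsion, i.e. $\nabla^g_w\varepsilon+\frac14(\iota_wH)\cdot\varepsilon=0$ for all vector fields $w$, for some $H\in\Omega^3(M)$, where $\cdot$ is Clifford multiplication by forms. *)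

(* Defs.v *)
(* MathComp-Analysis: smooth Lorentzian three-manifolds, spin structures and
   paired spinor bundles over an arbitrary [R : realType]. *)
From HB Require Import structures.
From mathcomp Require Import all_boot all_order all_algebra.
From mathcomp Require Import all_classical all_reals all_analysis.
Set Implicit Arguments.
Unset Strict Implicit.
Unset Printing Implicit Defensive.
Import Order.TTheory GRing.Theory Num.Theory.
Import numFieldNormedType.Exports.
Local Open Scope classical_set_scope.
Local Open Scope ring_scope.

(* [V] is meant to be open: C^k iff continuous with C^(k-1) partial
   derivatives. *)
Fixpoint Ck (R : realType) (k : nat) (V : set 'rV[R]_3)
    (f : 'rV[R]_3 -> R) : Prop :=
  (forall x, V x -> {for x, continuous f}) /\
  match k with
  | 0%N => True
  | k'.+1 => forall i : 'I_3,
      (forall x, V x -> derivable f x (delta_mx 0 i)) /\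
      Ck k' V (fun x => 'D_(delta_mx 0 i) f x)
  end.

Definition Cinf (R : realType) (V : set 'rV[R]_3) (f : 'rV[R]_3 -> R) : Prop :=
  forall k, Ck k V f.

(* [coord_jac x2 y1 p i j] is the derivative of the j-th coordinate of the
   chart x2 along the i-th coordinate of the chart whose inverse is y1, at the
   point with y1-coordinates p. *)
Definition coord_jac (R : realType) (T : Type) (x2 : T -> 'rV[R]_3)
    (y1 : 'rV[R]_3 -> T) (p : 'rV[R]_3) : 'M[R]_3 :=
  \matrix_(i, j) 'D_(delta_mx 0 i) (fun z => x2 (y1 z) 0 j) p.

(* Smooth three-manifolds with an oriented atlas.  [chart_at p] is a preferred
   chart around [p]; it serves to represent tangent spaces, see below. *)
Record manifold3 (R : realType) := Manifold3 {
  carrier :> topologicalType;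
  chart : Type;
  cdom : chart -> set carrier;
  cmap : chart -> carrier -> 'rV[R]_3;
  cinv : chart -> 'rV[R]_3 -> carrier;
  chart_at : carrier -> chart;
  m_hausdorff : hausdorff_space carrier;
  m_second_countable : @second_countable carrier;
  cdom_open : forall c, open (cdom c);
  cimg_open : forall c, open (cmap c @` cdom c);
  cmapK : forall c p, cdom c p -> cinv c (cmap c p) = p;
  cmap_cont : forall c p, cdom c p -> {for p, continuous (cmap c)};
  cinv_cont : forall c x, (cmap c @` cdom c) x -> {for x, continuous (cinv c)};
  chart_atP : forall p, cdom (chart_at p) p;
  transition_smooth : forall c c' (j : 'I_3),
    Cinf (cmap c @` (cdom c `&` cdom c')) (fun x => cmap c' (cinv c x) 0 j);
  transition_oriented : forall c c' p, cdom c p -> cdom c' p ->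
    0 < \det (coord_jac (cmap c') (cinv c) (cmap c p))
}.
Arguments cdom {R m}.
Arguments cmap {R m}.
Arguments cinv {R m}.
Arguments chart_at {R m}.

Section Calculus.
Variables (R : realType) (M : manifold3 R).
Implicit Types (U : set M) (c : chart M) (p : M).

Definition smooth_on U (f : M -> R) : Prop :=
  forall c, Cinf (cmap c @` (U `&` cdom c)) (f \o cinv c).

(* The tangent space at p is 'rV[R]_3 and the cotangent space is 'cV[R]_3,
   both through the coordinates of [chart_at p]; the evaluation of a covector
   u on a vector w is (w *m u) 0 0.  Row i of [cbasis c p] is the coordinate
   vector d/dx^i of the chart c at p, and column j of [cobasis c p] is dx^j. *)
Definition cbasis c p : 'M[R]_3 :=
  coord_jac (cmap (chart_at p)) (cinv c) (cmap c p).
Definition cobasis c p : 'M[R]_3 :=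
  coord_jac (cmap c) (cinv (chart_at p)) (cmap (chart_at p) p).

Definition vfield := M -> 'rV[R]_3.
Definition form1 := M -> 'cV[R]_3.
Definition form3 := M -> 'rV[R]_3 -> 'rV[R]_3 -> 'rV[R]_3 -> R.

Definition deriv_along (f : M -> R) p (w : 'rV[R]_3) : R :=
  'D_w (f \o cinv (chart_at p)) (cmap (chart_at p) p).

Definition smooth_vfield U (X : vfield) : Prop :=
  forall c j, smooth_on (U `&` cdom c) (fun p => (X p *m cobasis c p) 0 j).

Definition smooth_form1 U (u : form1) : Prop :=
  forall c i, smooth_on (U `&` cdom c) (fun p => (cbasis c p *m u p) i 0).

Definition smooth_form3 (H : form3) : Prop :=
  [/\ forall p a v v' w x,
        H p (a *: v + v') w x = a * H p v w x + H p v' w x,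
      forall p v w x, H p v w x = - H p w v x,
      forall p v w x, H p v w x = - H p v x w &
      forall c i j k, smooth_on (cdom c) (fun p =>
        H p (row i (cbasis c p)) (row j (cbasis c p)) (row k (cbasis c p)))].

End Calculus.

(* The matrix diag(1, 1, -1) of the standard form of signature (2,1). *)
Definition eta (R : realType) (a : 'I_3) : R := if a == ord_max then -1 else 1.
Definition eta_mx (R : realType) : 'M[R]_3 := diag_mx (\row_a eta R a).

(* [metric p] is the Gram matrix of the metric at p on the tangent space 'rV[R]_3.
   The time orientation is given by a smooth timelike vector field. *)
Record lorentz3 (R : realType) := Lorentz3 {
  mfd :> manifold3 R;
  mfd_nonempty : [set: mfd] !=set0;
  mfd_connected : connected [set: mfd];
  metric : mfd -> 'M[R]_3;
  metric_sym : forall p, (metric p)^T = metric p;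
  metric_signature : forall p, exists2 P : 'M[R]_3, P \in unitmx &
    P *m metric p *m P^T = eta_mx R;
  metric_smooth : forall c i j, smooth_on (cdom c)
    (fun p => (cbasis c p *m metric p *m (cbasis c p)^T) i j);
  tfield : vfield mfd;
  tfield_smooth : smooth_vfield setT tfield;
  tfield_timelike : forall p, (tfield p *m metric p *m (tfield p)^T) 0 0 < 0
}.
Arguments metric {R l}.

Section Lorentz.
Variables (R : realType) (M : lorentz3 R).
Implicit Types (p : M) (c : chart M) (u : form1 M).

Definition cometric p (a b : 'cV[R]_3) : R := (a^T *m invmx (metric p) *m b) 0 0.

Definition coord_metric c p : 'M[R]_3 :=
  cbasis c p *m metric p *m (cbasis c p)^T.

Definition partial c (i : 'I_3) (f : M -> R) p : R :=
  'D_(delta_mx 0 i) (f \o cinv c) (cmap c p).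

Definition christoffel c (k i j : 'I_3) p : R :=
  2^-1 * \sum_l invmx (coord_metric c p) k l *
    (partial c i (fun q => coord_metric c q j l) p
     + partial c j (fun q => coord_metric c q i l) p
     - partial c l (fun q => coord_metric c q i j) p).

(* Components (nabla_i u)_j in the chart c. *)
Definition coord_nabla c u p : 'M[R]_3 :=
  \matrix_(i, j) (partial c i (fun q => (cbasis c q *m u q) j 0) p
    - \sum_k christoffel c k i j p * (cbasis c p *m u p) k 0).

(* The (0,2)-tensor nabla^g u, with (nabla^g u)(w, v) = (nabla^g_w u)(v), as
   its matrix on the tangent space at p. *)
Definition nabla u p : 'M[R]_3 := coord_nabla (chart_at p) u p.

(* The covector nabla^g_w u. *)
Definition nabla_along u p (w : 'rV[R]_3) : 'cV[R]_3 := (w *m nabla u p)^T.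

Definition vol p (x y z : 'rV[R]_3) : R :=
  Num.sqrt (- \det (metric p)) *
    \det (\matrix_(a < 3) nth 0 [:: x; y; z] a : 'M[R]_3).

(* On one-forms the Hodge star is the contraction of the volume form with the
   metric dual of the one-form. *)
Definition hodge1 u p : 'M[R]_3 :=
  \matrix_(i, j) vol p (invmx (metric p) *m u p)^T (delta_mx 0 i) (delta_mx 0 j).

Definition isotropic u : Prop := forall p, cometric p (u p) (u p) = 0.

End Lorentz.

(* Spin(2,1) inside the even part of Cl(2,1), with v^2 = q(v).  It is realised
   in an irreducible two-dimensional representation of Cl(2,1), which is
   faithful on the even part: the [gam a] anticommute and square to eta. *)
Section SpinGroup.
Variable R : realType.

Definition mx2 (a b c d : R) : 'M[R]_2 :=
  \matrix_(i, j) nth 0 (nth [::] [:: [:: a; b]; [:: c; d]] i) j.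

Definition gam (a : 'I_3) : 'M[R]_2 :=
  nth 0 [:: mx2 0 1 1 0; mx2 1 0 0 (-1); mx2 0 1 (-1) 0] a.

Definition gamv (v : 'rV[R]_3) : 'M[R]_2 := \sum_a v 0 a *: gam a.

Definition qstd (v : 'rV[R]_3) : R := \sum_a eta R a * v 0 a ^+ 2.

Definition Spin21 : set 'M[R]_2 := [set h | exists s : seq 'rV[R]_3,
  [/\ ~~ odd (size s),
      forall v, v \in s -> qstd v = 1 \/ qstd v = -1 &
      h = \prod_(v <- s) gamv v]].

Definition Spin21_0 : set 'M[R]_2 := connected_component Spin21 1.

(* The covering Spin(2,1) -> SO(2,1):
   h (gam b) h^-1 = \sum_a (lam h a b) gam a, using tr(gam a gam b) = 2 eta_ab. *)
Definition lam (h : 'M[R]_2) : 'M[R]_3 :=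
  \matrix_(a, b) (eta R a * 2^-1 * \tr (gam a *m h *m gam b *m invmx h)).

End SpinGroup.

Section Spin.
Variables (R : realType) (M : lorentz3 R).
Implicit Types (U : set M).

(* The rows of E form a positively oriented orthonormal frame at p. *)
Definition oriented_orthonormal (p : M) (E : 'M[R]_3) : Prop :=
  E *m metric p *m E^T = eta_mx R /\ 0 < \det E.

Definition smooth_mx2 U (h : M -> 'M[R]_2) : Prop :=
  forall i j, smooth_on U (fun p => h p i j).

(* A principal Spin(2,1)-bundle with an equivariant map to the bundle of
   oriented orthonormal frames, its smooth structure being given by a
   trivialising family of local sections [sps_sec] with smooth transition
   functions.  [sps_act p q h] is only meaningful for h in Spin(2,1). *)
Record spin_structure := SpinStructure {
  sps_fib : M -> Type;
  sps_act : forall p, sps_fib p -> 'M[R]_2 -> sps_fib p;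
  sps_frame : forall p, sps_fib p -> 'M[R]_3;
  sps_idx : Type;
  sps_dom : sps_idx -> set M;
  sps_sec : sps_idx -> forall p, sps_fib p;
  sps_act1 : forall p (q : sps_fib p), sps_act q 1 = q;
  sps_actM : forall p (q : sps_fib p) h h', Spin21 h -> Spin21 h' ->
    sps_act q (h * h') = sps_act (sps_act q h) h';
  sps_torsor : forall p (q q' : sps_fib p),
    exists! h, Spin21 h /\ q' = sps_act q h;
  sps_frameP : forall p (q : sps_fib p), oriented_orthonormal p (sps_frame q);
  sps_equivariant : forall p (q : sps_fib p) h, Spin21 h ->
    sps_frame (sps_act q h) = (lam h)^T *m sps_frame q;
  sps_dom_open : forall i, open (sps_dom i);
  sps_dom_cover : forall p, exists i, sps_dom i p;
  sps_frame_smooth : forall i a, smooth_vfield (sps_dom i)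
    (fun p => row a (sps_frame (sps_sec i p)));
  sps_transition : forall i j, exists h : M -> 'M[R]_2,
    smooth_mx2 (sps_dom i `&` sps_dom j) h /\
    forall p, sps_dom i p -> sps_dom j p ->
      Spin21 (h p) /\ sps_sec j p = sps_act (sps_sec i p) (h p)
}.

Definition sps_smooth_section (P : spin_structure) U
    (s : forall p, sps_fib P p) : Prop :=
  forall i : sps_idx P, exists h : M -> 'M[R]_2,
    smooth_mx2 (U `&` sps_dom i) h /\
    forall p, U p -> sps_dom i p ->
      Spin21 (h p) /\ s p = sps_act (sps_sec i p) (h p).

(* Existence of a principal Spin_0(2,1)-subbundle. *)
Definition reduces_to_Spin0 (P : spin_structure) : Prop :=
  exists P0 : forall p, set (sps_fib P p),
    (forall p (q q' : sps_fib P p), P0 p q ->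
       (P0 p q' <-> exists2 h, Spin21_0 h & q' = sps_act q h)) /\
    (forall p, exists U (s : forall p, sps_fib P p),
       [/\ open U, U p, sps_smooth_section U s & forall q, U q -> P0 q (s q)]).

Definition strongly_spin : Prop :=
  (exists P : spin_structure, True) /\
  (forall P : spin_structure, reduces_to_Spin0 P).

(* Real vector bundles of rank n, trivialised by local frames. *)
Record vbundle (n : nat) := VBundle {
  fib :> M -> vectType R;
  vb_idx : Type;
  vb_dom : vb_idx -> set M;
  vb_frame : vb_idx -> forall p, 'I_n -> fib p;
  vb_dom_open : forall i, open (vb_dom i);
  vb_dom_cover : forall p, exists i, vb_dom i p;
  vb_frame_basis : forall i p, vb_dom i p ->
    basis_of fullv [seq vb_frame i p k | k <- enum 'I_n];
  vb_transition : forall i j, exists A : M -> 'M[R]_n,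
    (forall k l, smooth_on (vb_dom i `&` vb_dom j) (fun p => A p k l)) /\
    forall p, vb_dom i p -> vb_dom j p -> forall l,
      vb_frame j p l = \sum_k A p k l *: vb_frame i p k
}.

Definition smooth_section n (S : vbundle n) U (s : forall p, S p) : Prop :=
  forall i : vb_idx S, exists x : 'I_n -> M -> R,
    (forall k, smooth_on (U `&` vb_dom i) (x k)) /\
    forall p, U p -> vb_dom i p -> s p = \sum_k x k p *: vb_frame i p k.

(* Irreducible paired spinor bundles; [cl p a] is Clifford multiplication by
   the covector a. *)
Record paired_spinor_bundle := PairedSpinorBundle {
  sbundle :> vbundle 2;
  cl : forall p, 'cV[R]_3 -> sbundle p -> sbundle p;
  pairing : forall p, sbundle p -> sbundle p -> R;
  cl_linearl : forall p t (a b : 'cV[R]_3) (x : sbundle p),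
    cl (t *: a + b) x = t *: cl a x + cl b x;
  cl_linearr : forall p t (a : 'cV[R]_3) (x y : sbundle p),
    cl a (t *: x + y) = t *: cl a x + cl a y;
  cl_clifford : forall p (a : 'cV[R]_3) (x : sbundle p),
    cl a (cl a x) = cometric p a a *: x;
  cl_irreducible : forall p (W : {vspace sbundle p}),
    (forall a x, x \in W -> cl a x \in W) -> W = 0%VS \/ W = fullv;
  cl_smooth : forall U (u : form1 M) (s : forall p, sbundle p), open U ->
    smooth_form1 U u -> smooth_section U s ->
    smooth_section U (fun p => cl (u p) (s p));
  pairing_linear : forall p t (x y z : sbundle p),
    pairing (t *: x + y) z = t * pairing x z + pairing y z;
  pairing_skew : forall p (x y : sbundle p), pairing x y = - pairing y x;
  pairing_nondeg : forall p (x : sbundle p),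
    (forall y, pairing x y = 0) -> x = 0;
  pairing_smooth : forall U (s t : forall p, sbundle p), open U ->
    smooth_section U s -> smooth_section U t ->
    smooth_on U (fun p => pairing (s p) (t p));
  pairing_cl : forall p (a : 'cV[R]_3) (x y : sbundle p),
    pairing (cl a x) y = - pairing x (cl a y)
}.

Section SpinorDerivative.
Variable S : paired_spinor_bundle.

(* A smooth orthonormal coframe e and a smooth frame s of S on U in which
   Clifford multiplication by the e^a and the pairing have constant
   coefficients, i.e. s comes from a local section, over the coframe e, of the
   spin structure to which S is associated. *)
Definition adapted_frame U (e : 'I_3 -> form1 M)
    (s : 'I_2 -> forall p, S p) : Prop :=
  [/\ (forall a, smooth_form1 U (e a)) /\
      (forall p a b, U p -> cometric p (e a p) (e b p) = eta_mx R a b),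
      (forall k, smooth_section U (s k)) /\
      (forall p, U p -> basis_of fullv [seq s k p | k <- enum 'I_2]),
      exists Gam : 'I_3 -> 'M[R]_2, forall p a l, U p ->
        cl (e a p) (s l p) = \sum_k Gam a k l *: s k p &
      exists Om : 'M[R]_2, forall p k l, U p ->
        pairing (s k p) (s l p) = Om k l].

(* Connection forms omega_ab(w) of the Levi-Civita connection, with
   nabla_w e^a = - \sum_b omega^a_b(w) e^b and indices lowered by eta. *)
Definition conn_form (e : 'I_3 -> form1 M) p (w : 'rV[R]_3) (a b : 'I_3) : R :=
  - (eta R a * eta R b * cometric p (nabla_along (e a) p w) (e b p)).

(* [spin_nabla eps w y]: the derivative at p, along the tangent vector w, of
   the section eps for the lift to S of the Levi-Civita connection is y.  In an
   adapted frame the lift is d + 1/4 omega_ab e^a . e^b . *)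
Definition spin_nabla (eps : forall p, S p) (p : M) (w : 'rV[R]_3)
    (y : S p) : Prop :=
  exists U (e : 'I_3 -> form1 M) (s : 'I_2 -> forall p, S p)
      (x : 'I_2 -> M -> R),
    [/\ open U /\ U p, adapted_frame U e s,
        forall k, smooth_on U (x k),
        forall q, U q -> eps q = \sum_k x k q *: s k q &
        y = \sum_k deriv_along (x k) p w *: s k p
            + 4^-1 *: \sum_a \sum_b
                conn_form e p w a b *: cl (e a p) (cl (e b p) (eps p))].

(* Clifford multiplication by a two-form, a /\ b acting as (ab - ba)/2; the
   double sum does not depend on the basis used. *)
Definition cl2 (p : M) (F : 'rV[R]_3 -> 'rV[R]_3 -> R) (x : S p) : S p :=
  2^-1 *: \sum_(a < 3) \sum_(b < 3) F (delta_mx 0 a) (delta_mx 0 b) *: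
    cl (delta_mx a 0) (cl (delta_mx b 0) x).

(* nabla^g_w eps + 1/4 (i_w H) . eps = 0 for all w. *)
Definition skew_torsion_parallel (eps : forall p, S p) (H : form3 M) : Prop :=
  forall p (w : 'rV[R]_3), exists2 y : S p,
    spin_nabla eps w y & y + 4^-1 *: cl2 (H p w) (eps p) = 0.

Definition skew_torsion_parallel_spinor (eps : forall p, S p) : Prop :=
  [/\ smooth_section setT eps,
      exists p, eps p != 0 &
      exists2 H : form3 M, smooth_form3 H & skew_torsion_parallel eps H].

End SpinorDerivative.

Definition admits_skew_torsion_parallel_spinor : Prop :=
  exists (S : paired_spinor_bundle) (eps : forall p, S p),
    skew_torsion_parallel_spinor eps.

End Spin.

(* Main.v *)
From HB Require Import structures.
Require Import Defs.
From mathcomp Require Import all_boot all_order all_algebra.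
From mathcomp Require Import all_classical all_reals all_analysis.
From mathcomp Require Import ring lra.
Set Implicit Arguments.
Unset Strict Implicit.
Unset Printing Implicit Defensive.
Import Order.TTheory GRing.Theory Num.Theory.
Import numFieldNormedType.Exports.
Local Open Scope classical_set_scope.
Local Open Scope ring_scope.

(* A spinor eps determines a null one-form u = <eps, . eps>, its Dirac current.
   If eps is parallel for the connection with torsion H = h vol, then so is u,
   which means nabla u = - h/2 *u; in dimension three no sign depending on the
   representation survives, because only commutators of even elements with
   one-forms enter. That u is null is the completeness relation for three
   orthonormal traceless 2x2 matrices, and u = 0 only where eps = 0. The
   equation nabla u = f *u is a linear first order system, so on a connected
   manifold u vanishes nowhere unless it vanishes identically; here the tensor
   character of nabla u under changes of charts is needed.

   Conversely a nowhere vanishing null form u and the time orientation give a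
   global orthonormal coframe with u = e^0 + e^2. On the trivial bundle R^2,
   with the gamma matrices acting through this coframe, the constant spinor eps
   annihilated by gam 0 + gam 2 has Dirac current u. For H = - 2 f vol the
   equation nabla u = f *u says that the connection forms of the connection
   with torsion annihilate u, hence multiply eps by a multiple of
   (gam 0 + gam 2) gam 1, which kills it. *)

(** * Differentiation along lines *)

(** Tangent and cotangent spaces at p are read in the coordinates of [chart_at p], and this choice
    need not vary continuously with p. Fields are therefore never differentiated as they stand:
    smoothness is tested on components in a fixed chart, and [cbasis] carries pointwise identities
    between the two descriptions. Since [nabla u p] is itself computed in [chart_at p], reading the
    equation for u as a differential system near a point requires the transformation law of the
    Levi-Civita derivative. That law is obtained without transforming the formula for the
    Christoffel symbols: the transformed symbols are again symmetric and compatible with the metric,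
    and these two properties determine them. Symmetry rests on commuting partial derivatives; as C^k
    is defined by partial derivatives alone, Frechet differentiability and Schwarz's theorem come
    first. The ratio -1/2 between f and the torsion density comes from the factor 1/2 in the
    Clifford action of a two-form: the connection with torsion has the forms omega + (1/2) i_w H. *)

Section LineCalculus.
Context {R : realType} {V : normedModType R}.
Implicit Types (f : V -> R) (z v : V).

Lemma is_derive_line f z v t : derivable f (t *: v + z) v ->
  is_derive t 1 (fun s : R => f (s *: v + z)) ('D_v f (t *: v + z)).
Proof.
move=> df.
have E : (fun h : R => h^-1 *: (((fun s : R =>
    f (s *: v + z)) \o shift t) (h *: 1) - f (t *: v + z)))
   = (fun h : R => h^-1 *: ((f \o shift (t *: v + z)) (h *: v) - f (t *: v + z))).
  by apply/funext => h /=; rewrite scalerDl addrA [h *: 1]mulr1.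
by split; rewrite /derivable /derive ?E.
Qed.

Lemma derivable_scale f z v a : derivable f z v ->
  derivable f z (a *: v) /\ 'D_(a *: v) f z = a * 'D_v f z.
Proof.
move=> df.
have d0 : is_derive (0:R) 1 (fun s : R => f (s *: v + z)) ('D_v f z).
  by have := @is_derive_line f z v 0; rewrite scale0r add0r; apply.
have dd : differentiable (fun s : R => f (s *: v + z)) (a * 0).
  by rewrite mulr0; apply/derivable1_diffP; apply: ex_derive.
have dl : differentiable (fun s : R => a * s) (0:R).
  apply/derivable1_diffP; apply: derivableZ; exact: derivable_id.
have E : (fun s : R => f (s *: (a *: v) + z)) =
    (fun s : R => f (s *: v + z)) \o (fun s => a * s).
  by apply/funext => s /=; rewrite scalerA mulrC.
have [dE1 dE2] : is_derive (0:R) 1 (fun s : R => f (s *: (a *: v) + z)) (a * 'D_v f z).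
  rewrite E; split.
    by apply/derivable1_diffP; apply: differentiable_comp.
  rewrite -derive1E derive1_comp; [|exact/derivable1_diffP|exact/derivable1_diffP].
  rewrite mulrC !derive1E mulr0; congr (_ * _); last by apply: derive_val.
  have -> : (fun s : R => a * s) = a \*: (id : R -> R) by [].
  by rewrite deriveZ ?derive_id; [rewrite [LHS]mulr1 | exact: derivable_id].
have d1 : derivable f z (a *: v) by apply/derivable1P.
split=> //.
have d1' : derivable f (0 *: (a *: v) + z) (a *: v) by rewrite scale0r add0r.
have [_] := is_derive_line d1'.
by rewrite dE2 scale0r add0r.
Qed.

Lemma MVT_line f z v :
  (forall t : R, t \in `[0, 1] -> derivable f (t *: v + z) v) ->
  exists2 t : R, t \in `[0, 1] & f (v + z) - f z = 'D_v f (t *: v + z).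
Proof.
move=> df.
have [||c c01 H] := @MVT_segment R (fun s : R => f (s *: v + z))
  (fun t => 'D_v f (t *: v + z)) 0 1 ler01.
- move=> x x01; apply: is_derive_line; apply: df.
  by move: x01; rewrite !in_itv /= => /andP[/ltW -> /ltW ->].
- apply: derivable_within_continuous => x x01.
  by have [] := is_derive_line (df x x01).
exists c => //; move: H; by rewrite scale1r scale0r add0r subr0 mulr1.
Qed.

End LineCalculus.

(** * Frechet differentiability from continuous partial derivatives *)

Section RowCalculus.
Context {R : realType}.
Implicit Types (f : 'rV[R]_3 -> R) (x h v : 'rV[R]_3) (U V : set 'rV[R]_3).

Lemma row3_sum_delta h :
  h = h 0 0 *: delta_mx 0 0 + h 0 1 *: delta_mx 0 1
      + h 0 2%:R *: delta_mx 0 2%:R :> 'rV[R]_3.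
Proof.
rewrite {1}[h]row_sum_delta !big_ord_recl big_ord0 addr0 addrA.
by congr (_ + _ *: delta_mx 0 _ + _ *: delta_mx 0 _); try congr (h 0 _); apply/val_inj.
Qed.

Lemma row3_norm_le h e : 0 <= e -> (forall i, `|h 0 i| <= e) -> `|h| <= e.
Proof.
move=> e0 He; rewrite [`|h|]mx_normrE; apply: bigmax_le => // -[i j] _ /=.
by rewrite ord1.
Qed.

Lemma row3_entry_le h i : `|h 0 i| <= `|h|.
Proof. by rewrite [`|h|]mx_normrE; apply: (le_bigmax _ _ (0, i)). Qed.

(** The displacement h is split into three moves parallel to the axes. The mean value theorem on
    each move, with partial derivatives within e/3 of their values at x, bounds the total error by e
    |h|. *)
Lemma C1_differentiable f x :
  (forall i, \forall y \near x, derivable f y (delta_mx 0 i)) ->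
  (forall i, {for x, continuous (fun y => 'D_(delta_mx 0 i) f y)}) ->
  differentiable f x.
Proof.
move=> df cf.
pose G : 'cV[R]_3 := \col_i 'D_(delta_mx 0 i) f x.
pose L := fun h : 'rV[R]_3 => (h *m G) 0 0.
have linL : linear L by move=> a u v; rewrite /L mulmxDl -scalemxAl !mxE.
pose sxlM := GRing.isLinear.Build _ _ _ _ _ linL.
pose sL : {linear 'rV[R]_3 -> R} := HB.pack L sxlM.
have LE h : L h = h 0 0 * G 0 0 + h 0 1 * G 1 0 + h 0 2%:R * G 2%:R 0.
  rewrite /L mxE !big_ord_recl big_ord0 addr0 addrA.
  by congr (_ + h 0 _ * G _ 0 + h 0 _ * G _ 0); apply/val_inj.
have contL : continuous sL.
  move=> y; apply: (@differentiable_continuous _ _ _ y (L : 'rV[R]_3 -> R)).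
  rewrite (_ : L = fun h : 'rV[R]_3 =>
      h 0 0 * G 0 0 + h 0 1 * G 1 0 + h 0 2%:R * G 2%:R 0); last exact/funext.
  by do !apply: differentiableD => //; apply: differentiableM =>
      //; exact: differentiable_coord.
have uniq := @diff_unique _ _ _ f sL x contL.
have main : f \o shift x = cst (f x) + (sL : _ -> _) +o_ (0 : 'rV[R]_3) id.
  apply/eqaddoP => _/posnumP[e].
  have e3 : 0 < e%:num / 3 :> R by rewrite divr_gt0.
  have near_i i : \forall y \near x, derivable f y (delta_mx 0 i) /\
      `|'D_(delta_mx 0 i) f y - G i 0| <= e%:num / 3.
    near=> y; split; first by near: y; exact: df.
    rewrite distrC mxE; near: y.
    exact: (cvgrPdist_le _ _).1 (cf i) _ e3.
  have /nbhs_ballP[r /= r0 Hr] : \forall y \near x, forall i, derivable f y (delta_mx 0 i) /\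
      `|'D_(delta_mx 0 i) f y - G i 0| <= e%:num / 3.
    exact: (@filter_forall _ 'I_3 (fun i y => derivable f y (delta_mx 0 i) /\
      `|'D_(delta_mx 0 i) f y - G i 0| <= e%:num / 3) (nbhs x) _ near_i).
  apply/nbhs_ballP; exists r => //= h.
  rewrite -ball_normE /= sub0r normrN => hr.
  (* One move along axis i from z. The hypothesis keeps the segment within |h| of x in the sup norm,
     hence in the ball where the partial derivatives are controlled. *)
  have step z i (a : R) : (forall t : R, t \in `[0, 1] ->
      `|t *: (a *: delta_mx 0 i : 'rV[R]_3) + z - x| <= `|h|) ->
      `|a| <= `|h| ->
      `|f (a *: delta_mx 0 i + z) - f z - a * G i 0| <= e%:num / 3 * `|h|.
    move=> zt ah.
    have Hb t : t \in `[0, 1] -> ball x r (t *: (a *: delta_mx 0 i) + z).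
      by move=> /zt zth; rewrite -ball_normE /= distrC (le_lt_trans zth).
    have [|t t01 ->] := @MVT_line _ _ f z (a *: delta_mx 0 i).
      by move=> t /Hb /Hr /(_ i)[+ _] => /(@derivable_scale _ _ _ _ _ a)[].
    have [dt bt] := Hr _ (Hb t t01) i.
    rewrite (derivable_scale a dt).2 -mulrBr normrM mulrC.
    by apply: ler_pM.
  have E : f (h + x) - f x - L h =
     (f (h 0 0 *: delta_mx 0 0 + x) - f x - h 0 0 * G 0 0)
     + (f (h 0 1 *: delta_mx 0 1 + (h 0 0 *: delta_mx 0 0 +
         x)) - f (h 0 0 *: delta_mx 0 0 + x) - h 0 1 * G 1 0)
     + (f (h 0 2%:R *: delta_mx 0 2%:R + (h 0 1 *: delta_mx 0 1 + (h 0 0 *: delta_mx 0 0 +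
         x))) - f (h 0 1 *: delta_mx 0 1 + (h 0 0 *: delta_mx 0 0 + x)) - h 0 2%:R * G 2%:R 0).
    rewrite LE {1}[h]row3_sum_delta.
    have -> : h 0 2%:R *: delta_mx 0 2%:R + (h 0 1 *: delta_mx 0 1 +
        (h 0 0 *: delta_mx 0 0 + x))
      = h 0 0 *: delta_mx 0 0 + h 0 1 *: delta_mx 0 1 + h 0 2%:R *: delta_mx 0 2%:R +
          x :> 'rV[R]_3.
      by apply/rowP => j; rewrite !mxE; ring.
    by ring.
  rewrite [leLHS](_ : _ = `|f (h + x) - f x - L h|); last first.
    by rewrite /= -[in RHS]addrA -opprD.
  rewrite E.
  have -> : e%:num * `|id h| = e%:num / 3 * `|h| + e%:num / 3 * `|h| +
      e%:num / 3 * `|h| by rewrite /=; field.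
  have hle i : `|h 0 i| <= `|h| := row3_entry_le h i.
  have tle (t : R) i : t \in `[0, 1] -> `|t * h 0 i| <= `|h|.
    rewrite in_itv /= => /andP[t0 t1]; rewrite normrM (ger0_norm t0).
    by apply: le_trans (hle i); rewrite ler_piMl.
  apply: le_trans (ler_normD _ _) _; apply: lerD.
    apply: le_trans (ler_normD _ _) _; apply: lerD.
      apply: step => // t t01; rewrite addrK; apply: row3_norm_le => // i.
      rewrite !mxE; case: (i == 0); rewrite ?mulr1 ?mulr0 ?normr0 //; exact: tle.
    apply: step => // t t01; rewrite addrA addrK; apply: row3_norm_le => // i.
    rewrite !mxE /=; case: i => -[|[|[|//]]] Hi /=;
        rewrite ?mulr1 ?mulr0 ?addr0 ?add0r ?normr0 //.
    by apply: tle.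
  apply: step => // t t01; rewrite !addrA addrK; apply: row3_norm_le => // i.
  rewrite !mxE /=; case: i => -[|[|[|//]]] Hi /=; rewrite ?mulr1 ?mulr0 ?addr0 ?add0r;
      try exact: hle.
  by apply: tle.
apply/diff_locallyP; rewrite (uniq main); split => //.
Unshelve. all: by end_near. Qed.

End RowCalculus.

(** * Functions of class C^k *)

Lemma near_open (T : topologicalType) (V : set T) x :
  open V -> V x -> \forall y \near x, V y.
Proof. by move=> oV Vx; apply: open_nbhs_nbhs. Qed.

Lemma near_eq_open (T : topologicalType) (S : Type) (V : set T) (f g : T -> S) x :
  open V -> V x -> (forall y, V y -> f y = g y) -> {near x, f =1 g}.
Proof.
by move=> oV Vx fg; apply: filterS (near_open oV Vx) => y /fg.
Qed.

Section CkTheory.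
Context {R : realType}.
Implicit Types (f g : 'rV[R]_3 -> R) (x h v : 'rV[R]_3) (U V W : set 'rV[R]_3).

Lemma Ck_cont k V f x : Ck k V f -> V x -> {for x, continuous f}.
Proof. by case: k => [|k] [cf _]; apply: cf. Qed.

Lemma Ck_S k V f : Ck k.+1 V f -> Ck k V f.
Proof.
elim: k f => [|k IH] f [cf Df]; split=> // i.
by have [dfi Ci] := Df i; split=> //; apply: IH.
Qed.

Lemma Ck_subset k U V f : U `<=` V -> Ck k V f -> Ck k U f.
Proof.
move=> UV; elim: k f => [|k IH] f [cf Df]; split=> //;
  do ?by [move=> x /UV; exact: cf].
move=> i.
by have [dfi Ci] := Df i; split=> [x /UV/dfi//|]; apply: IH.
Qed.

Lemma Ck_local k V f :
  (forall x, V x -> exists W, [/\ open W, W x & Ck k W f]) -> Ck k V f.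
Proof.
elim: k f => [|k IH] f loc; split=> //;
  do ?by [move=> x /loc[W [_ Wx [+ _]]]; apply].
move=> i; split; first by move=> x /loc[W [_ Wx [_ /(_ i)[+ _]]]]; apply.
by apply: IH => x /loc[W [oW Wx [_ /(_ i)[_ CW]]]]; exists W.
Qed.

Lemma Ck_eq k V f g : open V -> (forall x, V x -> f x = g x) ->
  Ck k V f -> Ck k V g.
Proof.
move=> oV; elim: k f g => [|k IH] f g fg [cf Df]; (split=> [x Vx|]; first by
    have := cf x Vx; rewrite /prop_for /continuous_at (fg x Vx); apply: cvg_trans;
    apply: (@near_eq_cvg _ _ (nbhs x)); exact: near_eq_open oV Vx fg) => //.
move=> i.
have [dfi Ci] := Df i; split=> [x Vx|].
  exact: near_eq_derivable (near_eq_open oV Vx fg) (dfi x Vx).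
apply: IH Ci => x Vx; exact: near_eq_derive (near_eq_open oV Vx fg).
Qed.

Lemma Ck_cst k V (a : R) : Ck k V (fun=> a).
Proof.
elim: k a => [|k IH] a; split=> //; do ?by [move=> x _; exact: cst_continuous].
move=> i; split=> [x _|]; first exact: derivable_cst.
suff <- : (fun=> 0) = (fun x => 'D_(delta_mx 0 i) (fun=> a) x) by exact: IH.
by apply/funext => x; rewrite derive_cst.
Qed.

Lemma Ck_D k V f g : open V -> Ck k V f -> Ck k V g -> Ck k V (fun x => f x + g x).
Proof.
move=> oV; elim: k f g => [|k IH] f g [cf Df] [cg Dg]; split=> //;
  do ?by [move=> x Vx; apply: continuousD; [exact: cf|exact: cg]].
move=> i; have [dfi Cfi] := Df i; have [dgi Cgi] := Dg i; split=> [x Vx|].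
  by apply: derivableD; [exact: dfi|exact: dgi].
apply: Ck_eq (IH _ _ Cfi Cgi) => // x Vx.
by rewrite deriveD //; [exact: dfi|exact: dgi].
Qed.

Lemma Ck_M k V f g : open V -> Ck k V f -> Ck k V g -> Ck k V (fun x => f x * g x).
Proof.
move=> oV; elim: k f g => [|k IH] f g Cf Cg; have [cf Df] := Cf; have [cg Dg] := Cg; split=> //;
  do ?by [move=> x Vx; apply: continuousM; [exact: cf|exact: cg]].
move=> i; have [dfi Cfi] := Df i; have [dgi Cgi] := Dg i; split=> [x Vx|].
  by apply: derivableM; [exact: dfi|exact: dgi].
apply: Ck_eq (Ck_D oV (IH _ _ (Ck_S Cf) Cgi) (IH _ _ (Ck_S Cg) Cfi)) => // x Vx.
by rewrite deriveM //; [exact: dfi|exact: dgi].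
Qed.

(** The derivative is - f' (1/f) (1/f), a product to which the induction hypothesis for 1/f
    applies. *)
Lemma Ck_V k V f : open V -> (forall x, V x -> f x != 0) ->
  Ck k V f -> Ck k V (fun x => (f x)^-1).
Proof.
move=> oV f0; elim: k f f0 => [|k IH] f f0 Cf; have [cf Df] := Cf; split=> //;
  do ?by [move=> x Vx; apply: continuousV; [exact: f0|exact: cf]].
move=> i; have [dfi Cfi] := Df i; split=> [x Vx|].
  by apply: derivableV; [exact: f0|exact: dfi].
have C1 := IH _ f0 (Ck_S Cf).
apply: Ck_eq (Ck_M oV (Ck_cst k V (-1)) (Ck_M oV Cfi (Ck_M oV C1 C1))) => // x Vx.
rewrite deriveV //; [|exact: f0|exact: dfi].
by rewrite -exprVn expr2 mulN1r scaleNr [_ *: _]mulrC.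
Qed.

(** As f is only derivable along v, the chain rule is applied to its restriction to a line. *)
Lemma derive_sqrt_comp f x v : 0 < f x -> derivable f x v ->
  derivable (fun y => Num.sqrt (f y)) x v /\
  'D_v (fun y => Num.sqrt (f y)) x = (2 * Num.sqrt (f x))^-1 * 'D_v f x.
Proof.
move=> f0 dfx.
have dfx0 : derivable f ((0:R) *: v + x) v by rewrite scale0r add0r.
have [d0 d0E] := is_derive_line dfx0.
have [dsq dsqE] := is_derive1_sqrt f0.
have E : (fun s : R => Num.sqrt (f (s *: v + x))) = (@Num.sqrt R) \o (fun s : R =>
    f (s *: v + x)).
  exact/funext.
have dsq' : derivable (@Num.sqrt R) (f ((0:R) *: v + x)) 1.
  by rewrite scale0r add0r; exact: dsq.
have dE1 : derivable (fun s : R => Num.sqrt (f (s *: v + x))) 0 1.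
  rewrite E; apply/derivable1_diffP; apply: differentiable_comp.
    exact: (derivable1_diffP _ _).1 d0.
  exact: (derivable1_diffP _ _).1 dsq'.
have dE2 : 'D_1 (fun s : R => Num.sqrt (f (s *: v + x))) 0 = (2 * Num.sqrt (f x))^-1 * 'D_v f x.
  rewrite E -derive1E derive1_comp; [|exact: d0|exact: dsq'].
  by rewrite !derive1E d0E scale0r add0r dsqE.
have d1 : derivable (fun y => Num.sqrt (f y)) x v by apply/derivable1P.
split=> //.
have d1' : derivable (fun y => Num.sqrt (f y)) (0 *: v + x) v by rewrite scale0r add0r.
by have [_] := is_derive_line d1'; rewrite dE2 scale0r add0r.
Qed.

Lemma Ck_sqrt k V f : open V -> (forall x, V x -> 0 < f x) ->
  Ck k V f -> Ck k V (fun x => Num.sqrt (f x)).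
Proof.
move=> oV f0; elim: k f f0 => [|k IH] f f0 Cf; have [cf Df] := Cf; split=> //;
  do ?by [move=> x Vx; apply: continuous_comp; [exact: cf|exact: sqrt_continuous]].
move=> i; have [dfi Cfi] := Df i; split=> [x Vx|].
  by have [] := derive_sqrt_comp (f0 _ Vx) (dfi x Vx).
have C1 := IH _ f0 (Ck_S Cf).
apply: Ck_eq (Ck_M oV (Ck_V oV _ (Ck_M oV (Ck_cst k V 2) C1)) Cfi) => // x Vx.
  by rewrite (derive_sqrt_comp (f0 _ Vx) (dfi x Vx)).2.
by rewrite mulf_neq0 ?pnatr_eq0 // gt_eqF // sqrtr_gt0 f0.
Qed.

Lemma Ck_differentiable k V f x : open V -> Ck k.+1 V f -> V x -> differentiable f x.
Proof.
move=> oV [cf Df] Vx; apply: C1_differentiable => i.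
  by have [dfi _] := Df i; apply: filterS (near_open oV Vx).
by have [_ Ci] := Df i; apply: Ck_cont Ci Vx.
Qed.

(* Both iterated partial derivatives are values, near x, of the same second
   difference divided by s ^+ 2. *)
Lemma Schwarz V f x (i j : 'I_3) : open V -> Ck 2 V f -> V x ->
  'D_(delta_mx 0 i) (fun y => 'D_(delta_mx 0 j) f y) x =
  'D_(delta_mx 0 j) (fun y => 'D_(delta_mx 0 i) f y) x.
Proof.
move=> oV Cf Vx; have [cf Df] := Cf.
pose d k : 'rV[R]_3 := delta_mx 0 k.
have key k l (e : R) : 0 < e -> \forall s \near (0 : R), 0 < s ->
    exists y, `|'D_(d k) (fun y => 'D_(d l) f y) x - 'D_(d k) (fun y => 'D_(d l) f y) y| < e /\
     f (s *: d k + (s *: d l + x)) - f (s *: d l + x) - f (s *: d k + x) + f x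
       = s * (s * 'D_(d k) (fun y => 'D_(d l) f y) y).
  move=> e0.
  have [dfl [cfl Dfl]] := Df l; have [dfkl Cfkl] := Dfl k.
  have nx : \forall y \near x, V y /\
      `|'D_(d k) (fun y => 'D_(d l) f y) x - 'D_(d k) (fun y => 'D_(d l) f y) y| < e.
    near=> y; split; first by near: y; exact: (near_open oV Vx).
    near: y; exact: (cvgrPdist_lt _ _).1 (Cfkl.1 x Vx) _ e0.
  have /nbhs_ballP[r /= r0 Hr] := nx.
  have dn k' : `|d k'| <= 1.
    by apply: row3_norm_le => // i'; rewrite mxE; case: (_ && _); rewrite ?normr1 ?normr0.
  near=> s => s0.
  (* Each side of the parallelogram spanned by s d_k and s d_l has length at most s, so the whole of
     it lies in the ball of radius r. *)
  have sr : s < r / 2.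
    rewrite -[ltLHS](gtr0_norm s0); near: s.
    have := @nbhs0_lt R R (r / 2); rewrite divr_gt0 //; exact.
  have inb (a b : R) k' l' : 0 <= a <= 1 -> 0 <= b <= 1 ->
      ball x r (a *: (s *: d k') + (b *: (s *: d l') + x)).
    move=> /andP[a0 a1] /andP[b0 b1]; rewrite -ball_normE /= distrC addrA addrK.
    apply: le_lt_trans (ler_normD _ _) _.
    rewrite !normrZ !(ger0_norm a0) !(ger0_norm b0) !(gtr0_norm s0).
    have : a * (s * `|d k'|) <= s by rewrite -[leRHS]mul1r ler_pM ?mulr_ge0 ?(ltW s0) //
        ger_pMr.
    have : b * (s * `|d l'|) <= s by rewrite -[leRHS]mul1r ler_pM ?mulr_ge0 ?(ltW s0) //
        ger_pMr.
    move: sr; lra.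
  (* The second difference is the increment of [phi] from x to s d_l + x. The mean value theorem
     along d_l turns it into a difference of first derivatives, and a second application along d_k
     gives the mixed derivative. *)
  pose phi y := f (s *: d k + y) - f y.
  have shiftd y : V y -> V (s *: d k + y) ->
      derivable (fun y => f (s *: d k + y)) y (d l) /\ 'D_(d l) (fun y =>
      f (s *: d k + y)) y = 'D_(d l) f (s *: d k + y).
    move=> Vy Vsy.
    have E : (fun h : R => h^-1 *: (((fun y =>
        f (s *: d k + y)) \o shift y) (h *: d l) - f (s *: d k + y)))
      = (fun h : R => h^-1 *: ((f \o shift (s *: d k + y)) (h *: d l) - f (s *: d k + y))).
      by apply/funext => h /=; rewrite (addrCA (s *: d k)).
    by rewrite /derivable /derive E; split=> //; apply: dfl.
  have h01 : 0 <= (1:R) <= 1 by rewrite ler01 lexx.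
  have h00 : 0 <= (0:R) <= 1 by rewrite ler01 lexx.
  have Vb t : t \in `[0, 1] -> V (t *: (s *: d l) + x) /\ V (s *: d k + (t *: (s *: d l) + x)).
    rewrite in_itv /= => t01; split.
      by have [] := Hr _ (inb _ _ k l h00 t01); rewrite scale0r add0r.
    by have [] := Hr _ (inb _ _ k l h01 t01); rewrite scale1r.
  have dphi t : t \in `[0, 1] -> derivable phi (t *: (s *: d l) + x) (d l) /\
     'D_(d l) phi (t *: (s *: d l) + x) = 'D_(d l) f (s *: d k + (t *: (s *: d l) +
         x)) - 'D_(d l) f (t *: (s *: d l) + x).
    move=> t01; have [V1 V2] := Vb _ t01; have [s1 s2] := shiftd _ V1 V2.
    split; first by apply: derivableB; [exact: s1|exact: dfl].
    by rewrite deriveB; [rewrite s2|exact: s1|exact: dfl].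
  have [t t01|t t01] := @MVT_line _ _ phi x (s *: d l).
    by have [dp _] := dphi _ t01; have [] := derivable_scale s dp.
  have [dp Ep] := dphi _ t01.
  rewrite (derivable_scale s dp).2 Ep => {Ep dp}.
  have [|u u01] := @MVT_line _ _ (fun y => 'D_(d l) f y) (t *: (s *: d l) + x) (s *: d k).
    move=> u; rewrite in_itv /= => u01.
    have [Vu _] := Hr _ (inb _ _ k l u01 t01).
    by have [] := derivable_scale s (dfkl _ Vu).
  rewrite !in_itv /= in u01 t01.
  have [Vu eu] := Hr _ (inb _ _ k l u01 t01).
  rewrite (derivable_scale s (dfkl _ Vu)).2 => -> E.
  exists (u *: (s *: d k) + (t *: (s *: d l) + x)); split => //.
  by rewrite -E /phi; ring.
apply/eqP; rewrite -subr_eq0 -normr_le0; apply/ler_addgt0Pl => e e0; rewrite addr0.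
have e2 : 0 < e / 2 by rewrite divr_gt0.
have /nbhs_ballP[r1 /= r10 H1] := key i j _ e2.
have /nbhs_ballP[r2 /= r20 H2] := key j i _ e2.
pose r : R := Num.min r1 r2.
have r0 : 0 < r by rewrite lt_min r10.
have s0 : 0 < r / 2 by rewrite divr_gt0.
have sr : `|r / 2| < r by rewrite gtr0_norm // gtr_pMr // invf_lt1 // ltr1n.
have [|y [y1 y2]] := H1 (r / 2) _ s0.
  by rewrite -ball_normE /= sub0r normrN (lt_le_trans sr) // ge_min lexx.
have [|z [z1 z2]] := H2 (r / 2) _ s0.
  by rewrite -ball_normE /= sub0r normrN (lt_le_trans sr) // ge_min lexx orbT.
have cancel_sq (a b c t A B s : R) : s != 0 -> a - b - c + t = s * (s * A) ->
    a - c - b + t = s * (s * B) -> A = B.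
  by move=> sn0 HA HB; apply: (mulfI sn0); apply: (mulfI sn0); rewrite -HA -HB; ring.
have E := cancel_sq _ _ _ _ _ _ _ (lt0r_neq0 s0) y2.
(* Exchanging i and j only permutes the two middle terms of the second difference, so both mixed
   derivatives take the same value at their intermediate points. *)
rewrite addrCA in z2; rewrite -(E _ z2) in z1.
have tri (a b c : R) : `|a - b| < e / 2 -> `|c - b| < e / 2 -> `|a - c| <= e.
  rewrite (distrC c) => ab cb; rewrite -(subrK b a) -addrA [leRHS]splitr.
  by rewrite (le_trans (ler_normD _ _)) // lerD // ltW.
exact: tri y1 z1.
Unshelve. all: by end_near. Qed.

End CkTheory.

(** * Charts and smooth functions *)

Section ChainRule.
Context {R : realType}.
Implicit Types (F : 'rV[R]_3 -> R) (phi : 'rV[R]_3 -> 'rV[R]_3) (x v : 'rV[R]_3).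

Lemma derive_row F x v : differentiable F x ->
  'D_v F x = \sum_j v 0 j * 'D_(delta_mx 0 j) F x.
Proof.
move=> dF; rewrite (deriveE _ dF) {1}[v]row_sum_delta linear_sum.
by apply: eq_bigr => j _; rewrite linearZ (deriveE _ dF).
Qed.

Lemma differentiable_row phi x : (forall j, differentiable (fun y => phi y 0 j) x) ->
  differentiable phi x.
Proof.
move=> dphi.
have -> : phi = \sum_(j < 3) (fun y => phi y 0 j *: delta_mx 0 j).
  by apply/funext => y; rewrite fct_sumE -row_sum_delta.
by apply: differentiable_sum => j; apply: differentiableZl; exact: dphi.
Qed.

Lemma chain_row F phi x v : (forall j, differentiable (fun y => phi y 0 j) x) ->
  differentiable F (phi x) ->
  'D_v (F \o phi) x = \sum_j 'D_v (fun y => phi y 0 j) x * 'D_(delta_mx 0 j) F (phi x).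
Proof.
move=> dphi dF; have dp := differentiable_row dphi.
rewrite deriveE; last exact: differentiable_comp.
rewrite diff_comp //= -(deriveE _ dF) (derive_row _ dF).
apply: eq_bigr => j _; rewrite -(deriveE _ dp) derive_mx; first by rewrite mxE.
exact: diff_derivable.
Qed.

End ChainRule.

Section Charts.
Context {R : realType} {M : manifold3 R}.
Implicit Types (U W : set M) (c : chart M) (p : M) (f g : M -> R).

(** [cmap] and [cinv] are total functions with arbitrary values elsewhere, so identities between
    charts hold only near the image point, which suffices for derivatives. *)
Lemma near_chart c p U : cdom c p -> open U -> U p ->
  \forall z \near cmap c p, [/\ U (cinv c z), cdom c (cinv c z) & cmap c (cinv c z) = z].
Proof.
move=> dp oU Up.
have ip : (cmap c @` cdom c) (cmap c p) by exists p.
have H1 : \forall z \near cmap c p, U (cinv c z).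
  have := cinv_cont ip; rewrite /prop_for /continuous_at cmapK //; apply.
  exact: near_open.
have H2 := near_open (@cimg_open _ _ c) ip.
apply: filterS2 H1 H2 => z Uz [q dq E]; move: Uz; rewrite -E.
by rewrite !(cmapK dq).
Qed.

Lemma open_chart_image U c : open U -> open (cmap c @` (U `&` cdom c)).
Proof.
move=> oU; rewrite openE => _ [p [Up dp] <-].
by apply: filterS (near_chart dp oU Up) => z [Uz dz <-]; exists (cinv c z).
Qed.

Lemma smooth_on_subset U W f : U `<=` W -> smooth_on W f -> smooth_on U f.
Proof.
move=> UW sf c k; apply: Ck_subset (sf c k).
by apply: image_subset => p [/UW]; split.
Qed.

Lemma smooth_on_local U f :
  (forall p, U p -> exists W, [/\ open W, W p & smooth_on W f]) -> smooth_on U f.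
Proof.
move=> loc c k; apply: Ck_local => _ [p [Up dp] <-].
have [W [oW Wp sW]] := loc p Up.
by exists (cmap c @` (W `&` cdom c)); split; [exact: open_chart_image|exists p|exact: sW].
Qed.

Lemma smooth_on_eq U f g : open U -> (forall p, U p -> f p = g p) ->
  smooth_on U f -> smooth_on U g.
Proof.
move=> oU fg sf c k; apply: Ck_eq (sf c k); first exact: open_chart_image.
by move=> _ [p [Up dp] <-] /=; rewrite cmapK // fg.
Qed.

Lemma smooth_on_cst U (a : R) : smooth_on U (fun=> a).
Proof. by move=> c k; exact: Ck_cst. Qed.

Lemma smooth_onD U f g : open U -> smooth_on U f -> smooth_on U g ->
  smooth_on U (fun p => f p + g p).
Proof. by move=> oU sf sg c k; apply: Ck_D (sf c k) (sg c k); exact: open_chart_image. Qed.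

Lemma smooth_onM U f g : open U -> smooth_on U f -> smooth_on U g ->
  smooth_on U (fun p => f p * g p).
Proof. by move=> oU sf sg c k; apply: Ck_M (sf c k) (sg c k); exact: open_chart_image. Qed.

Lemma smooth_onZ U a f : open U -> smooth_on U f -> smooth_on U (fun p => a * f p).
Proof. by move=> oU; apply: smooth_onM => //; exact: smooth_on_cst. Qed.

Lemma smooth_onN U f : open U -> smooth_on U f -> smooth_on U (fun p => - f p).
Proof.
by move=> oU /(smooth_onZ (-1) oU); apply: smooth_on_eq => // p _; rewrite mulN1r.
Qed.

Lemma smooth_onV U f : open U -> (forall p, U p -> f p != 0) -> smooth_on U f ->
  smooth_on U (fun p => (f p)^-1).
Proof.
move=> oU f0 sf c k; apply: Ck_V (sf c k); first exact: open_chart_image.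
by move=> _ [p [Up dp] <-] /=; rewrite cmapK // f0.
Qed.

Lemma smooth_on_sqrt U f : open U -> (forall p, U p -> 0 < f p) -> smooth_on U f ->
  smooth_on U (fun p => Num.sqrt (f p)).
Proof.
move=> oU f0 sf c k; apply: Ck_sqrt (sf c k); first exact: open_chart_image.
by move=> _ [p [Up dp] <-] /=; rewrite cmapK // f0.
Qed.

Lemma smooth_on_sum (I : Type) (r : seq I) (P : pred I) U (F : I -> M -> R) : open U ->
  (forall i, smooth_on U (F i)) -> smooth_on U (fun p => \sum_(i <- r | P i) F i p).
Proof.
move=> oU sF; elim: r => [|i r IH].
  by apply: smooth_on_eq (smooth_on_cst U 0) => // p _; rewrite big_nil.
case Pi: (P i); last by apply: smooth_on_eq IH => // p _; rewrite big_cons Pi.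
by apply: smooth_on_eq (smooth_onD oU (sF i) IH) => // p _; rewrite big_cons Pi.
Qed.

Lemma smooth_on_prod (I : Type) (r : seq I) (P : pred I) U (F : I -> M -> R) : open U ->
  (forall i, smooth_on U (F i)) -> smooth_on U (fun p => \prod_(i <- r | P i) F i p).
Proof.
move=> oU sF; elim: r => [|i r IH].
  by apply: smooth_on_eq (smooth_on_cst U 1) => // p _; rewrite big_nil.
case Pi: (P i); last by apply: smooth_on_eq IH => // p _; rewrite big_cons Pi.
by apply: smooth_on_eq (smooth_onM oU (sF i) IH) => // p _; rewrite big_cons Pi.
Qed.

Lemma smooth_on_differentiable U f c p : open U -> U p -> cdom c p -> smooth_on U f ->
  differentiable (f \o cinv c) (cmap c p).
Proof.
move=> oU Up dp sf; apply: (@Ck_differentiable R 0 (cmap c @` (U `&` cdom c))) (sf c 1%N) _.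
  exact: open_chart_image.
by exists p.
Qed.

Lemma smooth_on_continuous U f p : open U -> U p -> smooth_on U f -> {for p, continuous f}.
Proof.
move=> oU Up sf; have dp := chart_atP p; set c := chart_at p in dp.
have cf := differentiable_continuous (smooth_on_differentiable oU Up dp sf).
have cc := @cmap_cont _ _ c p dp.
have -> : {for p, continuous f} = {for p, continuous ((f \o cinv c) \o cmap c)}.
  have E : {near p, (f \o cinv c) \o cmap c =1 f}.
    by apply: filterS (near_open (@cdom_open _ M c) dp) => q dq /=; rewrite cmapK.
  rewrite /prop_for /continuous_at /= cmapK //; apply/propext; split; apply: cvg_trans;
    apply: (@near_eq_cvg _ _ (nbhs p)) => //.
  by apply: filterS E => q /= ->.
exact: continuous_comp cc cf.
Qed.

(** Row i holds the i-th coordinate vector of c in the coordinates of c'; with row vectors,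
    compositions of charts multiply from left to right. *)
Definition jac c c' p : 'M[R]_3 := coord_jac (cmap c') (cinv c) (cmap c p).

Lemma transition_differentiable c c' p j : cdom c p -> cdom c' p ->
  differentiable (fun z => cmap c' (cinv c z) 0 j) (cmap c p).
Proof.
move=> dp dp'.
apply: (@Ck_differentiable R 0 (cmap c @` (cdom c `&` cdom c'))) (@transition_smooth _ M c
    c' j 1%N) _.
  by rewrite setIC; apply: open_chart_image; exact: cdom_open.
by exists p.
Qed.

Lemma derive_chart_change c c' p v (F : 'rV[R]_3 -> R) : cdom c p -> cdom c' p ->
  differentiable F (cmap c' p) ->
  'D_v (F \o cmap c' \o cinv c) (cmap c p)
  = \sum_j (v *m jac c c' p) 0 j * 'D_(delta_mx 0 j) F (cmap c' p).
Proof.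
move=> dp dp' dF.
have E : cmap c' (cinv c (cmap c p)) = cmap c' p by rewrite cmapK.
rewrite (@chain_row _ F (fun z => cmap c' (cinv c z))); first last.
- by rewrite E.
- by move=> j; exact: transition_differentiable.
apply: eq_bigr => j _; rewrite E; congr (_ * _).
rewrite derive_row; last exact: transition_differentiable.
by rewrite mxE; apply: eq_bigr => k _; rewrite mxE.
Qed.

Lemma jac_id c p : cdom c p -> jac c c p = 1%:M.
Proof.
move=> dp; apply/matrixP => i j; rewrite !mxE.
rewrite (@near_eq_derive _ _ _ _ (fun z : 'rV[R]_3 => z 0 j)); last first.
  by apply: filterS (near_chart dp (@cdom_open _ M c) dp) => z [_ _ ->].
rewrite deriveE; last exact: differentiable_coord.
have dl : linear (fun z : 'rV[R]_3 => z 0 j) by move=> a u v; rewrite !mxE.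
pose sL : {linear 'rV[R]_3 -> R} := HB.pack (fun z : 'rV[R]_3 =>
    z 0 j) (GRing.isLinear.Build _ _ _ _ _ dl).
have -> : (fun z : 'rV[R]_3 => z 0 j) = sL by [].
by rewrite diff_lin; [rewrite /= mxE eqxx eq_sym|exact: coord_continuous].
Qed.

Lemma jac_comp c c' c'' p : cdom c p -> cdom c' p -> cdom c'' p ->
  jac c c'' p = jac c c' p *m jac c' c'' p.
Proof.
move=> dp dp' dp''; apply/matrixP => i j; rewrite !mxE.
rewrite (@near_eq_derive _ _ _ _ ((fun z =>
    cmap c'' (cinv c' z) 0 j) \o cmap c' \o cinv c)); last first.
  apply: filterS (near_chart dp (@cdom_open _ M c') dp') => z [dz _ _] /=.
  by rewrite (cmapK dz).
rewrite derive_chart_change //; last exact: transition_differentiable.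
by apply: eq_bigr => k _; rewrite -rowE !mxE.
Qed.

Lemma partial_chart_change U c c' i f p : open U -> U p -> smooth_on U f ->
  cdom c p -> cdom c' p ->
  'D_(delta_mx 0 i) (f \o cinv c) (cmap c p)
  = \sum_j jac c c' p i j * 'D_(delta_mx 0 j) (f \o cinv c') (cmap c' p).
Proof.
move=> oU Up sf dp dp'.
rewrite (@near_eq_derive _ _ _ _ ((f \o cinv c') \o cmap c' \o cinv c)); last first.
  apply: filterS (near_chart dp (@cdom_open _ M c') dp') => z [dz _ _] /=.
  by rewrite (cmapK dz).
rewrite derive_chart_change //; last exact: smooth_on_differentiable sf.
by apply: eq_bigr => k _; rewrite -rowE !mxE.
Qed.

Lemma cbasisE c p : cbasis c p = jac c (chart_at p) p. Proof. by []. Qed.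
Lemma cobasisE c p : cobasis c p = jac (chart_at p) c p. Proof. by []. Qed.

Lemma cbasisK c p : cdom c p -> cbasis c p *m cobasis c p = 1%:M.
Proof.
by move=> dp; rewrite cbasisE cobasisE -jac_comp ?jac_id //; exact: chart_atP.
Qed.

Lemma cobasisK c p : cdom c p -> cobasis c p *m cbasis c p = 1%:M.
Proof. by move=> /cbasisK /mulmx1C. Qed.

Lemma cbasis_chart_at p : cbasis (chart_at p) p = 1%:M.
Proof. by rewrite cbasisE jac_id //; exact: chart_atP. Qed.

Lemma cbasis_change c c' p : cdom c p -> cdom c' p ->
  cbasis c p = jac c c' p *m cbasis c' p.
Proof. by move=> dp dp'; rewrite !cbasisE -jac_comp //; exact: chart_atP. Qed.

Lemma det_cbasis_gt0 c p : cdom c p -> 0 < \det (cbasis c p).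
Proof. by move=> dp; apply: transition_oriented dp (chart_atP p). Qed.

End Charts.

(** * The Levi-Civita connection *)

Section MatrixDerivative.
Context {R : realType} {V : normedModType R}.
Implicit Types (x v : V).

Definition derive_entries m n v (A : V -> 'M[R]_(m, n)) x : 'M[R]_(m, n) :=
  \matrix_(i, j) 'D_v (fun y => A y i j) x.

Lemma derive_entries_mul m n k v (A : V -> 'M[R]_(m, n)) (B : V -> 'M[R]_(n, k)) x :
  (forall i j, derivable (fun y => A y i j) x v) ->
  (forall i j, derivable (fun y => B y i j) x v) ->
  derive_entries v (fun y => A y *m B y) x =
  derive_entries v A x *m B x + A x *m derive_entries v B x.
Proof.
move=> dA dB; apply/matrixP => i j; rewrite !mxE -big_split /=.
have -> : (fun y => (A y *m B y) i j) = \sum_(l < n) (fun y => A y i l * B y l j).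
  by apply/funext => y; rewrite mxE fct_sumE.
rewrite derive_sum; last by move=> l; apply: derivableM; [exact: dA|exact: dB].
apply: eq_bigr => l _; rewrite deriveM; [|exact: dA|exact: dB].
by rewrite !mxE addrC; congr (_ + _); exact: mulrC.
Qed.

Lemma derive_entries_tr m n v (A : V -> 'M[R]_(m, n)) x :
  derive_entries v (fun y => (A y)^T) x = (derive_entries v A x)^T.
Proof.
by apply/matrixP => i j; rewrite !mxE; congr ('D_v _ x); apply/funext => y; rewrite mxE.
Qed.

Lemma derive_entries_near m n v (A B : V -> 'M[R]_(m, n)) x :
  (\forall y \near x, A y = B y) -> derive_entries v A x = derive_entries v B x.
Proof.
move=> AB; apply/matrixP => i j; rewrite !mxE; apply: near_eq_derive.
by apply: filterS AB => y ->.
Qed.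

Lemma derivable_mulmx m n k v (A : V -> 'M[R]_(m, n)) (B : V -> 'M[R]_(n, k)) x :
  (forall i j, derivable (fun y => A y i j) x v) ->
  (forall i j, derivable (fun y => B y i j) x v) ->
  forall i j, derivable (fun y => (A y *m B y) i j) x v.
Proof.
move=> dA dB i j.
have -> : (fun y => (A y *m B y) i j) = \sum_(l < n) (fun y => A y i l * B y l j).
  by apply/funext => y; rewrite mxE fct_sumE.
by apply: derivable_sum => l; apply: derivableM; [exact: dA|exact: dB].
Qed.

End MatrixDerivative.

(** * Algebra of symmetric symbols compatible with a metric *)

Section MetricAlgebra.
Context {R : realType}.

Lemma eta_sq (a : 'I_3) : eta R a * eta R a = 1.
Proof. by rewrite /eta; case: ifP; rewrite ?mulrNN mulr1. Qed.

Lemma eta_mxK : eta_mx R *m eta_mx R = 1%:M.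
Proof.
rewrite /eta_mx mulmx_diag -diag_const_mx; congr diag_mx.
by apply/rowP => a; rewrite !mxE eta_sq.
Qed.

Lemma eta_mxE a b : eta_mx R a b = eta R a *+ (a == b).
Proof. by rewrite !mxE; case: eqP => [->|]; rewrite ?mulr1n ?mulr0n. Qed.

Lemma det_eta : \det (eta_mx R) = -1.
Proof.
by rewrite det_diag !big_ord_recl big_ord0 !mxE /eta /= !mul1r mulr1.
Qed.

(** Three skew exchanges of the last two indices, alternating with symmetric exchanges of the first
    two, return to the same entry with the opposite sign. *)
Lemma skew_sym3_eq0 (S : 'I_3 -> 'M[R]_3) :
  (forall i, S i + (S i)^T = 0) -> (forall i j l, S i j l = S j i l) ->
  forall i, S i = 0.
Proof.
move=> Sskew Ssym i; apply/matrixP => j l; rewrite mxE.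
have sk a b c : S a b c = - S a c b.
  have /matrixP/(_ b c) := Sskew a; rewrite !mxE => /eqP.
  by rewrite addr_eq0 => /eqP.
have : S i j l = - S i j l.
  by rewrite {1}sk {1}Ssym {1}sk opprK {1}Ssym {1}sk Ssym.
lra.
Qed.

(* Christoffel symbols of the first kind, for the derivatives [d] of a metric. *)
Definition koszul (d : 'I_3 -> 'M[R]_3) i : 'M[R]_3 :=
  \matrix_(j, l) (2^-1 * (d i j l + d j i l - d l i j)).

Lemma koszul_compat d i : (forall a, (d a)^T = d a) -> koszul d i + (koszul d i)^T = d i.
Proof.
move=> dT; apply/matrixP => j l; rewrite !mxE.
by have -> a : d a l j = d a j l; [rewrite -[in LHS]dT mxE|field].
Qed.

Lemma koszul_sym d i j l : (forall a, (d a)^T = d a) -> koszul d i j l = koszul d j i l.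
Proof.
move=> dT; rewrite !mxE.
by have -> a : d a j i = d a i j; [rewrite -[in LHS]dT mxE|rewrite [d j i l + _]addrC].
Qed.

(** The difference of two solutions, its upper index lowered by g, is symmetric in its first two
    indices and skew in its last two. *)
Lemma compat_unique (g : 'M[R]_3) (G G' : 'I_3 -> 'M[R]_3) :
  g \in unitmx -> g^T = g ->
  (forall i, G i *m g + g *m (G i)^T = G' i *m g + g *m (G' i)^T) ->
  (forall i j k, G i j k = G j i k) -> (forall i j k, G' i j k = G' j i k) ->
  forall i, G i = G' i.
Proof.
move=> gu gT Gg Gsym G'sym i.
pose S i := (G i - G' i) *m g.
have S0 : S i = 0.
  apply: skew_sym3_eq0 => {i} [i|i j l].
    have trB : (G i - G' i)^T = (G i)^T - (G' i)^T by apply/matrixP => a b; rewrite !mxE.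
    rewrite /S trmx_mul gT trB mulmxBr mulmxBl addrACA Gg.
    by rewrite -opprD subrr.
  by rewrite /S mxE [RHS]mxE; apply: eq_bigr => k _; rewrite !mxE Gsym G'sym.
by apply/eqP; rewrite -subr_eq0 -[X in X == _](mulmxK gu) -/(S i) S0 mul0mx.
Qed.

(** The hypothesis is the inhomogeneous law of connection coefficients, with D for dK. The
    right-hand side is then the Leibniz rule for K g K^T, with N g + g N^T for dg. *)
Lemma compat_change (K D N g G : 'M[R]_3) : G *m K = D + K *m N ->
  G *m (K *m g *m K^T) + (K *m g *m K^T) *m G^T =
  D *m g *m K^T + K *m (N *m g + g *m N^T) *m K^T + K *m g *m D^T.
Proof.
move=> GK; have GKT : K^T *m G^T = D^T + N^T *m K^T.
  by rewrite -trmx_mul GK -trmx_mul; apply/matrixP => a b; rewrite !mxE.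
rewrite -[X in _ + X]mulmxA GKT !mulmxA GK !mulmxDl !mulmxDr !mulmxDl !mulmxA.
by rewrite -!addrA; congr (_ + (_ + _)); rewrite addrC.
Qed.

Lemma change_sym (K : 'M[R]_3) (N : 'I_3 -> 'M[R]_3) a b d :
  (forall i j k, N i j k = N j i k) ->
  (K *m \sum_m K a m *: N m) b d = (K *m \sum_m K b m *: N m) a d.
Proof.
move=> Nsym; rewrite [LHS]mxE [RHS]mxE.
under eq_bigr do rewrite summxE mulr_sumr.
under [in RHS]eq_bigr do rewrite summxE mulr_sumr.
rewrite exchange_big; apply: eq_bigr => m _; apply: eq_bigr => n _.
by rewrite !mxE Nsym mulrCA.
Qed.

End MetricAlgebra.

(** * Christoffel symbols and their behaviour under a change of chart *)

Section LeviCivita.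
Context {R : realType} {M : lorentz3 R}.
Implicit Types (U : set M) (p q : M) (c : chart M) (u : form1 M).

Lemma metric_unit p : metric p \in unitmx.
Proof.
have [P Pu E] := metric_signature p.
have : \det (P *m metric p *m P^T) != 0 by rewrite E det_eta oppr_eq0 oner_eq0.
rewrite !det_mulmx !mulf_eq0 !negb_or => /andP[/andP[_ d] _].
by rewrite unitmxE unitfE.
Qed.

Lemma det_metric_lt0 p : \det (metric p) < 0.
Proof.
have [P Pu E] := metric_signature p.
have : \det (P *m metric p *m P^T) = -1 by rewrite E det_eta.
rewrite !det_mulmx det_tr => D.
have d0 : \det P != 0 by rewrite -unitfE -unitmxE.
have : 0 < \det P ^+ 2 by rewrite exprn_even_gt0.
have : \det P ^+ 2 * \det (metric p) = -1 by rewrite -D; ring.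
move=> D' /pmulr_rlt0 <-; rewrite D'; lra.
Qed.

Lemma coord_metric_sym c p : (coord_metric c p)^T = coord_metric c p.
Proof. by rewrite /coord_metric !trmx_mul trmxK Defs.metric_sym mulmxA. Qed.

Lemma cbasis_unit c p : cdom c p -> cbasis c p \in unitmx.
Proof. by move=> dp; rewrite unitmxE unitfE gt_eqF // det_cbasis_gt0. Qed.

Lemma coord_metric_unit c p : cdom c p -> coord_metric c p \in unitmx.
Proof.
by move=> dp; rewrite /coord_metric !unitmx_mul unitmx_tr metric_unit cbasis_unit.
Qed.

Lemma coord_metric_chart_at p : coord_metric (chart_at p) p = metric p.
Proof. by rewrite /coord_metric cbasis_chart_at mul1mx trmx1 mulmx1. Qed.

Definition dmetric c i p : 'M[R]_3 :=
  derive_entries (delta_mx 0 i) (coord_metric c \o cinv c) (cmap c p).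

Lemma dmetricE c i p a b :
  dmetric c i p a b = partial c i (fun q => coord_metric c q a b) p.
Proof. by rewrite mxE. Qed.

Lemma dmetric_sym c i p : (dmetric c i p)^T = dmetric c i p.
Proof.
apply/matrixP => a b; rewrite mxE !dmetricE /partial.
have -> // : (fun q => coord_metric c q b a) = (fun q => coord_metric c q a b).
by apply/funext => q; rewrite -coord_metric_sym mxE coord_metric_sym.
Qed.

(** The entry (j, k) is Gamma^k_ij. With the upper index as column, metric compatibility reads
    Gamma_i g + g Gamma_i^T = d_i g. *)
Definition chr_mx c i p : 'M[R]_3 :=
  koszul (fun a => dmetric c a p) i *m invmx (coord_metric c p).

Lemma christoffelE c k i j p : christoffel c k i j p = chr_mx c i p j k.
Proof.
have : (invmx (coord_metric c p))^T = invmx (coord_metric c p).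
  by rewrite trmx_inv coord_metric_sym.
rewrite /christoffel /chr_mx; move: (invmx _) => gi giT.
rewrite mxE mulr_sumr; apply: eq_bigr => l _.
have -> : gi k l = gi l k by rewrite -{1}giT mxE.
have -> : koszul (fun a => dmetric c a p) i j l =
  2^-1 * (partial c i (fun q => coord_metric c q j l) p
    + partial c j (fun q => coord_metric c q i l) p
    - partial c l (fun q => coord_metric c q i j) p).
  by rewrite mxE; congr (_ * (_ + _ - _)); exact: dmetricE.
by move: (partial _ _ _ _) (partial _ _ _ _) (partial _ _ _ _) => a b d; rewrite mulrCA mulrC.
Qed.

Lemma chr_compat c i p : cdom c p ->
  chr_mx c i p *m coord_metric c p + coord_metric c p *m (chr_mx c i p)^T = dmetric c i p.
Proof.
move=> dp; rewrite -{2}coord_metric_sym -trmx_mul /chr_mx mulmxKV ?coord_metric_unit //.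
by rewrite (@koszul_compat _ (fun a => dmetric c a p)) // => a; exact: dmetric_sym.
Qed.

Lemma chr_sym c i j k p : chr_mx c i p j k = chr_mx c j p i k.
Proof.
rewrite /chr_mx; set d := (fun a => dmetric c a p).
have dT a : (d a)^T = d a by exact: dmetric_sym.
move: d dT (invmx _) => d dT gi.
by rewrite mxE [RHS]mxE; apply: eq_bigr => l _; rewrite koszul_sym.
Qed.

Lemma chr_unique c p (G : 'I_3 -> 'M[R]_3) : cdom c p ->
  (forall i, G i *m coord_metric c p + coord_metric c p *m (G i)^T = dmetric c i p) ->
  (forall i j k, G i j k = G j i k) ->
  forall i, G i = chr_mx c i p.
Proof.
move=> dp Gcompat Gsym.
apply: (compat_unique (coord_metric_unit dp)) => //; first exact: coord_metric_sym.
  by move=> j; rewrite Gcompat chr_compat.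
by move=> j k l; exact: chr_sym.
Qed.

Definition form_comp c u q : 'cV[R]_3 := cbasis c q *m u q.

Lemma coord_nabla_row c u p i : (row i (coord_nabla c u p))^T =
  derive_entries (delta_mx 0 i) (form_comp c u \o cinv c) (cmap c p)
  - chr_mx c i p *m form_comp c u p.
Proof.
apply/matrixP => j l; rewrite ord1 !mxE; congr (_ - _).
by apply: eq_bigr => k _; rewrite christoffelE.
Qed.

Lemma form_comp_derivable c c' U u p i l v : open U -> U p -> smooth_form1 U u ->
  cdom c p -> cdom c' p ->
  derivable (fun z => form_comp c' u (cinv c z) i l) (cmap c p) v.
Proof.
move=> oU Up su dp dp'; rewrite ord1; apply: diff_derivable.
apply: (@smooth_on_differentiable _ _ (U `&` cdom c') (fun q => form_comp c' u q i 0)) => //.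
by apply: openI => //; exact: cdom_open.
Qed.

Section ChartChange.
Variables (c c' : chart M) (p : M).
Hypotheses (dp : cdom c p) (dp' : cdom c' p).
Let x := cmap c p.
Let K := jac c c'.

Lemma jac_derivable i j v : derivable (fun z => K (cinv c z) i j) x v.
Proof.
apply: near_eq_derivable (_ : derivable (fun y => 'D_(delta_mx 0 i) (fun z =>
    cmap c' (cinv c z) 0 j) y) x v).
  apply: filterS (near_chart dp (@cdom_open _ M c') dp') => z [_ _ E].
  by rewrite /K mxE E.
apply: diff_derivable.
have oV : open (cmap c @` (cdom c `&` cdom c')).
  by rewrite setIC; apply: open_chart_image; exact: cdom_open.
have [_ /(_ i)[_ C1]] := @transition_smooth _ M c c' j 2%N.
by apply: (@Ck_differentiable R 0 _ _ _ oV C1); exists p.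
Qed.

(** The entries of K are first partial derivatives of the transition map, so this is Schwarz's
    theorem; it makes the transformed Christoffel symbols symmetric. *)
Lemma jac_derive_sym i j b :
  'D_(delta_mx 0 i) (fun z => K (cinv c z) j b) x
  = 'D_(delta_mx 0 j) (fun z => K (cinv c z) i b) x.
Proof.
have E k l : 'D_(delta_mx 0 k) (fun z => K (cinv c z) l b) x =
    'D_(delta_mx 0 k) (fun y => 'D_(delta_mx 0 l) (fun z => cmap c' (cinv c z) 0 b) y) x.
  apply: near_eq_derive.
  apply: filterS (near_chart dp (@cdom_open _ M c') dp') => z [_ _ E].
  by rewrite /K mxE E.
rewrite !E; apply: (@Schwarz R (cmap c @` (cdom c `&` cdom c'))).
- by rewrite setIC; apply: open_chart_image; exact: cdom_open.
- exact: transition_smooth.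
- by exists p.
Qed.

Let dK i := derive_entries (delta_mx 0 i) (K \o cinv c) x.

Let dK_sym a b d : dK a b d = dK b a d.
Proof.
have E k l : dK k l d = 'D_(delta_mx 0 k) (fun z => K (cinv c z) l d) x by exact: mxE.
exact: etrans (E a b) (etrans (jac_derive_sym a b d) (esym (E b a))).
Qed.

Lemma dmetric_change i : dmetric c i p =
  dK i *m coord_metric c' p *m (K p)^T
  + K p *m (\sum_m K p i m *: dmetric c' m p) *m (K p)^T
  + K p *m coord_metric c' p *m (dK i)^T.
Proof.
have xE : cinv c x = p by rewrite /x cmapK.
rewrite /dmetric -/x (@derive_entries_near _ _ _ _ _ _
   (fun z => K (cinv c z) *m coord_metric c' (cinv c z) *m (K (cinv c z))^T)); last first.
  apply: filterS (near_chart dp (@cdom_open _ M c') dp') => z [dz dz' _] /=.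
  by rewrite /coord_metric (cbasis_change dz' dz) trmx_mul !mulmxA.
have dgc a b v : derivable (fun z => coord_metric c' (cinv c z) a b) x v.
  apply: diff_derivable; apply: (@smooth_on_differentiable _ _ (cdom c') (fun q =>
      coord_metric c' q a b)) => //.
    exact: cdom_open.
  exact: metric_smooth.
have dKT a b v : derivable (fun z => (K (cinv c z))^T a b) x v.
  rewrite (_ : (fun z => _) = (fun z => K (cinv c z) b a)); first exact: jac_derivable.
  by apply/funext => z; rewrite mxE.
rewrite derive_entries_mul; last 2 first.
- by apply: derivable_mulmx => a b; [exact: jac_derivable|exact: dgc].
- by move=> a b; exact: dKT.
rewrite derive_entries_mul; last 2 first.
- by move=> a b; exact: jac_derivable.
- by move=> a b; exact: dgc.
rewrite derive_entries_tr mulmxDl xE; congr (_ + _ *m _ *m _ + _).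
apply/matrixP => a b; rewrite !mxE summxE.
rewrite (partial_chart_change i (@cdom_open _ M c') dp' (@metric_smooth _ M c' a b) dp dp').
by apply: eq_bigr => m _; rewrite !mxE.
Qed.

(** The right-hand side times K^-1 is compatible with the metric by [dmetric_change] and
    [compat_change], and symmetric by [jac_derive_sym] and [change_sym]; [chr_unique] identifies it
    with the Christoffel symbols of c. *)
Lemma chr_change i : chr_mx c i p *m K p =
  dK i + K p *m \sum_m K p i m *: chr_mx c' m p.
Proof.
have Ku : K p \in unitmx.
  by rewrite unitmxE unitfE gt_eqF //; exact: transition_oriented.
pose G j := (dK j + K p *m \sum_m K p j m *: chr_mx c' m p) *m invmx (K p).
have GK j : G j *m K p = dK j + K p *m \sum_m K p j m *: chr_mx c' m p.
  by rewrite mulmxKV.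
suff <- : G i = chr_mx c i p by rewrite GK.
apply: chr_unique i => // [i|i j k].
  have gE : coord_metric c p = K p *m coord_metric c' p *m (K p)^T.
    by rewrite /coord_metric (cbasis_change dp dp') trmx_mul !mulmxA.
  rewrite gE dmetric_change (compat_change _ (GK i)); congr (_ + _ *m _ *m _ + _).
  have -> : (\sum_m K p i m *: chr_mx c' m p)^T = \sum_m K p i m *: (chr_mx c' m p)^T.
    by apply/matrixP => a b; rewrite mxE !summxE; apply: eq_bigr => m _; rewrite !mxE.
  rewrite mulmx_suml mulmx_sumr -big_split /=; apply: eq_bigr => m _.
  by rewrite -(chr_compat m dp') -scalemxAl -scalemxAr scalerDr.
have H a b d : (G a *m K p) b d = (G b *m K p) a d.
  rewrite !GK [LHS]mxE [RHS]mxE; congr (_ + _).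
    exact: dK_sym.
  by apply: change_sym => *; exact: chr_sym.
have /(_ k) E : forall d, G i j d = G j i d.
  have : row j (G i) = row i (G j).
    rewrite -[LHS](mulmxK Ku) -[RHS](mulmxK Ku); congr (_ *m _).
    by rewrite -!row_mul; apply/rowP => d; rewrite mxE [RHS]mxE H.
  by move=> /rowP E d; have := E d; rewrite !mxE.
exact: E.
Qed.

Lemma coord_nabla_change U u : open U -> U p -> smooth_form1 U u ->
  coord_nabla c u p = K p *m coord_nabla c' u p *m (K p)^T.
Proof.
move=> oU Up su.
have xE : cinv c x = p by rewrite /x cmapK.
apply/row_matrixP => i; apply: (can_inj trmxK).
rewrite coord_nabla_row -/x row_mul row_mul trmx_mul trmxK trmx_mul.
have compE : form_comp c u p = K p *m form_comp c' u p.
  by rewrite /form_comp (cbasis_change dp dp') mulmxA.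
rewrite (@derive_entries_near _ _ _ _ _ _ (fun z =>
    K (cinv c z) *m form_comp c' u (cinv c z))); last first.
  apply: filterS (near_chart dp (@cdom_open _ M c') dp') => z [dz dz' _] /=.
  by rewrite /form_comp (cbasis_change dz' dz) !mulmxA.
rewrite derive_entries_mul; last 2 first.
- by move=> a b; exact: jac_derivable.
- by move=> a b; apply: form_comp_derivable su _ _.
(* The derivative of K in the product rule cancels the inhomogeneous term of [chr_change]; this is
   what makes the result tensorial. *)
rewrite compE mulmxA chr_change mulmxDl xE opprD addrACA subrr add0r -mulmxA -mulmxBr.
congr (_ *m _).
have -> : derive_entries (delta_mx 0 i) (fun z => form_comp c' u (cinv c z)) x =
   \sum_m K p i m *: derive_entries (delta_mx 0 m) (form_comp c' u \o cinv c') (cmap c' p).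
  apply/matrixP => a b; rewrite !mxE summxE ord1.
  have oU' : open (U `&` cdom c') by apply: openI => //; exact: cdom_open.
  have E := partial_chart_change i oU' (conj Up dp') (su c' a) dp dp'.
  by rewrite [LHS]E; apply: eq_bigr => m _; rewrite !mxE.
rewrite mulmx_suml -sumrB.
have -> N : N^T *m (row i (K p))^T = \sum_m K p i m *: (row m N)^T.
  apply/matrixP => a b; rewrite mxE summxE; apply: eq_bigr => m _.
  by rewrite !mxE mulrC.
by apply: eq_bigr => m _; rewrite coord_nabla_row -scalemxAl scalerBr.
Qed.

End ChartChange.

End LeviCivita.

(** * Orthonormal coframes *)

Section Det3.
Context {R : realType}.
Implicit Types (x y z w : 'rV[R]_3) (E : 'M[R]_3).

Definition rdet x y z : R := \det (\matrix_(a < 3) nth 0 [:: x; y; z] a : 'M[R]_3).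

Lemma sum3 (V : nmodType) (F : 'I_3 -> V) : \sum_i F i = F 0 + F 1 + F 2%:R.
Proof.
rewrite !big_ord_recl big_ord0 addr0 addrA.
by congr (_ + F _ + F _); apply/val_inj.
Qed.

Lemma det_mx2 (A : 'M[R]_2) : \det A = A 0 0 * A 1 1 - A 0 1 * A 1 0.
Proof.
rewrite (expand_det_row _ 0) !big_ord_recl big_ord0 /cofactor !det_mx11 !mxE /=.
have i1 : lift 0 (0 : 'I_1) = 1 :> 'I_2 by apply/val_inj.
have i2 : lift (1 : 'I_2) (0 : 'I_1) = 0 :> 'I_2 by apply/val_inj.
by rewrite !(i1, i2) /=; ring.
Qed.

Lemma rdetE x y z : rdet x y z =
  x 0 0 * (y 0 1 * z 0 2%:R - y 0 2%:R * z 0 1)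
  - x 0 1 * (y 0 0 * z 0 2%:R - y 0 2%:R * z 0 0)
  + x 0 2%:R * (y 0 0 * z 0 1 - y 0 1 * z 0 0).
Proof.
rewrite /rdet (expand_det_row _ 0) sum3 /cofactor !det_mx2 !mxE /=.
have i1 : lift 0 (0 : 'I_2) = 1 :> 'I_3 by apply/val_inj.
have i2 : lift 0 (1 : 'I_2) = 2%:R :> 'I_3 by apply/val_inj.
have i3 : lift 1 (0 : 'I_2) = 0 :> 'I_3 by apply/val_inj.
have i4 : lift 1 (1 : 'I_2) = 2%:R :> 'I_3 by apply/val_inj.
have i5 : lift (2%:R : 'I_3) (0 : 'I_2) = 0 :> 'I_3 by apply/val_inj.
have i6 : lift (2%:R : 'I_3) (1 : 'I_2) = 1 :> 'I_3 by apply/val_inj.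
by rewrite !(i1, i2, i3, i4, i5, i6) /=; ring.
Qed.

Lemma col_mulmx m n k (A : 'M[R]_(m, n)) (B : 'M[R]_(n, k)) j :
  col j (A *m B) = A *m col j B.
Proof. by apply/colP => i; rewrite !mxE; apply: eq_bigr => l _; rewrite mxE. Qed.

Lemma mulmx_row_col m n k (A : 'M[R]_(m, n)) (B : 'M[R]_(n, k)) i j :
  (A *m B) i j = (row i A *m col j B) 0 0.
Proof. by rewrite !mxE; apply: eq_bigr => l _; rewrite !mxE. Qed.

Lemma rdet_mulmx x y z E : rdet (x *m E) (y *m E) (z *m E) = rdet x y z * \det E.
Proof.
rewrite /rdet -det_mulmx; congr (\det _); apply/row_matrixP => i.
by rewrite row_mul !rowK; case: i => -[|[|[|//]]] Hi.
Qed.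

Lemma rdet_delta : rdet (delta_mx 0 0) (delta_mx 0 1) (delta_mx 0 2%:R) = 1.
Proof. by rewrite rdetE !mxE /=; ring. Qed.

Lemma det_rdet E : \det E = rdet (row 0 E) (row 1 E) (row 2%:R E).
Proof.
rewrite -[LHS]mul1r -rdet_delta -rdet_mulmx -!rowE //.
Qed.

(** Skewness carries linearity from the first slot to the others. In the expansion over the standard
    basis only the six terms with distinct indices survive. *)
Lemma alternating3E (H : 'rV[R]_3 -> 'rV[R]_3 -> 'rV[R]_3 -> R) :
  (forall a v v' w x, H (a *: v + v') w x = a * H v w x + H v' w x) ->
  (forall v w x, H v w x = - H w v x) ->
  (forall v w x, H v w x = - H v x w) ->
  forall x y z, H x y z = H (delta_mx 0 0) (delta_mx 0 1) (delta_mx 0 2%:R) * rdet x y z.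
Proof.
move=> L1 A12 A23.
have L2 a v v' w x : H w (a *: v + v') x = a * H w v x + H w v' x.
  by rewrite A12 L1 opprD -mulrN -!A12.
have L3 a v v' w x : H w x (a *: v + v') = a * H w x v + H w x v'.
  by rewrite A23 L2 opprD -mulrN -!A23.
have Z12 v x : H v v x = 0 by have := A12 v v x; lra.
have Z23 v x : H x v v = 0 by have := A23 x v v; lra.
have Z13 v x : H v x v = 0 by rewrite A23 Z12 oppr0.
pose d i : 'rV[R]_3 := delta_mx 0 i.
have dec x : x = x 0 0 *: d 0 + (x 0 1 *: d 1 + x 0 2%:R *: d 2%:R).
  by rewrite addrA; exact: row3_sum_delta.
have s1 v w x a : H (a *: v) w x = a * H v w x.
  by have := L1 a v 0 w x; rewrite addr0 =>
      ->; have := L1 1 0 0 w x; rewrite scaler0 addr0; lra.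
have s2 v w x a : H w (a *: v) x = a * H w v x.
  by rewrite A12 s1 -mulrN -A12.
have s3 v w x a : H w x (a *: v) = a * H w x v.
  by rewrite A23 s2 -mulrN -A23.
move=> x y z; rewrite rdetE (dec x) (dec y) (dec z).
rewrite !(L1, s1) !(L2, s2) !(L3, s3) !(Z12, Z23, Z13).
rewrite -!dec -/(d 0) -/(d 1) -/(d 2%:R).
have e1 : H (d 0) (d 2%:R) (d 1) = - H (d 0) (d 1) (d 2%:R) by rewrite A23.
have e2 : H (d 1) (d 0) (d 2%:R) = - H (d 0) (d 1) (d 2%:R) by rewrite A12.
have e3 : H (d 1) (d 2%:R) (d 0) = H (d 0) (d 1) (d 2%:R) by rewrite A23 A12 opprK.
have e4 : H (d 2%:R) (d 0) (d 1) = H (d 0) (d 1) (d 2%:R) by rewrite A12 A23 opprK.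
have e5 : H (d 2%:R) (d 1) (d 0) = - H (d 0) (d 1) (d 2%:R) by rewrite A23 e4.
rewrite e1 e2 e3 e4 e5; ring.
Qed.

(** In the application g is the inverse metric, E a coframe and W its covariant derivative. The last
    hypothesis says that E h E^T, the metric, is parallel; multiplying it by E^T g and g E gives
    skewness of the connection forms. *)
Lemma skew_gram (E W g h : 'M[R]_3) : E^T *m g *m E = h -> g^T = g -> h *m h = 1%:M ->
  W *m h *m E^T + E *m h *m W^T = 0 ->
  W^T *m g *m E + (W^T *m g *m E)^T = 0.
Proof.
move=> Eg gT hh H.
have : E^T *m g *m (W *m h *m E^T + E *m h *m W^T) *m g *m E = 0.
  by rewrite H mulmx0 !mul0mx.
rewrite mulmxDr !mulmxDl !mulmxA Eg hh mul1mx addrC.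
rewrite -(mulmxA _ E^T) -(mulmxA _ (E^T *m g)) Eg -(mulmxA _ h) hh mulmx1.
by rewrite !trmx_mul trmxK gT mulmxA.
Qed.

End Det3.

(** * Volume form, Hodge star and connection forms in a coframe *)

Section Frames.
Context {R : realType} {M : lorentz3 R}.
Implicit Types (U : set M) (p q : M) (c : chart M) (u : form1 M) (w : 'rV[R]_3).

Lemma volE p x y z : vol p x y z = Num.sqrt (- \det (metric p)) * rdet x y z.
Proof. by []. Qed.

Lemma cometricC p a b : cometric p a b = cometric p b a.
Proof.
have E : b^T *m invmx (metric p) *m a = (a^T *m invmx (metric p) *m b)^T.
  by rewrite !trmx_mul trmx_inv Defs.metric_sym trmxK mulmxA.
by rewrite /cometric E [RHS]mxE.
Qed.

Lemma cometricDl p t a a' b : cometric p (t *: a + a') b = t * cometric p a b + cometric p a' b.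
Proof.
rewrite /cometric; have -> : (t *: a + a')^T = t *: a^T + a'^T by apply/matrixP =>
    i j; rewrite !mxE.
by rewrite !mulmxDl -!scalemxAl mxE [X in X + _]mxE.
Qed.

Lemma cometric0l p b : cometric p 0 b = 0.
Proof. by rewrite /cometric trmx0 !mul0mx mxE. Qed.

Lemma cometricZl p t a b : cometric p (t *: a) b = t * cometric p a b.
Proof. by rewrite -[t *: a]addr0 cometricDl cometric0l addr0. Qed.

Lemma cometric_suml p (I : finType) (t : I -> R) (v : I -> 'cV[R]_3) b :
  cometric p (\sum_i t i *: v i) b = \sum_i t i * cometric p (v i) b.
Proof. by elim/big_rec2: _ => [|i x y _ <-]; rewrite ?cometric0l ?cometricDl. Qed.

Definition coframe_mx (e : 'I_3 -> form1 M) q : 'M[R]_3 := \matrix_(i, a) e a q i 0.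

Lemma col_coframe_mx e q a : col a (coframe_mx e q) = e a q.
Proof. by apply/colP => i; rewrite !mxE. Qed.

Definition orthonormal_at (e : 'I_3 -> form1 M) q : Prop :=
  forall a b, cometric q (e a q) (e b q) = eta_mx R a b.

Lemma cometric_coframe_mx e q a b :
  cometric q (e a q) (e b q) = ((coframe_mx e q)^T *m invmx (metric q) *m coframe_mx e q) a b.
Proof.
by rewrite mulmx_row_col row_mul -tr_col !col_coframe_mx.
Qed.

Section AtPoint.
Variables (e : 'I_3 -> form1 M) (p : M).
Hypothesis oe : orthonormal_at e p.
Let E := coframe_mx e p.

Lemma coframe_gram : E^T *m invmx (metric p) *m E = eta_mx R.
Proof. by apply/matrixP => a b; rewrite -cometric_coframe_mx oe. Qed.

Lemma coframe_unit : E \in unitmx.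
Proof.
have : \det (E^T *m invmx (metric p) *m E) != 0.
  by rewrite coframe_gram det_eta oppr_eq0 oner_eq0.
by rewrite !det_mulmx !mulf_eq0 !negb_or unitmxE unitfE => /andP[].
Qed.

(** The Gram identity exhibits a right inverse of E^T; for square matrices it is also a left
    inverse, which gives the metric in terms of the coframe. *)
Lemma coframe_metric : E *m eta_mx R *m E^T = metric p.
Proof.
have gu := metric_unit p.
have H : E^T *m (invmx (metric p) *m E *m eta_mx R) = 1%:M.
  by rewrite !mulmxA coframe_gram eta_mxK.
have H2 := mulmx1C H.
have : metric p *m (invmx (metric p) *m E *m eta_mx R *m E^T) = metric p.
  by rewrite H2 mulmx1.
by rewrite !mulmxA mulmxV // mul1mx.
Qed.

Lemma coframe_sum (v : 'cV[R]_3) : v = \sum_b (eta R b * cometric p v (e b p)) *: e b p.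
Proof.
have Ev b : (E^T *m invmx (metric p) *m v) b 0 = cometric p v (e b p).
  by rewrite cometricC /cometric -(col_coframe_mx e p b) tr_col -!row_mul [RHS]mxE.
have {1}-> : v = E *m (eta_mx R *m (E^T *m invmx (metric p) *m v)).
  by rewrite !mulmxA coframe_metric mulmxV ?metric_unit // mul1mx.
rewrite /eta_mx mul_diag_mx; apply/colP => i; rewrite mxE summxE.
apply: eq_bigr => b _; rewrite -Ev mxE [RHS]mxE [E i b]mxE mulrC; congr (_ * _).
by congr (_ * _); rewrite mxE.
Qed.

Lemma sqrt_det_metric : Num.sqrt (- \det (metric p)) = `|\det E|.
Proof.
rewrite -coframe_metric !det_mulmx det_tr det_eta mulrN1 mulNr opprK -expr2.
exact: sqrtr_sqr.
Qed.

Definition coframe_sign : R := `|\det E| / \det E.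

Lemma det_coframe_neq0 : \det E != 0.
Proof. by have := coframe_unit; rewrite unitmxE unitfE. Qed.

Lemma vol_coframe x y z : vol p x y z = coframe_sign * rdet (x *m E) (y *m E) (z *m E).
Proof.
rewrite volE sqrt_det_metric rdet_mulmx /coframe_sign [rdet x y z * _]mulrC mulrA.
by rewrite divfK // det_coframe_neq0.
Qed.

Lemma hodge_coframe u (k : 'I_3 -> R) w : u p = \sum_a k a *: e a p ->
  (w *m hodge1 u p)^T = coframe_sign *:
    \sum_b rdet (\row_a (eta R a * k a)) (w *m E) (delta_mx 0 b) *: e b p.
Proof.
move=> uE.
have ukE : u p = E *m \col_a k a.
  apply/colP => i; rewrite uE summxE mxE; apply: eq_bigr => a _.
  by rewrite !mxE mulrC.
have usharp : (invmx (metric p) *m u p)^T *m E = \row_a (eta R a * k a).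
  rewrite ukE trmx_mul trmx_inv Defs.metric_sym trmx_mul -!mulmxA (mulmxA E^T) coframe_gram.
  by apply/rowP => a; rewrite /eta_mx mul_mx_diag !mxE mulrC.
apply/colP => j; rewrite !mxE summxE.
transitivity (vol p (invmx (metric p) *m u p)^T w (delta_mx 0 j)).
  rewrite volE rdetE sum3 !mxE !volE !rdetE !mxE /=; ring.
rewrite vol_coframe usharp; congr (_ * _).
under eq_bigr do rewrite mxE.
rewrite -rowE !rdetE sum3 !rdetE !mxE /=; ring.
Qed.

End AtPoint.

Lemma deriv_along_sum U f p w : open U -> U p -> smooth_on U f ->
  deriv_along f p w = \sum_i w 0 i * partial (chart_at p) i f p.
Proof.
move=> oU Up sf; apply: derive_row.
by apply: smooth_on_differentiable sf => //; exact: chart_atP.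
Qed.

Lemma nabla_alongE u p w : nabla_along u p w = \sum_i w 0 i *: (row i (nabla u p))^T.
Proof.
apply/colP => j; rewrite /nabla_along !mxE summxE; apply: eq_bigr => i _.
by rewrite !mxE.
Qed.

Lemma form_comp_chart_at u p : form_comp (chart_at p) u p = u p.
Proof. by rewrite /form_comp cbasis_chart_at mul1mx. Qed.

Lemma nabla_along_sum U p w (e : 'I_3 -> form1 M) (k : 'I_3 -> M -> R) u :
  open U -> U p -> (forall a, smooth_form1 U (e a)) -> (forall a, smooth_on U (k a)) ->
  (forall q, U q -> u q = \sum_a k a q *: e a q) ->
  nabla_along u p w =
  \sum_a (deriv_along (k a) p w *: e a p + k a p *: nabla_along (e a) p w).
Proof.
move=> oU Up se sk uE.
have dp := chart_atP p; set c := chart_at p in dp *.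
have pE : cinv c (cmap c p) = p by rewrite cmapK.
have rowE' i : (row i (nabla u p))^T = \sum_a (partial c i (k a) p *: e a p
     + k a p *: (row i (nabla (e a) p))^T).
  rewrite /nabla -/c coord_nabla_row.
  have -> : form_comp c u p = \sum_a k a p *: form_comp c (e a) p.
    by rewrite /form_comp uE // mulmx_sumr; apply: eq_bigr => a _; rewrite scalemxAr.
  have -> : derive_entries (delta_mx 0 i) (form_comp c u \o cinv c) (cmap c p) =
     \sum_a (partial c i (k a) p *: form_comp c (e a) p +
       k a p *: derive_entries (delta_mx 0 i) (form_comp c (e a) \o cinv c) (cmap c p)).
    apply/colP => j; rewrite mxE summxE.
    rewrite (@near_eq_derive _ _ _ _
      (\sum_(a < 3) ((k a \o cinv c) * (fun z =>
          form_comp c (e a) (cinv c z) j 0)))); last first.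
      apply: filterS (near_chart dp oU Up) => z [Uz _ _].
      rewrite fct_sumE /= /form_comp uE // mulmx_sumr summxE; apply: eq_bigr => a _.
      by rewrite -scalemxAr mxE.
    have dk a : derivable (k a \o cinv c) (cmap c p) (delta_mx 0 i).
      by apply: diff_derivable; exact: smooth_on_differentiable (sk a).
    have de a : derivable (fun z => form_comp c (e a) (cinv c z) j 0) (cmap c p) (delta_mx 0 i).
      exact: form_comp_derivable (se a) _ _.
    rewrite derive_sum; last by move=> a; apply: derivableM; [exact: dk|exact: de].
    apply: eq_bigr => a _; rewrite deriveM; [|exact: dk|exact: de].
    rewrite [RHS]mxE [RHS]addrC; congr (_ + _).
      by rewrite /= pE mxE; congr (_ * _); rewrite mxE.
    by rewrite /= pE [RHS]mxE; exact: mulrC.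
  rewrite mulmx_sumr -sumrB; apply: eq_bigr => a _.
  rewrite coord_nabla_row form_comp_chart_at -addrA; congr (_ + _).
  by rewrite scalerBr scalemxAr.
rewrite nabla_alongE.
under eq_bigr do rewrite rowE' scaler_sumr.
rewrite exchange_big; apply: eq_bigr => a _.
rewrite (deriv_along_sum _ oU Up (sk a)) scaler_suml nabla_alongE scaler_sumr -big_split.
by apply: eq_bigr => i _; rewrite scalerDr !scalerA [k a p * _]mulrC.
Qed.

Section Connection.
Variables (U : set M) (e : 'I_3 -> form1 M) (p : M).
Hypotheses (oU : open U) (Up : U p) (se : forall a, smooth_form1 U (e a)).
Hypothesis oe : forall q, U q -> orthonormal_at e q.

Lemma nabla_coframe w a :
  nabla_along (e a) p w = - \sum_b (eta R a * conn_form e p w a b) *: e b p.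
Proof.
rewrite {1}(coframe_sum (oe Up) (nabla_along (e a) p w)) -sumrN; apply: eq_bigr => b _.
rewrite -scaleNr; congr (_ *: _); rewrite /conn_form mulrN opprK !mulrA eta_sq mul1r.
by [].
Qed.

Let c := chart_at p.
Let E q := cbasis c q *m coframe_mx e q.

Let coframe_comp q j k : E q j k = form_comp c (e k) q j 0.
Proof.
by rewrite /E /form_comp [LHS]mxE [RHS]mxE; apply: eq_bigr =>
    l _; rewrite [coframe_mx _ _ _ _]mxE.
Qed.

(** The identity g = E eta E^T is differentiated in the chart [chart_at p]. As eta is constant and
    the Christoffel symbols are compatible with g, the covariant derivative W of E satisfies W eta
    E^T + E eta W^T = 0. *)
Lemma cometric_nabla_skew i a b :
  cometric p (row i (nabla (e a) p))^T (e b p) +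
      cometric p (e a p) (row i (nabla (e b) p))^T = 0.
Proof.
have dp : cdom c p by exact: chart_atP.
have pE : cinv c (cmap c p) = p by rewrite cmapK.
pose v : 'rV[R]_3 := delta_mx 0 i.
pose W : 'M[R]_3 := \matrix_(k, a) nabla (e a) p i k.
have E0 : E p = coframe_mx e p by rewrite /E cbasis_chart_at mul1mx.
have dE j k : derivable (fun z => E (cinv c z) j k) (cmap c p) v.
  have -> : (fun z => E (cinv c z) j k) = (fun z => form_comp c (e k) (cinv c z) j 0).
    by apply/funext => z; exact: coframe_comp.
  exact: form_comp_derivable (se k) _ _.
have dET j k : derivable (fun z => (E (cinv c z))^T j k) (cmap c p) v.
  rewrite (_ : (fun z => _) = (fun z => E (cinv c z) k j)); first exact: dE.
  by apply/funext => z; rewrite mxE.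
have WE : W = derive_entries v (E \o cinv c) (cmap c p) - chr_mx c i p *m E p.
  apply/matrixP => k d; rewrite [LHS]mxE.
  have := coord_nabla_row c (e d) p i; move/colP/(_ k).
  rewrite mxE mxE => ->; rewrite mxE [RHS]mxE; congr (_ + _).
    rewrite [LHS]mxE [RHS]mxE.
    have -> // : (fun z => (E \o cinv c) z k d) = (fun z =>
        (form_comp c (e d) \o cinv c) z k 0).
    by apply/funext => z; exact: coframe_comp.
  rewrite mxE [RHS]mxE; congr (- _); rewrite [LHS]mxE [RHS]mxE; apply: eq_bigr => l _.
  by rewrite coframe_comp.
have dg : dmetric c i p = derive_entries v (E \o cinv c) (cmap c p) *m eta_mx R *m (E p)^T
    + E p *m eta_mx R *m (derive_entries v (E \o cinv c) (cmap c p))^T.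
  rewrite /dmetric -/v (@derive_entries_near _ _ _ _ _ _
     (fun z => (E (cinv c z) *m eta_mx R) *m (E (cinv c z))^T)); last first.
    apply: filterS (near_chart dp oU Up) => z [Uz _ _] /=.
    by rewrite /coord_metric -(coframe_metric (oe Uz)) /E trmx_mul !mulmxA.
  have deta j k : derivable (fun z : 'rV[R]_3 =>
      eta_mx R j k) (cmap c p) v by exact: derivable_cst.
  rewrite derive_entries_mul; last 2 first.
  - by apply: derivable_mulmx; [exact: dE|exact: deta].
  - exact: dET.
  rewrite derive_entries_tr pE; congr (_ *m _ + _).
  rewrite (@derive_entries_mul _ _ _ _ _ _ (E \o cinv c) (fun=> eta_mx R)); last 2 first.
  - exact: dE.
  - exact: deta.
  rewrite (_ : derive_entries v (fun=> eta_mx R) _ = 0) ?mulmx0 ?addr0 //.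
  by apply/matrixP => j k; rewrite mxE derive_cst mxE.
have Wskew : W *m eta_mx R *m (E p)^T + E p *m eta_mx R *m W^T = 0.
  have := chr_compat i dp; rewrite dg coord_metric_chart_at -(coframe_metric (oe Up)) -E0 WE.
  set D := derive_entries _ _ _; set G := chr_mx _ _ _; move=> H.
  have -> : (D - G *m E p)^T = D^T - (E p)^T *m G^T.
    by rewrite -trmx_mul; apply/matrixP => j k; rewrite !mxE.
  rewrite !mulmxBl mulmxBr addrACA -H -opprD !mulmxA; exact: subrr.
pose Z := W^T *m invmx (metric p) *m E p.
have ZE : cometric p (row i (nabla (e a) p))^T (e b p) = Z a b.
  rewrite /cometric /Z -(col_coframe_mx e p b) trmxK -E0 -col_mulmx [LHS]mxE.
  have -> : row i (nabla (e a) p) = row a W^T by apply/rowP => k; rewrite !mxE.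
  by rewrite -!row_mul mxE.
have ZE' : cometric p (e a p) (row i (nabla (e b) p))^T = Z b a.
  rewrite cometricC /cometric /Z -(col_coframe_mx e p a) trmxK -E0 -col_mulmx [LHS]mxE.
  have -> : row i (nabla (e b) p) = row b W^T by apply/rowP => k; rewrite !mxE.
  by rewrite -!row_mul mxE.
suff : Z + Z^T = 0 by rewrite ZE ZE' => /matrixP/(_ a b); rewrite !mxE.
apply: skew_gram Wskew; last exact: eta_mxK.
- by rewrite E0; exact: coframe_gram (oe Up).
- by rewrite trmx_inv Defs.metric_sym.
Qed.

Lemma conn_form_skew w a b : conn_form e p w a b = - conn_form e p w b a.
Proof.
have XY : cometric p (nabla_along (e a) p w) (e b p)
    = - cometric p (nabla_along (e b) p w) (e a p).
  apply/eqP; rewrite -addr_eq0 !nabla_alongE !cometric_suml -big_split big1 //= => i _.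
  by rewrite -mulrDr (cometricC p _ (e a p)) cometric_nabla_skew mulr0.
by rewrite /conn_form XY mulrN (mulrC (eta R a)).
Qed.

End Connection.

End Frames.

(** * Null forms with nabla u = f *u vanish nowhere *)

Section Gronwall.
Context {R : realType}.

Lemma nonincreasing_01 (g dg : R -> R) :
  (forall t : R, t \in `[0, 1] -> is_derive t 1 g (dg t)) ->
  (forall t : R, t \in `[0, 1] -> dg t <= 0) -> g 1 <= g 0.
Proof.
move=> dgP dg0.
have P1 (t : R) : t \in `]0, 1[ -> is_derive t 1 g (dg t).
  rewrite in_itv /= => /andP[t0 t1]; apply: dgP.
  by rewrite in_itv /= (ltW t0) (ltW t1).
have P2 : {within `[0, 1], continuous g}.
  by apply: derivable_within_continuous => t /dgP[].
have [t t01 E] := @MVT_segment R g dg 0 1 ler01 P1 P2.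
by rewrite -subr_le0 E subr0 mulr1 dg0.
Qed.

(** The product of N with exp(- K t) is nonincreasing and starts at 0, so N 1 is nonpositive. *)
Lemma differential_inequality_eq0 (N dN : R -> R) (K : R) :
  (forall t : R, t \in `[0, 1] -> is_derive t 1 N (dN t)) ->
  (forall t : R, t \in `[0, 1] -> dN t <= K * N t) -> N 0 = 0 -> 0 <= N 1 -> N 1 = 0.
Proof.
move=> dNP dNK N0 N1.
pose g (t : R) := N t * expR (- K * t).
pose dg (t : R) := (dN t - K * N t) * expR (- K * t).
have dgP (t : R) : t \in `[0, 1] -> is_derive t 1 g (dg t).
  move=> t01; have dNt := dNP _ t01.
  have dl : is_derive t 1 (fun s : R => - K * s) (- K).
    have := is_deriveZ (- K) (is_derive_id t (1 : R)).
    by move=> H; apply: is_derive_eq H _; rewrite [LHS]mulr1.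
  have de : is_derive t 1 (fun s : R => expR (- K * s)) (- K * expR (- K * t)).
    have := @is_derive1_comp R expR (fun s => - K * s) t (expR (- K * t)) (- K) _ dl.
    by move=> H; apply: is_derive_eq (H _) _; rewrite mulrC.
  have H := is_deriveM dNt de; apply: is_derive_eq H _.
  rewrite /dg /GRing.scale /=; ring.
have g10 : g 1 <= 0.
  have -> : 0 = g 0 by rewrite /g N0 mul0r.
  apply: nonincreasing_01 dgP _ => t t01.
  by rewrite /dg mulr_le0_ge0 ?expR_ge0 // subr_le0 dNK.
apply/eqP; rewrite eq_le N1 andbT.
by move: g10; rewrite /g pmulr_lle0 ?expR_gt0.
Qed.

(* Gronwall's inequality for the sum of the squares along the segments issued
   from [x0]. *)
Lemma linear_system_eq0 (y : 'I_3 -> 'rV[R]_3 -> R) (x0 : 'rV[R]_3) (r C : R) :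
  (forall j x, ball x0 r x -> differentiable (y j) x) ->
  (forall i j x, ball x0 r x -> `|'D_(delta_mx 0 i) (y j) x| <= C * \sum_k `|y k x|) ->
  0 <= C -> (forall j, y j x0 = 0) ->
  forall j x, ball x0 r x -> y j x = 0.
Proof.
move=> dy bD C0 y0 j x bx.
have r0 : 0 < r by move: bx; rewrite -ball_normE /=; exact: le_lt_trans.
pose v := x - x0.
have vr : `|v| < r by move: bx; rewrite -ball_normE /= distrC.
have bt (t : R) : t \in `[0, 1] -> ball x0 r (t *: v + x0).
  rewrite in_itv /= => /andP[t0 t1].
  rewrite -ball_normE /= distrC addrK normrZ (ger0_norm t0) (le_lt_trans _ vr) //.
  by rewrite ler_piMl.
pose Y k (t : R) := y k (t *: v + x0).
pose dY k (t : R) := 'D_v (y k) (t *: v + x0).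
have dYP k (t : R) : t \in `[0, 1] -> is_derive t 1 (Y k) (dY k t).
  by move=> t01; apply: is_derive_line; apply: diff_derivable; apply: dy; exact: bt.
pose N (t : R) := Y 0 t * Y 0 t + Y 1 t * Y 1 t + Y 2%:R t * Y 2%:R t.
pose dN (t : R) := 2 * (Y 0 t * dY 0 t + Y 1 t * dY 1 t + Y 2%:R t * dY 2%:R t).
have dNP (t : R) : t \in `[0, 1] -> is_derive t 1 N (dN t).
  move=> t01; have D0 := dYP 0 t t01; have D1 := dYP 1 t t01; have D2 := dYP 2%:R t t01.
  have := is_deriveD (is_deriveD (is_deriveM D0 D0) (is_deriveM D1 D1)) (is_deriveM D2 D2).
  move=> H; apply: is_derive_eq H _; rewrite /dN /GRing.scale /=; ring.
have dYb k (t : R) : t \in `[0, 1] -> `|dY k t| <= 3 * (C * r) * \sum_l `|Y l t|.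
  move=> t01; rewrite /dY derive_row; last by apply: dy; exact: bt.
  apply: le_trans (ler_norm_sum _ _ _) _.
  have -> : 3 * (C * r) * \sum_l `|Y l t| = \sum_(i < 3) r * (C * \sum_l `|Y l t|).
    by rewrite sumr_const card_ord -mulr_natr; ring.
  apply: ler_sum => i _; rewrite normrM; apply: ler_pM => //.
    by apply: le_trans (row3_entry_le _ _) (ltW vr).
  by apply: bD; exact: bt.
(* Here 18 = 2 * 3 * 3: the derivative of a square, the three coordinate directions in [dYb], and
   (|a| + |b| + |c|)^2 <= 3 (a^2 + b^2 + c^2). *)
have dNK (t : R) : t \in `[0, 1] -> dN t <= 18 * (C * r) * N t.
  move=> t01.
  have H0 := dYb 0 t t01; have H1 := dYb 1 t t01; have H2 := dYb 2%:R t t01.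
  move: H0 H1 H2; rewrite !sum3 => H0 H1 H2.
  have K0 : 0 <= C * r by rewrite mulr_ge0 // ltW.
  rewrite /dN /N.
  move: (Y 0 t) (Y 1 t) (Y 2%:R t) (dY 0 t) (dY 1 t) (dY 2%:R t) (C * r) K0 H0 H1 H2.
  move=> a b c da db dc K K0 H0 H1 H2.
  have P z dz : `|dz| <= 3 * K * (`|a| + `|b| + `|c|) ->
      z * dz <= 3 * K * (`|a| + `|b| + `|c|) * `|z|.
    by move=> Hz; rewrite (le_trans (ler_norm _)) // normrM mulrC ler_wpM2r.
  have := P a da H0; have := P b db H1; have := P c dc H2.
  have sq (z : R) : `|z| * `|z| = z * z by rewrite -!expr2 real_normK ?num_real.
  have Q : (`|a| + `|b| + `|c|) * (`|a| + `|b| + `|c|) <= 3 * (a * a + b * b + c * c).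
    rewrite -(sq a) -(sq b) -(sq c); have := sqr_ge0 (`|a| - `|b|); have :=
        sqr_ge0 (`|a| - `|c|).
    have := sqr_ge0 (`|b| - `|c|); rewrite !expr2; nra.
  have : 3 * K * ((`|a| + `|b| + `|c|) * (`|a| + `|b| + `|c|)) <= 3 * K * (3 * (a * a +
      b * b + c * c)).
    by rewrite ler_wpM2l // mulr_ge0.
  nra.
have N00 : N 0 = 0 by rewrite /N /Y !scale0r !add0r !y0 mulr0 !addr0.
have Nge t : 0 <= N t by rewrite /N -!expr2 !addr_ge0 ?sqr_ge0.
have := differential_inequality_eq0 dNP dNK N00 (Nge 1).
have vE : v + x0 = x by rewrite /v subrK.
rewrite /N /Y !scale1r vE -!expr2 => /eqP.
rewrite paddr_eq0 ?addr_ge0 ?sqr_ge0 // paddr_eq0 ?sqr_ge0 // !sqrf_eq0.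
move=> /andP[/andP[/eqP Y0 /eqP Y1] /eqP Y2].
case: j => -[|[|[|//]]] Hj.
- by rewrite -Y0; congr y; apply/val_inj.
- by rewrite -Y1; congr y; apply/val_inj.
- by rewrite -Y2; congr y; apply/val_inj.
Qed.

End Gronwall.

Section SmoothMatrices.
Context {R : realType} {M : manifold3 R}.
Implicit Types (U : set M).

Definition smooth_mx U m n (A : M ->
    'M[R]_(m, n)) := forall i j, smooth_on U (fun p => A p i j).

Lemma smooth_mx_mul U m n k (A : M -> 'M[R]_(m, n)) (B : M -> 'M[R]_(n, k)) : open U ->
  smooth_mx U A -> smooth_mx U B -> smooth_mx U (fun p => A p *m B p).
Proof.
move=> oU sA sB i j; apply: (@smooth_on_eq _ _ _ (fun p => \sum_l A p i l * B p l j)) => //.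
  by move=> p _; rewrite mxE.
by apply: smooth_on_sum => // l; apply: smooth_onM; [|exact: sA|exact: sB].
Qed.

Lemma smooth_mx_tr U m n (A : M -> 'M[R]_(m, n)) : open U ->
  smooth_mx U A -> smooth_mx U (fun p => (A p)^T).
Proof.
by move=> oU sA i j; apply: smooth_on_eq (sA j i) => // p _; rewrite mxE.
Qed.

Lemma smooth_on_det U n (A : M -> 'M[R]_n) : open U -> smooth_mx U A ->
  smooth_on U (fun p => \det (A p)).
Proof.
move=> oU sA; apply: smooth_on_sum => // s; apply: smooth_onZ => //.
by apply: smooth_on_prod => // i; exact: sA.
Qed.

Lemma smooth_mx_inv U n (A : M -> 'M[R]_n) : open U -> smooth_mx U A ->
  (forall p, U p -> A p \in unitmx) -> smooth_mx U (fun p => invmx (A p)).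
Proof.
move=> oU sA Au i j.
apply: (@smooth_on_eq _ _ _ (fun p => (\det (A p))^-1 * cofactor (A p) j i)) => //.
  by move=> p Up; rewrite /invmx Au // !mxE.
apply: smooth_onM => //.
  apply: smooth_onV => //; last exact: smooth_on_det.
  by move=> p /Au; rewrite unitmxE unitfE.
rewrite /cofactor; apply: smooth_onZ => //; apply: smooth_on_det => // a b.
by apply: smooth_on_eq (sA (lift j a) (lift i b)) => // p _; rewrite !mxE.
Qed.

End SmoothMatrices.

(** * The equation for u as a linear system in a chart *)

Section NowhereZero.
Context {R : realType} {M : lorentz3 R}.
Implicit Types (U : set M) (p q : M) (c : chart M) (u : form1 M).

Lemma smooth_coord_metric c : smooth_mx (cdom c) (fun p : M => coord_metric c p).
Proof. by move=> i j; exact: metric_smooth. Qed.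

Lemma det_coord_metric c p :
  \det (coord_metric c p) = \det (cbasis c p) ^+ 2 * \det (metric p).
Proof. by rewrite /coord_metric !det_mulmx det_tr; ring. Qed.

Lemma det_coord_metric_lt0 c p : cdom c p -> \det (coord_metric c p) < 0.
Proof.
move=> dp; rewrite det_coord_metric pmulr_rlt0 ?det_metric_lt0 //.
by rewrite exprn_gt0 // det_cbasis_gt0.
Qed.

Lemma sqrt_det_coord_metric c p : cdom c p ->
  Num.sqrt (- \det (coord_metric c p)) = \det (cbasis c p) * Num.sqrt (- \det (metric p)).
Proof.
move=> dp; rewrite det_coord_metric -mulrN sqrtrM ?sqr_ge0 //.
by rewrite sqrtr_sqr gtr0_norm // det_cbasis_gt0.
Qed.

Lemma smooth_sqrt_det c : smooth_on (cdom c) (fun p : M =>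
    Num.sqrt (- \det (coord_metric c p))).
Proof.
have oc : open (cdom c) by exact: cdom_open.
apply: smooth_on_sqrt => //.
  by move=> p dp; rewrite oppr_gt0 det_coord_metric_lt0.
by apply: smooth_onN => //; apply: smooth_on_det => //; exact: smooth_coord_metric.
Qed.

Lemma christoffel_continuous c k i j z : (cmap c @` cdom c) z ->
  {for z, continuous (fun z => christoffel c k i j (cinv c z : M))}.
Proof.
move=> cz; have oV := @cimg_open _ M c.
have VE : cmap c @` (cdom c `&` cdom c) = cmap c @` cdom c by rewrite setIid.
have cpart a b l : {for z, continuous (fun z => partial c l (fun q : M =>
    coord_metric c q a b) (cinv c z))}.
  have := @metric_smooth _ M c a b c 1%N; rewrite VE => -[_ /(_ l)[_ Cl]].
  apply: (@Ck_cont R 0 (cmap c @` cdom c) _ z _ cz).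
  pose F := (fun q : M => coord_metric c q a b) \o cinv c.
  apply: (@Ck_eq R 0 _ (fun x => 'D_(delta_mx 0 l) F x) _ oV); last exact: Cl.
  by move=> _ [p dp <-]; rewrite /partial (cmapK dp).
have cinvm a b : {for z, continuous (fun z => invmx (coord_metric c (cinv c z)) a b)}.
  have oc : open (cdom c) by exact: cdom_open.
  have := smooth_mx_inv oc (@smooth_coord_metric c) (@coord_metric_unit _ _ c) a b c 0%N.
  by rewrite VE => /Ck_cont; exact.
pose T l (x : 'rV[R]_3) := invmx (coord_metric c (cinv c x : M)) k l *
  (partial c i (fun q : M => coord_metric c q j l) (cinv c x)
   + partial c j (fun q : M => coord_metric c q i l) (cinv c x)
   - partial c l (fun q : M => coord_metric c q i j) (cinv c x)).
have cT l : {for z, continuous (T l)}.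
  apply: continuousM; first exact: cinvm.
  by apply: continuousB; [apply: continuousD|]; exact: cpart.
have -> : (fun x => christoffel c k i j (cinv c x : M)) = (fun x =>
    2^-1 * (T 0 x + T 1 x + T 2%:R x)).
  by apply/funext => x; rewrite /christoffel sum3.
apply: continuousM; first exact: cst_continuous.
by apply: continuousD; [apply: continuousD|]; exact: cT.
Qed.

Lemma hodge1_bilinear u p (x y : 'rV[R]_3) :
  (x *m hodge1 u p *m y^T) 0 0 = vol p (invmx (metric p) *m u p)^T x y.
Proof. by rewrite mxE sum3 !mxE !sum3 !mxE !volE !rdetE !mxE /=; ring. Qed.

Lemma metric_frame_change c p : cdom c p ->
  (cbasis c p)^T *m invmx (coord_metric c p) *m cbasis c p = invmx (metric p).
Proof.
move=> dp; have Bu := cbasis_unit dp.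
have H : (cbasis c p *m metric p) *m ((cbasis c p)^T *m invmx (coord_metric c p)) = 1%:M.
  by rewrite mulmxA -/(coord_metric c p) mulmxV // coord_metric_unit.
have := mulmx1C H; rewrite mulmxA => H2.
by rewrite -[RHS]mul1mx -H2 mulmxK // metric_unit.
Qed.

(** The usual expression of the star through sqrt |det g|. The determinant of [cbasis c p] is
    absorbed by the square root because the atlas is oriented. *)
Lemma coord_hodge c u p i j : cdom c p ->
  (cbasis c p *m hodge1 u p *m (cbasis c p)^T) i j =
  Num.sqrt (- \det (coord_metric c p)) *
    rdet ((form_comp c u p)^T *m invmx (coord_metric c p)) (delta_mx 0 i) (delta_mx 0 j).
Proof.
move=> dp; rewrite mulmx_row_col row_mul -tr_row hodge1_bilinear sqrt_det_coord_metric // volE.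
set B := cbasis c p.
have -> : (invmx (metric p) *m u p)^T = ((form_comp c u p)^T *m invmx (coord_metric c p)) *m B.
  rewrite trmx_mul trmx_inv Defs.metric_sym -(metric_frame_change dp) /form_comp trmx_mul.
  by rewrite !mulmxA.
by rewrite !rowE rdet_mulmx -/B; ring.
Qed.

(* In a chart the equation [nabla u = f *: hodge1 u] is a linear first order
   system with continuous coefficients, so [u] vanishes near each of its zeros. *)
Lemma null_form_zero_open u f p : smooth_form1 setT u -> smooth_on setT f ->
  (forall q : M, nabla u q = f q *: hodge1 u q) -> u p = 0 ->
  \forall q \near p, u q = 0.
Proof.
move=> su sf nu up0.
have dp := chart_atP p; set c := chart_at p in dp.
have oc : open (cdom c) by exact: cdom_open.
pose z0 := cmap c p; pose V := cmap c @` cdom c.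
have oV : open V by exact: cimg_open.
have Vz0 : V z0 by exists p.
pose y j z := form_comp c u (cinv c z) j 0.
pose G (z : 'rV[R]_3) := invmx (coord_metric c (cinv c z : M)).
pose sq (z : 'rV[R]_3) := Num.sqrt (- \det (coord_metric c (cinv c z : M))).
(* Coefficient of u_k in d_i u_j: the first term is the star, row k of the inverse metric raising
   the index of u, and the second undoes the Christoffel correction. *)
pose a i j k z := f (cinv c z) * sq z * rdet (row k (G z)) (delta_mx 0 i) (delta_mx 0 j)
  + christoffel c k i j (cinv c z : M).
have Dy i j z : V z -> 'D_(delta_mx 0 i) (y j) z = \sum_k a i j k z * y k z.
  move=> [q dq <-].
  have E1 : coord_nabla c u q i j = 'D_(delta_mx 0 i) (y j) (cmap c q)
       - \sum_k christoffel c k i j q * form_comp c u q k 0.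
    by rewrite /coord_nabla [LHS]mxE.
  have E2 : coord_nabla c u q i j = f q * (Num.sqrt (- \det (coord_metric c q)) *
     rdet ((form_comp c u q)^T *m invmx (coord_metric c q)) (delta_mx 0 i) (delta_mx 0 j)).
    rewrite (@coord_nabla_change _ _ c (chart_at q) q dq (chart_atP q) setT u openT I su).
    by rewrite -/(nabla u q) -cbasisE nu -scalemxAr -scalemxAl mxE coord_hodge.
  have -> : 'D_(delta_mx 0 i) (y j) (cmap c q) = coord_nabla c u q i j +
      \sum_k christoffel c k i j q * form_comp c u q k 0.
    by rewrite E1 subrK.
  rewrite E2 /a /y /sq /G (cmapK dq) !sum3 !rdetE.
  move: (invmx _) (form_comp c u q) => g v.
  rewrite !mxE !sum3 !mxE; ring.
have ca i j k : {for z0, continuous (a i j k)}.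
  have cc := @cinv_cont _ _ c z0 Vz0.
  have onM (h : M -> R) : smooth_on (cdom c) h -> {for z0, continuous (h \o cinv c)}.
    move=> sh; apply: continuous_comp; first exact: cc.
    by rewrite /z0 cmapK //; apply: smooth_on_continuous sh.
  have cG l m : {for z0, continuous (fun z => G z l m)}.
    apply: (onM (fun q => invmx (coord_metric c q) l m)).
    exact: smooth_mx_inv oc (@smooth_coord_metric c) (@coord_metric_unit _ _ c) l m.
  have cf : {for z0, continuous (f \o cinv c)}.
    by apply: onM; apply: smooth_on_subset sf.
  have csq : {for z0, continuous sq} by exact: onM (@smooth_sqrt_det c).
  apply: continuousD; last exact: christoffel_continuous.
  apply: continuousM; first by apply: continuousM; [exact: cf|exact: csq].
  pose d (i j k l : 'I_3) : R := (delta_mx 0 i : 'rV[R]_3) 0 k * (delta_mx 0 j : 'rV[R]_3) 0 l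
    - (delta_mx 0 i : 'rV[R]_3) 0 l * (delta_mx 0 j : 'rV[R]_3) 0 k.
  have -> : (fun z => rdet (row k (G z)) (delta_mx 0 i) (delta_mx 0 j)) =
     (fun z => G z k 0 * d i j 1 2%:R - G z k 1 * d i j 0 2%:R + G z k 2%:R * d i j 0 1).
    by apply/funext => z; rewrite rdetE /d; congr (_ * _ - _ * _ + _ * _); rewrite [LHS]mxE.
  by apply: continuousD; [apply: continuousB|]; apply: continuousM; do ?exact: cG;
      exact: cst_continuous.
(* A common bound for all coefficients near z0: each of them stays there within 1 of its value at
   z0. *)
pose C := \sum_i \sum_j \sum_k (`|a i j k z0| + 1).
have aC i j k : `|a i j k z0| + 1 <= C.
  have pos i' j' k' : 0 <= `|a i' j' k' z0| + 1 by rewrite addr_ge0.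
  have le1 (F : 'I_3 -> R) l : (forall m, 0 <= F m) -> F l <= \sum_m F m.
    by move=> F0; rewrite (bigD1 l) //= lerDl sumr_ge0.
  apply: le_trans (le1 (fun k => `|a i j k z0| + 1) k _) _; first by move=> ?; exact: pos.
  apply: le_trans (le1 (fun j => \sum_k (`|a i j k z0| + 1)) j _) _.
    by move=> ?; apply: sumr_ge0 => *; exact: pos.
  apply: (le1 (fun i => \sum_j \sum_k (`|a i j k z0| + 1))) => ?.
  by do 2 apply: sumr_ge0 => *; exact: pos.
have nearC : \forall z \near z0, V z /\ forall i, forall j, forall k, `|a i j k z| <= C.
  have nA : \forall z \near z0, forall i, forall j, forall k, `|a i j k z| <= C.
    apply: (@filter_forall _ 'I_3 (fun i z =>
        forall j, forall k, `|a i j k z| <= C) (nbhs z0)) => i.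
    apply: (@filter_forall _ 'I_3 (fun j z => forall k, `|a i j k z| <= C) (nbhs z0)) => j.
    apply: (@filter_forall _ 'I_3 (fun k z => `|a i j k z| <= C) (nbhs z0)) => k.
    have Hlt : \forall z \near z0, `|a i j k z0 - a i j k z| < 1.
      exact: (cvgrPdist_lt _ _).1 (ca i j k) 1 ltr01.
    apply: filterS Hlt => z Hz; apply: le_trans (aC i j k).
    by rewrite -lerBlDl (le_trans _ (ltW Hz)) // distrC lerB_dist.
  by apply: filterS2 (near_open oV Vz0) nA => z Vz Hz; split.
have /nbhs_ballP[r /= r0 Hr] := nearC.
have C0 : 0 <= C by apply: le_trans (aC 0 0 0); rewrite addr_ge0.
have y0 j : y j z0 = 0.
  by rewrite /y /z0 cmapK // /form_comp up0 mulmx0 mxE.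
have dy j z : ball z0 r z -> differentiable (y j) z.
  move=> /Hr[[q dq <-] _].
  apply: (@smooth_on_differentiable _ _ (setT `&` cdom c) (fun q => form_comp c u q j 0)) => //.
    by rewrite setTI.
have bD i j z : ball z0 r z -> `|'D_(delta_mx 0 i) (y j) z| <= C * \sum_k `|y k z|.
  move=> /Hr[Vz Hz]; rewrite Dy // mulr_sumr.
  apply: le_trans (ler_norm_sum _ _ _) _; apply: ler_sum => k _.
  by rewrite normrM ler_wpM2r.
have yz := linear_system_eq0 dy bD C0 y0.
have nb : \forall q \near p, cdom c q /\ ball z0 r (cmap c q).
  have nr : \forall q \near p, ball z0 r (cmap c q).
    by have := @cmap_cont _ _ c p dp; apply; exact: nbhsx_ballx.
  by apply: filterS2 (near_open oc dp) nr => q dq bq; split.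
apply: filterS nb => q [dq bq].
have Bu := cbasis_unit dq.
have : cbasis c q *m u q = 0.
  by apply/colP => j; have := yz j _ bq; rewrite /y (cmapK dq) => ->; rewrite mxE.
by move=> /(congr1 (mulmx (invmx (cbasis c q)))); rewrite mulKmx // mulmx0.
Qed.

Lemma null_form_nowhere_zero u f : smooth_form1 setT u -> smooth_on setT f ->
  (forall q : M, nabla u q = f q *: hodge1 u q) ->
  (exists p, u p <> 0) -> forall p, u p <> 0.
Proof.
move=> su sf nu [p0 up0].
have cl : closed [set p : M | u p = 0].
  rewrite -openC openE => p /= up.
  have dp := chart_atP p; set c := chart_at p in dp.
  have oc : open (cdom c) by exact: cdom_open.
  have Bu := cbasis_unit dp.
  have [j yj] : exists j, form_comp c u p j 0 != 0.
    apply/existsP; rewrite -negb_forall; apply/negP => /forallP H; apply: up.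
    have : form_comp c u p = 0.
      by apply/colP => j; rewrite [RHS]mxE; apply/eqP; exact: H.
    by move=> /(congr1 (mulmx (invmx (cbasis c p)))); rewrite mulKmx // mulmx0.
  have oc' : open (setT `&` cdom c) by rewrite setTI.
  have cy := smooth_on_continuous oc' (conj I dp) (su c j).
  have : \forall q \near p, form_comp c u q j 0 != 0.
    have ny : \forall x \near form_comp c u p j 0, x != 0.
      by apply: open_nbhs_nbhs; split => //; exact: open_neq.
    exact: cy ny.
  apply: filterS => q /= yq uq; move: yq.
  by rewrite /form_comp uq mulmx0 mxE eqxx.
have op : open [set p : M | u p = 0].
  by rewrite openE => p /= up; exact: null_form_zero_open su sf nu up.
move=> p up.
have E : [set p : M | u p = 0] = setT.
  apply: (@mfd_connected _ M); first by exists p.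
    by exists [set p : M | u p = 0] => //; rewrite setTI.
  by exists [set p : M | u p = 0] => //; rewrite setTI.
apply: up0; have : setT p0 by [].
by rewrite -E.
Qed.

End NowhereZero.

(** * The Dirac current of a parallel spinor *)

Section QuadraticForms.
Context {R : realType}.

(* The quadratic forms of three anticommuting traceless 2x2 matrices
   [[al a, be a], [ga a, - al a]] with squares eta_a; completeness of such a
   basis of sl(2) makes the vector of their values null. *)
Lemma sl2_completeness (al be ga : 'I_3 -> R) (x y : R) :
  (forall a b, al a * al b + 2^-1 * (be a * ga b + ga a * be b) = eta_mx R a b) ->
  \sum_a eta R a * (ga a * x ^+ 2 - 2 * al a * x * y - be a * y ^+ 2) ^+ 2 = 0.
Proof.
move=> H.
(* [N] is the Gram matrix of half the trace form in the coordinates (al, be, ga), and [N'] is its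
   inverse. The hypothesis B N B^T = eta inverts to B^T eta B = N', the completeness relation. *)
pose B : 'M[R]_3 := \matrix_(a, j) nth 0 [:: al a; be a; ga a] j.
pose N : 'M[R]_3 := \matrix_(i, j) nth 0 (nth [::] [:: [:: 1; 0; 0]; [:: 0; 0; 2^-1];
    [:: 0; 2^-1; 0]] i) j.
pose N' : 'M[R]_3 := \matrix_(i, j) nth 0 (nth [::] [:: [:: 1; 0; 0]; [:: 0; 0; 2]; [:: 0;
    2; 0]] i) j.
have BN : B *m N *m B^T = eta_mx R.
  apply/matrixP => a b; rewrite -H !mxE sum3 !mxE !sum3 !mxE /=; ring.
have N'N : N' *m N = 1%:M.
  apply/matrixP => i j; rewrite !mxE sum3 !mxE.
  by case: i => -[|[|[|//]]] Hi; case: j => -[|[|[|//]]] Hj /=; field.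
have BB : B^T *m eta_mx R *m B = N'.
  have E : B *m (N *m B^T *m eta_mx R) = 1%:M.
    by rewrite !mulmxA BN eta_mxK.
  have := mulmx1C E; move/(congr1 (mulmx N')).
  by rewrite -!mulmxA !(mulmxA N') N'N mul1mx mulmx1 !mulmxA.
have S i j : \sum_a eta R a * B a i * B a j = N' i j.
  rewrite -BB /eta_mx mul_mx_diag !mxE; apply: eq_bigr => a _.
  by rewrite !mxE; congr (_ * _); rewrite mulrC.
have := S 0 0; have := S 0 1; have := S 0 2%:R; have := S 1 1; have := S 1 2%:R; have :=
    S 2%:R 2%:R.
rewrite !sum3 !mxE /= => S22 S12 S11 S02 S01 S00.
(* By completeness only two sums are nonzero, those of eta al al, equal to 1, and of eta be ga,
   equal to 2. They meet in the coefficient of x^2 y^2, where 4 * 1 - 2 * 2 = 0. *)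
transitivity (
  (eta R 0 * ga 0 * ga 0 + eta R 1 * ga 1 * ga 1 + eta R 2%:R * ga 2%:R * ga 2%:R) * x ^+ 4
  + 4 * (eta R 0 * al 0 * al 0 + eta R 1 * al 1 * al 1 +
      eta R 2%:R * al 2%:R * al 2%:R) * x ^+ 2 * y ^+ 2
  + (eta R 0 * be 0 * be 0 + eta R 1 * be 1 * be 1 + eta R 2%:R * be 2%:R * be 2%:R) * y ^+ 4
  - 4 * (eta R 0 * al 0 * ga 0 + eta R 1 * al 1 * ga 1 +
      eta R 2%:R * al 2%:R * ga 2%:R) * x ^+ 3 * y
  - 2 * (eta R 0 * be 0 * ga 0 + eta R 1 * be 1 * ga 1 +
      eta R 2%:R * be 2%:R * ga 2%:R) * x ^+ 2 * y ^+ 2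
  + 4 * (eta R 0 * al 0 * be 0 + eta R 1 * al 1 * be 1 +
      eta R 2%:R * al 2%:R * be 2%:R) * x * y ^+ 3); first by ring.
rewrite S22 S12 S11 S02 S01 S00; ring.
Qed.

(** A traceless matrix with square -1 has a definite quadratic form: ga times the form is (ga x - al
    y)^2 + y^2. *)
Lemma definite_form_eq0 (al be ga x y : R) : al * al + be * ga = -1 ->
  ga * x ^+ 2 - 2 * al * x * y - be * y ^+ 2 = 0 -> x = 0 /\ y = 0.
Proof.
move=> H E.
have S : (ga * x - al * y) ^+ 2 + y ^+ 2 = 0.
  transitivity (ga * (ga * x ^+ 2 - 2 * al * x * y - be * y ^+ 2) + (al * al + be * ga +
      1) * y ^+ 2).
    by ring.
  by rewrite E H; ring.
move/eqP: S; rewrite paddr_eq0 ?sqr_ge0 // !sqrf_eq0 => /andP[/eqP S1 /eqP y0].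
split=> //; have g0 : ga != 0.
  apply/eqP => g0; move: H; rewrite g0 mulr0 addr0 => H.
  by have := sqr_ge0 al; rewrite expr2 H oppr_ge0 ler10.
by move: S1; rewrite y0 mulr0 subr0 => /eqP; rewrite mulf_eq0 (negbTE g0) => /eqP.
Qed.

End QuadraticForms.

Section SpinorAlgebra.
Context {R : realType} {M : lorentz3 R} (S : paired_spinor_bundle M).
Implicit Types (p : M).

Section Linear.
Variable p : M.
Implicit Types (x y z : S p) (a b d : 'cV[R]_3).

Lemma pairing0l x : pairing (0 : S p) x = 0.
Proof.
have := @pairing_linear _ _ S p (-1) 0 0 x; rewrite scaler0 addr0; lra.
Qed.

Lemma pairingDl x y z : pairing (x + y) z = pairing x z + pairing y z.
Proof. by have := @pairing_linear _ _ S p 1 x y z; rewrite scale1r mul1r. Qed.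

Lemma pairingZl t x z : pairing (t *: x) z = t * pairing x z.
Proof. by have := @pairing_linear _ _ S p t x 0 z; rewrite !addr0 pairing0l addr0. Qed.

Lemma pairingDr x y z : pairing z (x + y) = pairing z x + pairing z y.
Proof. by rewrite pairing_skew pairingDl opprD -!pairing_skew. Qed.

Lemma pairingZr t x z : pairing z (t *: x) = t * pairing z x.
Proof. by rewrite pairing_skew pairingZl -mulrN -pairing_skew. Qed.

Lemma pairing_suml (I : finType) (F : I -> S p) z :
  pairing (\sum_i F i) z = \sum_i pairing (F i) z.
Proof. by elim/big_rec2: _ => [|i y x _ <-]; rewrite ?pairing0l ?pairingDl. Qed.

Lemma pairing_sumr (I : finType) (F : I -> S p) z :
  pairing z (\sum_i F i) = \sum_i pairing z (F i).
Proof. by rewrite pairing_skew pairing_suml -sumrN; apply: eq_bigr =>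
    i _; rewrite -pairing_skew. Qed.

Lemma pairing_self x : pairing x x = 0.
Proof. have := pairing_skew x x; lra. Qed.

Lemma cl0r a : cl a (0 : S p) = 0.
Proof.
have := @cl_linearr _ _ S p 1 a 0 0; rewrite !scale1r addr0 => H.
by apply/eqP; rewrite -(inj_eq (addrI (cl a 0))) addr0 -H.
Qed.

Lemma clDr a x y : cl a (x + y) = cl a x + cl a y.
Proof. by have := @cl_linearr _ _ S p 1 a x y; rewrite !scale1r. Qed.

Lemma clZr t a x : cl a (t *: x) = t *: cl a x.
Proof. by have := @cl_linearr _ _ S p t a x 0; rewrite cl0r !addr0. Qed.

Lemma cl0l x : cl (0 : 'cV[R]_3) x = 0.
Proof.
have := @cl_linearl _ _ S p 1 0 0 x; rewrite !scale1r addr0 => H.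
by apply/eqP; rewrite -(inj_eq (addrI (cl 0 x))) addr0 -H.
Qed.

Lemma clDl a b x : cl (a + b) x = cl a x + cl b x.
Proof. by have := @cl_linearl _ _ S p 1 a b x; rewrite !scale1r. Qed.

Lemma clZl t a x : cl (t *: a) x = t *: cl a x.
Proof. by have := @cl_linearl _ _ S p t a 0 x; rewrite cl0l !addr0. Qed.

Lemma cl_suml (I : finType) (F : I -> 'cV[R]_3) x :
  cl (\sum_i F i) x = \sum_i cl (F i) x.
Proof. by elim/big_rec2: _ => [|i y z _ <-]; rewrite ?cl0l ?clDl. Qed.

Lemma cl_sumr (I : finType) a (F : I -> S p) :
  cl a (\sum_i F i) = \sum_i cl a (F i).
Proof. by elim/big_rec2: _ => [|i y z _ <-]; rewrite ?cl0r ?clDr. Qed.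

Lemma cl_anticomm a b x : cl a (cl b x) + cl b (cl a x) = (2 * cometric p a b) *: x.
Proof.
have H := @cl_clifford _ _ S p (a + b) x.
have E : cometric p (a + b) (a + b) = cometric p a a + (2 * cometric p a b + cometric p b b).
  have D u v w : cometric p (u + v) w = cometric p u w + cometric p v w.
    by have := cometricDl p 1 u v w; rewrite scale1r mul1r.
  rewrite D (cometricC p a (a + b)) (cometricC p b (a + b)) !D (cometricC p b a); ring.
move: H; rewrite E !clDl !clDr !cl_clifford !scalerDl -!addrA => /addrI.
by rewrite !addrA => /addIr <-.
Qed.

End Linear.

Section Current.
Variables (p : M) (e : 'I_3 -> 'cV[R]_3) (eps : S p).
Hypothesis oe : forall a b : 'I_3, cometric p (e a) (e b) = eta_mx R a b.
Let P a := pairing eps (cl (e a) eps).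

(* [- 4^-1 th_ab e^a e^b] acts on spinors as the lift of an infinitesimal
   rotation: its commutator with [e c] is again a one-form. *)
Lemma current_derivative (th : 'I_3 -> 'I_3 -> R) (y : S p) (c : 'I_3) :
  (forall a b, th a b = - th b a) ->
  y = - (4^-1 *: \sum_a \sum_b th a b *: cl (e a) (cl (e b) eps)) ->
  pairing y (cl (e c) eps) + pairing eps (cl (e c) y) = eta R c * \sum_b th b c * P b.
Proof.
move=> skew ->.
pose T a b d := pairing eps (cl (e a) (cl (e b) (cl (e d) eps))).
have cl_swap a b d : T a b d + T b a d = 2 * eta_mx R a b * P d.
  rewrite /T -pairingDr cl_anticomm oe pairingZr //.
have cl_swapr a b d : T a b d + T a d b = 2 * eta_mx R b d * P a.
  by rewrite /T -pairingDr -clDr cl_anticomm oe clZr pairingZr.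
have -> : pairing (- (4^-1 *: \sum_a \sum_b th a b *: cl (e a) (cl (e b) eps))) (cl (e c) eps)
    = 4^-1 * \sum_a \sum_b th a b * T a b c.
  rewrite -scaleNr pairingZl pairing_suml mulNr -mulrN; congr (_ * _).
  (* Moving two Clifford factors across the pairing reverses their order; exchanging the sums and
     using skewness of [th] restores it. *)
  rewrite exchange_big -sumrN; apply: eq_bigr => a _.
  rewrite pairing_suml -sumrN; apply: eq_bigr => b _.
  by rewrite pairingZl 2!pairing_cl opprK (skew a b) mulNr opprK.
have -> : pairing eps (cl (e c) (- (4^-1 *: \sum_a \sum_b th a b *: cl (e a) (cl (e b) eps))))
    = - (4^-1 * \sum_a \sum_b th a b * T c a b).
  rewrite -scaleNr clZr pairingZr cl_sumr pairing_sumr mulNr; congr (- (_ * _)).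
  apply: eq_bigr => a _; rewrite cl_sumr pairing_sumr; apply: eq_bigr => b _.
  by rewrite clZr pairingZr.
(* The commutator of e_a e_b with e_c: two anticommutations cancel the cubic terms and leave
   one-forms. *)
have TT a b : T a b c - T c a b = 2 * eta_mx R b c * P a - 2 * eta_mx R c a * P b.
  by rewrite -(cl_swapr a b c) -(cl_swap c a b); ring.
rewrite -mulrBr -sumrB.
under eq_bigr => a _.
  rewrite -sumrB; under eq_bigr => b _ do rewrite -mulrBr TT.
  over.
rewrite !sum3 !eta_mxE.
have := skew 0 0; have := skew 1 1; have := skew 2%:R 2%:R.
have := skew 0 1; have := skew 0 2%:R; have := skew 1 2%:R.
case: c {TT} => -[|[|[|//]]] Hc.
- rewrite (_ : Ordinal Hc = 0) /=; last exact/val_inj.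
  move=> -> -> -> h2 h1 h0; have -> : th 0 0 = 0 by lra.
  have -> : th 1 1 = 0 by lra. have -> : th 2%:R 2%:R = 0 by lra.
  by rewrite /eta /=; field.
- rewrite (_ : Ordinal Hc = 1) /=; last exact/val_inj.
  move=> -> -> -> h2 h1 h0; have -> : th 0 0 = 0 by lra.
  have -> : th 1 1 = 0 by lra. have -> : th 2%:R 2%:R = 0 by lra.
  by rewrite /eta /=; field.
- rewrite (_ : Ordinal Hc = 2%:R) /=; last exact/val_inj.
  move=> -> -> -> h2 h1 h0; have -> : th 0 0 = 0 by lra.
  have -> : th 1 1 = 0 by lra. have -> : th 2%:R 2%:R = 0 by lra.
  by rewrite /eta /=; field.
Qed.

End Current.
End SpinorAlgebra.

(** * Three-forms as multiples of the volume form, and their Clifford action *)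

Section Torsion.
Context {R : realType} {M : lorentz3 R}.
Implicit Types (p q : M) (w : 'rV[R]_3).

Lemma delta_coframe (e : 'I_3 -> form1 M) p a : orthonormal_at e p ->
  delta_mx a 0 = \sum_c invmx (coframe_mx e p) c a *: e c p.
Proof.
move=> oe; have Eu := coframe_unit oe.
have : coframe_mx e p *m invmx (coframe_mx e p) = 1%:M by rewrite mulmxV.
move=> /matrixP E; apply/colP => i; rewrite summxE.
transitivity ((1%:M : 'M[R]_3) i a); first by rewrite !mxE eqxx andbT.
rewrite -E mxE; apply: eq_bigr => c _; rewrite [RHS]mxE mulrC; congr (_ * _).
by rewrite mxE.
Qed.

Definition torsion_density (H : form3 M) p : R :=
  H p (delta_mx 0 0) (delta_mx 0 1) (delta_mx 0 2%:R) / Num.sqrt (- \det (metric p)).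

Lemma sqrt_det_metric_gt0 p : 0 < Num.sqrt (- \det (metric p)).
Proof. by rewrite sqrtr_gt0 oppr_gt0 det_metric_lt0. Qed.

Lemma form3_vol (H : form3 M) p x y z : smooth_form3 H ->
  H p x y z = torsion_density H p * vol p x y z.
Proof.
move=> [L A12 A23 _]; rewrite (alternating3E (L p) (A12 p) (A23 p)) volE mulrA divfK //.
by rewrite gt_eqF // sqrt_det_metric_gt0.
Qed.

(** The defining quotient is taken in the coordinates of [chart_at p]. In a fixed chart numerator
    and denominator are both multiplied by the determinant of [cbasis], and the quotient becomes
    visibly smooth. *)
Lemma smooth_torsion_density (H : form3 M) : smooth_form3 H ->
    smooth_on setT (torsion_density H).
Proof.
move=> sH; have [_ _ _ sm] := sH; apply: smooth_on_local => p _.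
have oc : open (cdom (chart_at p)) by exact: cdom_open.
exists (cdom (chart_at p)); split=> //; first exact: chart_atP.
set c := chart_at p in oc *.
apply: (@smooth_on_eq _ _ _ (fun q =>
    H q (row 0 (cbasis c q)) (row 1 (cbasis c q)) (row 2%:R (cbasis c q))
    * (Num.sqrt (- \det (coord_metric c q)))^-1)) => //.
  move=> q dq; rewrite form3_vol // volE -det_rdet sqrt_det_coord_metric //.
  have d0 : \det (cbasis c q) != 0 by rewrite gt_eqF // det_cbasis_gt0.
  have s0 : Num.sqrt (- \det (metric q)) != 0 by rewrite gt_eqF // sqrt_det_metric_gt0.
  by field; rewrite d0 s0.
apply: smooth_onM => //; apply: smooth_onV => //; last exact: smooth_sqrt_det.
by move=> q dq; rewrite gt_eqF // sqrtr_gt0 oppr_gt0 det_coord_metric_lt0.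
Qed.

Lemma sum_rdet w (F : 'M[R]_3) c d :
  \sum_a \sum_b rdet w (delta_mx 0 a) (delta_mx 0 b) * F c a * F d b =
      rdet w (row c F) (row d F).
Proof. by rewrite !sum3 !rdetE !mxE /=; ring. Qed.

Lemma cl2_torsion (S : paired_spinor_bundle M) (e : 'I_3 ->
    form1 M) (H : form3 M) p w (x : S p) :
  orthonormal_at e p -> smooth_form3 H ->
  cl2 (H p w) x = 2^-1 *: \sum_c \sum_d
    (torsion_density H p * (coframe_sign e p * rdet (w *m coframe_mx e p) (delta_mx 0 c)
        (delta_mx 0 d)))
      *: cl (e c p) (cl (e d p) x).
Proof.
move=> oe sH; rewrite /cl2; congr (_ *: _).
have Eu := coframe_unit oe; set E := coframe_mx e p in Eu *.
(* The coordinate covectors are expanded in the coframe through E^-1. The coefficients then become H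
   on the dual frame, whose vectors are the rows of E^-1. *)
transitivity (\sum_c \sum_d (\sum_a \sum_b H p w (delta_mx 0 a) (delta_mx 0 b) * invmx E c
    a * invmx E d b)
   *: cl (e c p) (cl (e d p) x)).
  under eq_bigr => a _.
    under eq_bigr => b _.
      rewrite (delta_coframe a oe) (delta_coframe b oe) cl_suml.
      rewrite (eq_bigr (fun c => \sum_d (invmx E c a * invmx E d b) *: cl (e c p) (cl (e d
          p) x))); last first.
        move=> c _; rewrite clZl cl_suml cl_sumr scaler_sumr; apply: eq_bigr => d _.
        by rewrite clZl clZr scalerA.
      rewrite scaler_sumr.
      under eq_bigr => c _.
        rewrite scaler_sumr; under eq_bigr => d _ do rewrite scalerA mulrA.
        over.
      over.
    over.
  under [RHS]eq_bigr => c _.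
    under eq_bigr => d _.
      rewrite scaler_suml; under eq_bigr => a _ do rewrite scaler_suml.
      over.
    over.
  under eq_bigr => a _ do rewrite exchange_big /=.
  rewrite exchange_big /=; apply: eq_bigr => c _.
  under eq_bigr => a _ do rewrite exchange_big /=.
  by rewrite exchange_big /=.
apply: eq_bigr => c _; apply: eq_bigr => d _; congr (_ *: _).
have -> : \sum_a \sum_b H p w (delta_mx 0 a) (delta_mx 0 b) * invmx E c a * invmx E d b
   = torsion_density H p * Num.sqrt (- \det (metric p)) * \sum_a \sum_b rdet w (delta_mx 0
       a) (delta_mx 0 b) * invmx E c a * invmx E d b.
  rewrite mulr_sumr; apply: eq_bigr => a _; rewrite mulr_sumr; apply: eq_bigr => b _.
  by rewrite form3_vol // volE !mulrA.
rewrite sum_rdet -mulrA -volE (vol_coframe oe) -!row_mul mulVmx //.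
by rewrite !rowE !mulmx1.
Qed.

End Torsion.

Section DerivAlong.
Context {R : realType} {M : manifold3 R}.
Implicit Types (U : set M) (p : M) (w : 'rV[R]_3).

Lemma deriv_along_near U (f g : M -> R) p w : open U -> U p ->
  (forall q, U q -> f q = g q) -> deriv_along f p w = deriv_along g p w.
Proof.
move=> oU Up fg; apply: near_eq_derive.
by apply: filterS (near_chart (chart_atP p) oU Up) => z [Uz _ _] /=; rewrite fg.
Qed.

Lemma deriv_alongD U (f g : M -> R) p w : open U -> U p -> smooth_on U f -> smooth_on U g ->
  deriv_along (fun q => f q + g q) p w = deriv_along f p w + deriv_along g p w.
Proof.
move=> oU Up sf sg.
have df := smooth_on_differentiable oU Up (chart_atP p) sf.
have dg := smooth_on_differentiable oU Up (chart_atP p) sg.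
rewrite /deriv_along (_ : (fun q =>
    f q + g q) \o _ = (f \o cinv (chart_at p)) + (g \o cinv (chart_at p))) //.
by rewrite deriveD //; exact: diff_derivable.
Qed.

Lemma deriv_alongM U (f g : M -> R) p w : open U -> U p -> smooth_on U f -> smooth_on U g ->
  deriv_along (fun q => f q * g q) p w = deriv_along f p w * g p + f p * deriv_along g p w.
Proof.
move=> oU Up sf sg.
have df := smooth_on_differentiable oU Up (chart_atP p) sf.
have dg := smooth_on_differentiable oU Up (chart_atP p) sg.
rewrite /deriv_along (_ : (fun q =>
    f q * g q) \o _ = (f \o cinv (chart_at p)) * (g \o cinv (chart_at p))) //.
rewrite deriveM; [|exact: diff_derivable|exact: diff_derivable].
rewrite /= (cmapK (chart_atP p)) addrC; congr (_ + _); exact: mulrC.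
Qed.

Lemma deriv_along_cst (a : R) p w : deriv_along (fun _ : M => a) p w = 0.
Proof. exact: derive_cst. Qed.

Lemma deriv_along_bilinear U (A : 'I_2 -> 'I_2 -> R) (x : 'I_2 -> M -> R) p w : open U -> U p ->
  (forall k, smooth_on U (x k)) ->
  deriv_along (fun q => \sum_k \sum_l A k l * (x k q * x l q)) p w =
  \sum_k \sum_l A k l * (deriv_along (x k) p w * x l p + x k p * deriv_along (x l) p w).
Proof.
move=> oU Up sx.
have sum2 (F : 'I_2 -> R) : \sum_k F k = F 0 + F 1.
  by rewrite !big_ord_recl big_ord0 addr0; congr (_ + F _); apply/val_inj.
have -> : (fun q => \sum_k \sum_l A k l * (x k q * x l q)) = (fun q =>
   (A 0 0 * (x 0 q * x 0 q) + A 0 1 * (x 0 q * x 1 q))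
   + (A 1 0 * (x 1 q * x 0 q) + A 1 1 * (x 1 q * x 1 q))).
  by apply/funext => q; rewrite !sum2.
have sxx k l : smooth_on U (fun q => x k q * x l q) by apply: smooth_onM.
have sA k l : smooth_on U (fun q => A k l * (x k q * x l q)) by apply: smooth_onZ.
have dA k l : deriv_along (fun q => A k l * (x k q * x l q)) p w =
  A k l * (deriv_along (x k) p w * x l p + x k p * deriv_along (x l) p w).
  rewrite (deriv_alongM _ oU Up (smooth_on_cst U (A k l)) (sxx k l)) deriv_along_cst mul0r
      add0r.
  by rewrite (deriv_alongM _ oU Up (sx k) (sx l)).
rewrite (deriv_alongD _ oU Up); [|by apply: smooth_onD|by apply: smooth_onD].
by rewrite !(deriv_alongD _ oU Up) // !dA !sum2.
Qed.

End DerivAlong.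

(** * The Dirac current and its covariant derivative *)

Section DiracCurrent.
Context {R : realType} {M : lorentz3 R} (S : paired_spinor_bundle M).
Implicit Types (p q : M) (w : 'rV[R]_3) (U : set M).
Variable eps : forall p, S p.

(* The one-form [a |-> <eps, a . eps>], a covector being paired with a covector
   through the metric. *)
Definition dirac_current : form1 M := fun p =>
  metric p *m \col_i pairing (eps p) (cl (delta_mx i 0) (eps p)).

Lemma cometric_dirac_current p (a : 'cV[R]_3) :
  cometric p (dirac_current p) a = pairing (eps p) (cl a (eps p)).
Proof.
rewrite /cometric /dirac_current trmx_mul Defs.metric_sym mulmxK ?metric_unit // mxE.
have {2}-> : a = \sum_i a i 0 *: delta_mx i 0.
  by rewrite {1}[a]matrix_sum_delta; apply: eq_bigr => i _; rewrite big_ord1.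
rewrite cl_suml pairing_sumr; apply: eq_bigr => i _.
by rewrite clZl pairingZr !mxE mulrC.
Qed.

Lemma dirac_current_coframe (e : 'I_3 -> form1 M) p : orthonormal_at e p ->
  dirac_current p = \sum_a (eta R a * pairing (eps p) (cl (e a p) (eps p))) *: e a p.
Proof.
move=> oe; rewrite {1}(coframe_sum oe (dirac_current p)).
by apply: eq_bigr => a _; rewrite cometric_dirac_current.
Qed.

Section Adapted.
Variables (U : set M) (e : 'I_3 -> form1 M) (s : 'I_2 -> forall p, S p) (x : 'I_2 -> M -> R).
Hypotheses (oU : open U) (ad : adapted_frame U e s) (sx : forall k, smooth_on U (x k)).
Hypothesis epsE : forall q, U q -> eps q = \sum_k x k q *: s k q.

Let phi a q := pairing (eps q) (cl (e a q) (eps q)).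

Lemma adapted_orthonormal q : U q -> orthonormal_at e q.
Proof. by move=> Uq a b; case: ad => [[_ H] _ _ _]; exact: H. Qed.

(** In an adapted frame the Clifford action and the pairing have constant coefficients, so the
    components of the current are quadratic forms in x with constant coefficients and only x is
    differentiated. *)
Lemma current_component a : exists A : 'I_2 -> 'I_2 -> R,
  (forall q, U q -> forall k l, pairing (s k q) (cl (e a q) (s l q)) = A k l) /\
  forall q, U q -> phi a q = \sum_k \sum_l A k l * (x k q * x l q).
Proof.
case: ad => [_ _ [Gam HG] [Om HO]].
pose A k l := \sum_m Gam a m l * Om k m.
have AE q k l : U q -> pairing (s k q) (cl (e a q) (s l q)) = A k l.
  by move=> Uq; rewrite HG // pairing_sumr; apply: eq_bigr => m _; rewrite pairingZr HO.
exists A; split=> [q Uq k l|q Uq]; first exact: AE.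
rewrite /phi epsE // pairing_suml; apply: eq_bigr => k _.
rewrite pairingZl cl_sumr pairing_sumr mulr_sumr; apply: eq_bigr => l _.
by rewrite clZr pairingZr AE // mulrA mulrC.
Qed.

Lemma smooth_current_component a : smooth_on U (phi a).
Proof.
have [A [_ AE]] := current_component a.
apply: (@smooth_on_eq _ _ _ (fun q => \sum_k \sum_l A k l * (x k q * x l q))) => //.
  by move=> q Uq; rewrite AE.
do 2 (apply: smooth_on_sum => // ?).
by apply: smooth_onZ => //; apply: smooth_onM.
Qed.

Lemma deriv_current_component a p w : U p -> let y := \sum_k deriv_along (x k) p w *: s k p in
  deriv_along (phi a) p w =
  pairing y (cl (e a p) (eps p)) + pairing (eps p) (cl (e a p) y).
Proof.
move=> Up y; have [A [AE AS]] := current_component a.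
rewrite (deriv_along_near w oU Up AS) (deriv_along_bilinear A w oU Up sx) /y epsE //.
rewrite !pairing_suml -big_split; apply: eq_bigr => k _ /=.
rewrite !pairingZl !cl_sumr !pairing_sumr !mulr_sumr -big_split; apply: eq_bigr => l _ /=.
by rewrite !clZr !pairingZr !AE //; ring.
Qed.

Lemma smooth_dirac_current_adapted : smooth_form1 U dirac_current.
Proof.
move=> c i; have oc : open (U `&` cdom c) by apply: openI => //; exact: cdom_open.
apply: (@smooth_on_eq _ _ _ (fun q =>
    \sum_a (eta R a * phi a q) * (cbasis c q *m e a q) i 0)) => //.
  move=> q [Uq _]; rewrite (dirac_current_coframe (adapted_orthonormal Uq)).
  rewrite mulmx_sumr summxE; apply: eq_bigr => a _.
  by rewrite -scalemxAr [RHS]mxE.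
apply: smooth_on_sum => // a; apply: smooth_onM => //; last first.
  by case: ad => [[se _] _ _ _]; exact: se.
by apply: smooth_onZ => //; apply: smooth_on_subset (smooth_current_component a) => q [].
Qed.

(** The forms [th] belong to the connection with torsion, and [current_derivative] expresses the
    derivatives of the components of the current through them. Subtracting the Levi-Civita part
    leaves the torsion term, a multiple of the star of the current. *)
Lemma nabla_dirac_current_adapted H p w : U p -> smooth_form3 H ->
  \sum_k deriv_along (x k) p w *: s k p
   + 4^-1 *: \sum_a \sum_b conn_form e p w a b *: cl (e a p) (cl (e b p) (eps p))
   + 4^-1 *: cl2 (H p w) (eps p) = 0 ->
  nabla_along dirac_current p w =
    (- 2^-1 * torsion_density H p) *: (w *m hodge1 dirac_current p)^T.
Proof.
move=> Up sH Hy; have oe := adapted_orthonormal Up.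
have se : forall a, smooth_form1 U (e a) by case: ad => [[]].
set y := \sum_k deriv_along (x k) p w *: s k p in Hy.
set E := coframe_mx e p.
pose F b a := torsion_density H p * (coframe_sign e p * rdet (w *m E) (delta_mx 0 b)
    (delta_mx 0 a)).
pose th b a := conn_form e p w b a + 2^-1 * F b a.
have om_skew := conn_form_skew oU Up se adapted_orthonormal w.
have th_skew a b : th a b = - th b a.
  rewrite /th {1}om_skew opprD; congr (_ + _).
  by rewrite /F !rdetE; ring.
have yE : y = - (4^-1 *: \sum_a \sum_b th a b *: cl (e a p) (cl (e b p) (eps p))).
  apply/eqP; rewrite -addr_eq0; apply/eqP; rewrite -[RHS]Hy.
  rewrite (cl2_torsion w (eps p) oe sH) -addrA -scalerDr.
  congr (_ + _ *: _); rewrite scaler_sumr -big_split; apply: eq_bigr => a _ /=.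
  rewrite scaler_sumr -big_split; apply: eq_bigr => b _ /=.
  by rewrite scalerA -scalerDl.
have dphi a : deriv_along (phi a) p w = eta R a * \sum_b th b a * phi b p.
  by rewrite deriv_current_component // (current_derivative oe a th_skew yE).
have dk a : deriv_along (fun q => eta R a * phi a q) p w = \sum_b th b a * phi b p.
  rewrite (deriv_alongM _ oU Up (smooth_on_cst U (eta R a)) (smooth_current_component a)).
  by rewrite deriv_along_cst mul0r add0r dphi mulrA eta_sq mul1r.
have sk a : smooth_on U (fun q => eta R a * phi a q).
  by apply: smooth_onZ => //; exact: smooth_current_component.
have uE q : U q -> dirac_current q = \sum_a (eta R a * phi a q) *: e a q.
  by move=> Uq; rewrite (dirac_current_coframe (adapted_orthonormal Uq)).
rewrite (nabla_along_sum w oU Up se sk uE) (hodge_coframe oe w (uE p Up)).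
under eq_bigr do rewrite dk (nabla_coframe Up adapted_orthonormal).
rewrite scalerA scaler_sumr.
(* The forms [conn_form] contained in [th] cancel against the derivatives of the coframe. *)
transitivity (\sum_a (\sum_b 2^-1 * F b a * phi b p) *: e a p).
  rewrite big_split /=.
  have -> : \sum_i (eta R i * phi i p) *: - (\sum_b (eta R i * conn_form e p w i b) *: e b p)
     = - \sum_a (\sum_b conn_form e p w b a * phi b p) *: e a p.
    rewrite -sumrN; under [RHS]eq_bigr do rewrite scaler_suml -sumrN.
    rewrite [RHS]exchange_big; apply: eq_bigr => i _.
    rewrite scalerN scaler_sumr -sumrN; apply: eq_bigr =>
        b _; rewrite scalerA; congr (- (_ *: _)).
    by rewrite mulrACA eta_sq mul1r mulrC.
  rewrite -sumrB; apply: eq_bigr => a _; rewrite -scalerBl; congr (_ *: _).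
  by rewrite -sumrB; apply: eq_bigr => b _; rewrite -mulrBl /th addrAC subrr add0r.
apply: eq_bigr => a _; rewrite scalerA; congr (_ *: _).
rewrite sum3 /F !rdetE !mxE /= -!/(phi _ _) !mulrA !eta_sq !mul1r.
by ring.
Qed.

End Adapted.
End DiracCurrent.

(** * Two-dimensional spinor algebra in a frame *)

Section Fierz.
Context {R : realType} {M : lorentz3 R} (S : paired_spinor_bundle M).
Variables (p : M) (s : 'I_2 -> S p) (e : 'I_3 -> 'cV[R]_3).
Hypothesis bs : basis_of fullv [seq s k | k <- enum 'I_2].
Hypothesis oe : forall a b : 'I_3, cometric p (e a) (e b) = eta_mx R a b.

Lemma sum2 (V : nmodType) (F : 'I_2 -> V) : \sum_i F i = F 0 + F 1.
Proof. by rewrite !big_ord_recl big_ord0 addr0; congr (_ + F _); apply/val_inj. Qed.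

Lemma frame_seq : [seq s k | k <- enum 'I_2] = [:: s 0; s 1].
Proof.
rewrite !enum_ordSl enum_ord0 /=; congr [:: s _; s _]; exact/val_inj.
Qed.

Lemma frame2_span (v : S p) : exists x : 'I_2 -> R, v = \sum_k x k *: s k.
Proof.
have : v \in <<[:: s 0%R; s 1%R]>>%VS by rewrite -frame_seq (span_basis bs) memvf.
rewrite span_cons span_seq1 => /memv_addP[_ /vlineP[a ->] [_ /vlineP[b ->] ->]].
by exists (fun k => if k == 0 then a else b); rewrite sum2.
Qed.

Lemma frame2_free (x : 'I_2 -> R) : \sum_k x k *: s k = 0 -> forall k, x k = 0.
Proof.
have := basis_free bs; rewrite frame_seq free_cons span_seq1 => /andP[s0 s1].
rewrite seq1_free in s1; rewrite sum2 => H.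
have x0 : x 0 = 0.
  apply/eqP; apply/negPn/negP => x0; move/negP: s0; apply.
  apply/vlineP; exists (- (x 1 / x 0)).
  apply: (scalerI x0); rewrite scalerA mulrN mulrCA divff // mulr1.
  by move/eqP: H; rewrite addr_eq0 => /eqP ->; rewrite scaleNr.
have x1 : x 1 = 0.
  move: H; rewrite x0 scale0r add0r => /eqP.
  by rewrite scaler_eq0 (negbTE s1) orbF => /eqP.
case=> -[|[|//]] Hk.
  by rewrite -[RHS]x0; congr x; apply/val_inj.
by rewrite -[RHS]x1; congr x; apply/val_inj.
Qed.

Lemma frame2_inj (x y : 'I_2 -> R) : \sum_k x k *: s k = \sum_k y k *: s k ->
    forall k, x k = y k.
Proof.
move=> H k; apply/eqP; rewrite -subr_eq0; apply/eqP.
apply: (frame2_free (x := fun k => x k - y k)).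
by under eq_bigr do rewrite scalerBl; rewrite sumrB H subrr.
Qed.

(* [[al a, be a], [ga a, - al a]] is the matrix of Clifford multiplication by
   [e a] in the frame [s]; skew-adjointness makes it traceless. *)
Lemma spinor_matrices : exists (om : R) (al be ga : 'I_3 -> R),
  [/\ om != 0,
   forall a b, al a * al b + 2^-1 * (be a * ga b + ga a * be b) = eta_mx R a b &
   forall (x : 'I_2 -> R) a, pairing (\sum_k x k *: s k) (cl (e a) (\sum_k x k *: s k))
     = om * (ga a * x 0 ^+ 2 - 2 * al a * x 0 * x 1 - be a * x 1 ^+ 2)].
Proof.
pose om := pairing (s 0) (s 1).
have p10 : pairing (s 1) (s 0) = - om by rewrite pairing_skew.
have p00 : pairing (s 0) (s 0) = 0 by exact: pairing_self.
have p11 : pairing (s 1) (s 1) = 0 by exact: pairing_self.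
have [G GE] := choice (fun al : 'I_3 * 'I_2 => frame2_span (cl (e al.1) (s al.2))).
have GE' a l : cl (e a) (s l) = G (a, l) 0 *: s 0 + G (a, l) 1 *: s 1.
  by rewrite (GE (a, l)) sum2.
pose al a := G (a, 0) 0; pose ga a := G (a, 0) 1; pose be a := G (a, 1) 0.
have om0 : om != 0.
  apply/eqP => om0.
  have : s 0 = 0.
    apply: pairing_nondeg => y; have [x ->] := frame2_span y.
    by rewrite sum2 pairingDr !pairingZr p00 -/om om0 !mulr0 addr0.
  move=> s00; have := frame2_free (x := fun k => if k == 0 then 1 else 0).
  rewrite sum2 /= s00 scaler0 scale0r addr0 => /(_ erefl 0) /=.
  by move/eqP; rewrite oner_eq0.
have tr0 a : G (a, 1) 1 = - al a.
  have := pairing_cl (e a) (s 0) (s 1); rewrite !GE' pairingDl pairingDr !pairingZl !pairingZr.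
  rewrite p00 p11 -/om !mulr0 addr0 add0r -mulNr => /(mulIf om0) E.
  by rewrite /al E opprK.
exists om, al, be, ga; split=> // [a b|x a].
  (* The component along s 0 of the Clifford relation applied to s 0 is already the required
     identity. *)
  have := cl_anticomm (e a) (e b) (s 0).
  rewrite !GE' !clDr !clZr !GE' !tr0 oe !scalerDr !scalerA => H.
  pose A := al b * al a + ga b * be a + (al a * al b + ga a * be b).
  pose B := al b * ga a + ga b * - al a + (al a * ga b + ga a * - al b).
  have HAB : A *: s 0 + B *: s 1 = (2 * eta_mx R a b) *: s 0.
    by rewrite -H /A /B !scalerDl addrACA; congr (_ + _); exact: addrACA.
  have := frame2_inj (x := fun k => if k == 0 then A else B)
    (y := fun k => if k == 0 then 2 * eta_mx R a b else 0).
  rewrite !sum2 /= scale0r addr0 => /(_ HAB 0) /= E.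
  have -> : eta_mx R a b = 2^-1 * A by rewrite E mulKf // pnatr_eq0.
  by rewrite /A; field.
rewrite !sum2 clDr !clZr !GE' tr0 !pairingDl !pairingDr !pairingZl !pairingZr.
rewrite !pairingDr !pairingZr p00 p11 p10 -/om /al /be /ga; ring.
Qed.

Lemma current_null (v : S p) :
  \sum_a eta R a * pairing v (cl (e a) v) ^+ 2 = 0.
Proof.
have [om [al [be [ga [_ H E]]]]] := spinor_matrices.
have [x ->] := frame2_span v.
under eq_bigr do rewrite E exprMn mulrCA.
by rewrite -mulr_sumr sl2_completeness // mulr0.
Qed.

(** The covector e 2 is timelike, so its Clifford matrix squares to -1 and the quadratic form is
    definite. *)
Lemma current_eq0 (v : S p) : pairing v (cl (e 2%:R) v) = 0 -> v = 0.
Proof.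
have [om [al [be [ga [om0 H E]]]]] := spinor_matrices.
have [x ->] := frame2_span v; rewrite E => /eqP.
rewrite mulf_eq0 (negbTE om0) /= => /eqP Q.
have := H 2%:R 2%:R; rewrite eta_mxE /eta /= => H2.
have [|x0 x1] := definite_form_eq0 _ Q.
  by rewrite -[RHS]H2; field.
by rewrite sum2 x0 x1 !scale0r addr0.
Qed.

End Fierz.

(** * From a parallel spinor to a null form *)

Section Forward.
Context {R : realType} {M : lorentz3 R} (S : paired_spinor_bundle M).

Lemma skew_torsion_current (eps : forall p : M, S p) : skew_torsion_parallel_spinor eps ->
  exists u : form1 M,
    [/\ smooth_form1 setT u,
        forall p : M, u p <> 0,
        isotropic u &
        exists2 f : M -> R, smooth_on setT f &
          forall p : M, nabla u p = f p *: hodge1 u p].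
Proof.
move=> [_ [p0 eps0] [H sH par]].
(* Parallelism along w = 0 carries no differential information, but its witness supplies an adapted
   frame around p. *)
have loc p : exists U e s x, [/\ open U /\ U p, adapted_frame U e s,
    forall k, smooth_on U (x k) & forall q, U q -> eps q = \sum_k x k q *: s k q].
  by have [y [U [e [s [x [oU ad sx epsE _]]]]] _] := par p 0; exists U, e, s, x.
pose u := dirac_current eps; pose f p := - 2^-1 * torsion_density H p.
have su : smooth_form1 setT u.
  move=> c i; apply: smooth_on_local => p [_ dp].
  have [U [e [s [x [[oU Up] ad sx epsE]]]]] := loc p.
  exists (U `&` cdom c); split=> //; first by apply: openI => //; exact: cdom_open.
  exact: (smooth_dirac_current_adapted oU ad sx epsE).
have sf : smooth_on setT f.
  by apply: smooth_onZ; [exact: openT|exact: smooth_torsion_density].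
have nu p : nabla u p = f p *: hodge1 u p.
  apply/row_matrixP => i; rewrite !rowE; apply: (can_inj trmxK).
  have [y [U [e [s [x [[oU Up] ad sx epsE yE]]]]] y0] := par p (delta_mx 0 i).
  rewrite yE in y0.
  have := nabla_dirac_current_adapted oU ad sx epsE Up sH y0.
  rewrite /nabla_along -/u => ->.
  by rewrite -scalemxAr; apply/matrixP => a b; rewrite !mxE.
exists u; split=> //; last by exists f.
  apply: null_form_nowhere_zero su sf nu _; exists p0 => u0.
  have [U [e [s [x [[oU Up] ad sx epsE]]]]] := loc p0.
  move/eqP: eps0; apply; case: (ad) => [_ [_ bs] _ _].
  apply: (current_eq0 (bs p0 Up) (e := fun a =>
      e a p0)); first by exact: adapted_orthonormal ad _ Up.
  by rewrite -cometric_dirac_current -/u u0 /cometric trmx0 !mul0mx mxE.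
move=> p; have [U [e [s [x [[oU Up] ad sx epsE]]]]] := loc p.
have oe := adapted_orthonormal ad Up.
case: (ad) => [_ [_ bs] _ _].
have key := current_null (bs p Up) (e := fun a => e a p) oe (eps p).
rewrite {2}(coframe_sum oe (u p)) cometricC.
rewrite cometric_suml -[RHS]key; apply: eq_bigr => a _.
by rewrite (cometricC p (e a p)) !cometric_dirac_current -mulrA -expr2.
Qed.

End Forward.

(** * Coframes adapted to a null form *)

Section SmoothForms.
Context {R : realType} {M : lorentz3 R}.
Implicit Types (U : set M) (p q : M) (c : chart M) (u v : form1 M).

Lemma smooth_form1_comp U c u : smooth_form1 U u -> smooth_mx (U `&` cdom c) (form_comp c u).
Proof. by move=> su i j; rewrite ord1; exact: su. Qed.

Lemma smooth_form1_of_comp U u : (forall c, smooth_mx (U `&` cdom c) (form_comp c u)) ->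
    smooth_form1 U u.
Proof. by move=> su c i; exact: su. Qed.

Lemma open_dom U c : open U -> open (U `&` cdom c).
Proof. by move=> oU; apply: openI => //; exact: cdom_open. Qed.

Lemma smooth_mx_subset U V m n (A : M -> 'M[R]_(m, n)) : U `<=` V -> smooth_mx V A ->
    smooth_mx U A.
Proof. by move=> UV sA i j; exact: smooth_on_subset (sA i j). Qed.

Lemma smooth_mx_eq U m n (A B : M -> 'M[R]_(m, n)) : open U -> (forall p, U p -> A p = B p) ->
  smooth_mx U A -> smooth_mx U B.
Proof. by move=> oU AB sA i j; apply: smooth_on_eq (sA i j) => // p /AB ->. Qed.

Lemma smooth_inv_coord_metric U c : open U ->
  smooth_mx (U `&` cdom c) (fun p => invmx (coord_metric c p)).
Proof.
move=> oU; apply: smooth_mx_subset (smooth_mx_inv (@cdom_open _ M c) (@smooth_coord_metric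
    _ M c) (@coord_metric_unit _ _ c)).
by move=> p [].
Qed.

Lemma cometric_comp c u v p : cdom c p -> cometric p (u p) (v p) =
  ((form_comp c u p)^T *m invmx (coord_metric c p) *m form_comp c v p) 0 0.
Proof.
move=> dp; rewrite /cometric -(metric_frame_change dp) /form_comp trmx_mul.
by rewrite !mulmxA.
Qed.

Lemma smooth_cometric U u v : open U -> smooth_form1 U u -> smooth_form1 U v ->
  smooth_on U (fun p => cometric p (u p) (v p)).
Proof.
move=> oU su sv; apply: smooth_on_local => p Up; set c := chart_at p.
have oc := open_dom c oU.
exists (U `&` cdom c); split=> //; first by split=> //; exact: chart_atP.
apply: (smooth_on_eq oc) (fun q '(conj Uq dq) => esym (cometric_comp u v dq)) _.
apply: smooth_mx_mul => //; last exact: smooth_form1_comp.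
apply: smooth_mx_mul => //; last exact: smooth_inv_coord_metric.
by apply: smooth_mx_tr => //; exact: smooth_form1_comp.
Qed.

Lemma smooth_form1D U u v : open U -> smooth_form1 U u -> smooth_form1 U v ->
  smooth_form1 U (fun p => u p + v p).
Proof.
move=> oU su sv c i; have oc := open_dom c oU.
apply: smooth_on_eq (smooth_onD oc (su c i) (sv c i)) => // q _.
by rewrite mulmxDr [RHS]mxE.
Qed.

Lemma smooth_form1Z U (k : M -> R) u : open U -> smooth_on U k -> smooth_form1 U u ->
  smooth_form1 U (fun p => k p *: u p).
Proof.
move=> oU sk su c i; have oc := open_dom c oU.
have sk' : smooth_on (U `&` cdom c) k by apply: smooth_on_subset sk => q [].
apply: smooth_on_eq (smooth_onM oc sk' (su c i)) => // q _.
by rewrite -scalemxAr [RHS]mxE.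
Qed.

Definition flat (X : vfield M) : form1 M := fun p => metric p *m (X p)^T.

Lemma smooth_flat U X : open U -> smooth_vfield U X -> smooth_form1 U (flat X).
Proof.
move=> oU sX; apply: smooth_form1_of_comp => c; have oc := open_dom c oU.
apply: (smooth_mx_eq (A := fun p => coord_metric c p *m (X p *m cobasis c p)^T) oc).
  move=> q [_ dq]; rewrite /form_comp /flat /coord_metric trmx_mul.
  rewrite -!mulmxA (mulmxA (cbasis c q)^T) -trmx_mul cobasisK // trmx1 mul1mx //.
apply: smooth_mx_mul => //.
  by apply: smooth_mx_subset (@smooth_coord_metric _ M c) => q [].
by apply: smooth_mx_tr => // i j; rewrite ord1; exact: sX.
Qed.

Lemma cometric_flat X a p : cometric p (flat X p) a = (X p *m a) 0 0.
Proof.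
by rewrite /cometric /flat trmx_mul trmxK Defs.metric_sym mulmxK // metric_unit.
Qed.

(* [vol u# v# .], with [#] the dual vectors. *)
Definition cross u v : form1 M := fun p =>
  ((invmx (metric p) *m v p)^T *m hodge1 u p)^T.

Lemma smooth_cross U u v : open U -> smooth_form1 U u -> smooth_form1 U v ->
  smooth_form1 U (cross u v).
Proof.
move=> oU su sv; apply: smooth_form1_of_comp => c; have oc := open_dom c oU.
have si := smooth_inv_coord_metric c oU.
apply: (smooth_mx_eq (A := fun p => (((form_comp c v p)^T *m invmx (coord_metric c p)) *m
   (cbasis c p *m hodge1 u p *m (cbasis c p)^T))^T) oc).
  move=> q [_ dq]; rewrite /form_comp /cross -(metric_frame_change dq) !trmx_mul !trmxK.
  by rewrite trmx_inv coord_metric_sym !mulmxA.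
apply: smooth_mx_tr => //; apply: smooth_mx_mul => //.
  by apply: smooth_mx_mul => //; apply: smooth_mx_tr => //; exact: smooth_form1_comp.
move=> i j; apply: (smooth_on_eq oc (fun q '(conj Uq dq) => esym (coord_hodge u i j dq))).
apply: smooth_onM => //.
  by apply: smooth_on_subset (@smooth_sqrt_det _ M c) => q [].
have sx : smooth_mx (U `&` cdom c) (fun p => (form_comp c u p)^T *m invmx (coord_metric c p)).
  by apply: smooth_mx_mul => //; apply: smooth_mx_tr => //; exact: smooth_form1_comp.
pose d (k l : 'I_3) : R := (delta_mx 0 i : 'rV[R]_3) 0 k * (delta_mx 0 j : 'rV[R]_3) 0 l
    - (delta_mx 0 i : 'rV[R]_3) 0 l * (delta_mx 0 j : 'rV[R]_3) 0 k.
pose X q := (form_comp c u q)^T *m invmx (coord_metric c q).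
apply: (smooth_on_eq (f := fun q =>
    d 1 2%:R * X q 0 0 + (- d 0 2%:R * X q 0 1 + d 0 1 * X q 0 2%:R)) oc).
  by move=> q _; rewrite rdetE /d /X; ring.
by do !apply: smooth_onD => //; apply: smooth_onZ => //; exact: sx.
Qed.

End SmoothForms.

(** * Cross products and the coframe of a null form *)

Section NullCoframe.
Context {R : realType} {M : lorentz3 R}.
Implicit Types (p q : M) (u v : form1 M).

(** Orthonormality is asked at p alone, so forms with the same coordinate vector at every point
    serve; the coframe is used only for identities at p. *)
Lemma exists_coframe_at p : exists e : 'I_3 -> form1 M, orthonormal_at e p.
Proof.
have [P Pu E] := metric_signature p.
pose e : 'I_3 -> form1 M := fun a _ => col a (invmx P).
exists e => a b; rewrite (cometric_coframe_mx e).
have -> : coframe_mx e p = invmx P.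
  by apply/matrixP => i j; rewrite !mxE.
have H : metric p *m (P^T *m eta_mx R *m P) = 1%:M.
  have H1 : (P *m metric p) *m (P^T *m eta_mx R) = 1%:M by rewrite mulmxA E eta_mxK.
  by apply: mulmx1C; rewrite -(mulmxA (P^T *m eta_mx R)); exact: mulmx1C H1.
have -> : invmx (metric p) = P^T *m eta_mx R *m P.
  by rewrite -[LHS]mulmx1 -H mulKmx // metric_unit.
by rewrite !mulmxA mulmxK // -trmx_mul mulmxV // trmx1 mul1mx.
Qed.

Section Components.
Variables (e : 'I_3 -> form1 M) (p : M).
Hypothesis oe : orthonormal_at e p.
Let K (a : 'cV[R]_3) b := eta R b * cometric p a (e b p).

Lemma cometric_components a b : cometric p a b = \sum_i eta R i * K a i * K b i.
Proof.
rewrite {1}(coframe_sum oe a).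
rewrite cometric_suml; apply: eq_bigr => i _; rewrite /K (cometricC p (e i p)).
have := eta_sq (R := R) i; move: (eta R i) (cometric p a _) (cometric p b _) => s x y ss.
by transitivity ((s * s) * (s * x * y)); [rewrite ss mul1r|ring].
Qed.

Lemma components_eq0 a : (forall b, K a b = 0) -> a = 0.
Proof. by move=> H; rewrite (coframe_sum oe a) big1 // => b _; rewrite -/(K a b) H scale0r. Qed.

Lemma cross_components u v b : K (cross u v p) b = coframe_sign e p *
  rdet (\row_a (eta R a * K (u p) a)) (\row_a (eta R a * K (v p) a)) (delta_mx 0 b).
Proof.
have vE : (invmx (metric p) *m v p)^T *m coframe_mx e p = \row_a (eta R a * K (v p) a).
  apply/rowP => a; rewrite trmx_mul trmx_inv Defs.metric_sym mulmx_row_col col_coframe_mx.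
  by rewrite row_id [RHS]mxE /K mulrA eta_sq mul1r.
rewrite /cross (hodge_coframe oe _ (coframe_sum oe (u p))) vE.
rewrite /K cometricZl cometric_suml mulrCA; congr (_ * _).
rewrite mulr_sumr (bigD1 b) //= big1 ?addr0 => [|a ab].
  by rewrite oe eta_mxE eqxx mulr1n mulrCA eta_sq mulr1.
by rewrite oe eta_mxE (negbTE ab) mulr0n !mulr0.
Qed.

Lemma coframe_sign_sq : coframe_sign e p ^+ 2 = 1.
Proof.
rewrite /coframe_sign expr_div_n real_normK ?num_real // divff //.
by rewrite expf_neq0 // det_coframe_neq0.
Qed.

Lemma eta0 : eta R 0 = 1. Proof. by []. Qed.
Lemma eta1 : eta R 1 = 1. Proof. by []. Qed.
Lemma eta2 : eta R 2%:R = -1. Proof. by []. Qed.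

(** Lagrange's identity in signature (2,1), with the sign opposite to the Euclidean one; the
    orientation sign enters squared. *)
Lemma cross_gram u v : cometric p (cross u v p) (cross u v p) =
  cometric p (u p) (v p) ^+ 2 - cometric p (u p) (u p) * cometric p (v p) (v p).
Proof.
rewrite !cometric_components !sum3 !cross_components !rdetE !mxE /= !eta0 !eta1 !eta2.
move: (K (u p)) (K (v p)) coframe_sign_sq => k l; move: (coframe_sign e p) => s s1.
have E (X : R) : X = s ^+ 2 * X by rewrite s1 mul1r.
by rewrite [RHS]E; ring.
Qed.

Lemma cross_orthl u v : cometric p (u p) (cross u v p) = 0.
Proof. by rewrite cometric_components sum3 !cross_components !rdetE !mxE /= !eta0 !eta1
    !eta2; ring. Qed.

Lemma cross_orthr u v : cometric p (v p) (cross u v p) = 0.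
Proof. by rewrite cometric_components sum3 !cross_components !rdetE !mxE /= !eta0 !eta1
    !eta2; ring. Qed.

End Components.

(** The orthogonal complement of a timelike covector is positive definite, so it contains no nonzero
    null covector. *)
Lemma null_timelike_neq0 p (a b : 'cV[R]_3) : a <> 0 -> cometric p a a = 0 ->
  cometric p b b < 0 -> cometric p b a != 0.
Proof.
move=> a0 aa bb; have [e oe] := exists_coframe_at p; apply/eqP => ba.
pose k (d : 'cV[R]_3) i := eta R i * cometric p d (e i p).
have C c d : cometric p c d = k c 0 * k d 0 + k c 1 * k d 1 - k c 2%:R * k d 2%:R.
  by rewrite (cometric_components oe c d) sum3 /k eta0 eta1 eta2; ring.
apply: a0; apply: (components_eq0 oe) => i; rewrite -/(k a i).
move: aa bb ba; rewrite !C; move: (k a) (k b) => {C}{}k l.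
move: (l 0) (l 1) (l 2%:R) => x y z aa bb ba.
have k2 : k 2%:R = 0.
  apply/eqP; apply/negPn/negP => k2.
  have sq : 0 < k 2%:R ^+ 2 by rewrite exprn_even_gt0.
  (* Cauchy-Schwarz for the spatial parts. Orthogonality and nullity turn it into z^2 <= x^2 + y^2,
     against b timelike. *)
  have cs : (x * k 0 + y * k 1) ^+ 2 <= (x * x + y * y) * (k 0 * k 0 + k 1 * k 1).
    rewrite -subr_ge0.
    have -> : (x * x + y * y) * (k 0 * k 0 + k 1 * k 1) - (x * k 0 +
        y * k 1) ^+ 2 = (x * k 1 - y * k 0) ^+ 2 by ring.
    exact: sqr_ge0.
  have e1 : x * k 0 + y * k 1 = z * k 2%:R by lra.
  have e2 : k 0 * k 0 + k 1 * k 1 = k 2%:R ^+ 2 by rewrite expr2; lra.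
  move: cs; rewrite e1 e2 exprMn ler_pM2r // => cs.
  move: bb cs; rewrite expr2; lra.
have : k 0 ^+ 2 + k 1 ^+ 2 = 0 by move: aa; rewrite k2 !expr2; lra.
move/eqP; rewrite paddr_eq0 ?sqr_ge0 // !sqrf_eq0 => /andP[/eqP k0 /eqP k1].
case: i => -[|[|[|//]]] Hi.
- by rewrite -[RHS]k0; congr k; apply/val_inj.
- by rewrite -[RHS]k1; congr k; apply/val_inj.
- by rewrite -[RHS]k2; congr k; apply/val_inj.
Qed.

(* With [T] the time orientation, [v = 2 / lam T^flat - N / lam ^+ 2 u], where
   [lam = u(T)] and [N = g(T, T)], is the second null form: [<u, v> = 2]. The
   coframe is [(u + v) / 2], its cross product with the last form,
   [(u - v) / 2]. *)
Lemma null_coframe u : smooth_form1 setT u -> (forall p, u p <> 0) -> isotropic u ->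
  exists e : 'I_3 -> form1 M, [/\ forall a, smooth_form1 setT (e a),
    forall p, orthonormal_at e p & forall p, u p = e 0 p + e 2%:R p].
Proof.
move=> su u0 uu.
pose T := flat (@tfield _ M).
have sT : smooth_form1 setT T by apply: smooth_flat; [exact: openT|exact: tfield_smooth].
have oT : open [set: M] := openT.
pose lam p := cometric p (T p) (u p); pose N p := cometric p (T p) (T p).
have N0 p : N p < 0.
  rewrite /N /T cometric_flat /flat mulmxA; exact: tfield_timelike.
have lam0 p : lam p != 0 by apply: null_timelike_neq0 => //; exact: N0.
have sl : smooth_on setT lam by exact: smooth_cometric.
have sN : smooth_on setT N by exact: smooth_cometric.
have sli : smooth_on setT (fun p => (lam p)^-1) by apply: smooth_onV.
pose v : form1 M := fun p => (2 * (lam p)^-1) *: T p +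
    (- (N p * ((lam p)^-1 * (lam p)^-1))) *: u p.
have sv : smooth_form1 setT v.
  apply: smooth_form1D => //; apply: smooth_form1Z => //; first exact: smooth_onZ.
  by apply: smooth_onN => //; apply: smooth_onM => //; exact: smooth_onM.
have D p t s a b c : cometric p (t *: a + s *: b) c = t * cometric p a c + s * cometric p b c.
  by rewrite cometricDl cometricZl.
have D' p t s a b c : cometric p c (t *: a + s *: b) = t * cometric p c a + s * cometric p c b.
  by rewrite cometricC D !(cometricC p _ c).
have uv p : cometric p (u p) (v p) = 2.
  rewrite /v D' uu (cometricC p (u p)) -/(lam p) mulr0 addr0 divfK //.
have vv p : cometric p (v p) (v p) = 0.
  rewrite {1}/v D uv /v D' -/(N p) -/(lam p).
  by have l0 := lam0 p; field.
(* From here on only the smoothness of v and the values of <u, v> and <v, v> matter. *)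
clearbody v.
pose e0 : form1 M := fun p => 2^-1 *: u p + 2^-1 *: v p.
pose e2 : form1 M := fun p => 2^-1 *: u p + (- 2^-1) *: v p.
have s0 : smooth_form1 setT e0.
  by apply: smooth_form1D => //; apply: smooth_form1Z => //; exact: smooth_on_cst.
have s2 : smooth_form1 setT e2.
  by apply: smooth_form1D => //; apply: smooth_form1Z => //; exact: smooth_on_cst.
have g00 p : cometric p (e0 p) (e0 p) = 1.
  rewrite /e0 D !D' uu vv (cometricC p (v p)) uv; by field.
have g22 p : cometric p (e2 p) (e2 p) = -1.
  rewrite /e2 D !D' uu vv (cometricC p (v p)) uv; by field.
have g02 p : cometric p (e0 p) (e2 p) = 0.
  rewrite /e0 /e2 D !D' uu vv (cometricC p (v p)) uv; by field.
pose e1 := cross e0 e2.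
pose e (a : 'I_3) : form1 M := nth e0 [:: e0; e1; e2] a.
exists e; split.
- case=> -[|[|[|//]]] Ha //=; apply: smooth_cross => //.
(* The auxiliary coframe [e'] only serves to evaluate the cross product at p. *)
- move=> p; have [e' oe'] := exists_coframe_at p.
  have g11 : cometric p (e1 p) (e1 p) = 1.
    by rewrite /e1 (cross_gram oe') g00 g22 g02; ring.
  have g01 : cometric p (e0 p) (e1 p) = 0 by rewrite /e1 (cross_orthl oe').
  have g21 : cometric p (e2 p) (e1 p) = 0 by rewrite /e1 (cross_orthr oe').
  move=> a b; rewrite eta_mxE.
  case: a => -[|[|[|//]]] Ha; case: b => -[|[|[|//]]] Hb; rewrite /e /=;
    by rewrite ?(g00, g11, g22, g01, g02, g21) // cometricC ?(g00, g11, g22, g01, g02, g21).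
- move=> p; rewrite /e /= /e0 /e2.
  by apply/colP => j; rewrite !mxE; field.
Qed.

End NullCoframe.

(** * The spinor bundle of a null form *)

Section GammaMatrices.
Context {R : realType}.
Implicit Types (v : 'rV[R]_3) (x y : 'cV[R]_2).

Lemma gamvE v : gamv v = mx2 (v 0 1) (v 0 0 + v 0 2%:R) (v 0 0 - v 0 2%:R) (- v 0 1).
Proof.
rewrite /gamv sum3 /gam; apply/matrixP => i j; rewrite !mxE /=.
by case: i => -[|[|//]] Hi; case: j => -[|[|//]] Hj; rewrite /=; ring.
Qed.

Lemma gamv_sq v x : gamv v *m (gamv v *m x) = qstd v *: x.
Proof.
rewrite gamvE /qstd sum3 eta0 eta1 eta2; apply/colP => i; rewrite !mxE !sum2 !mxE !sum2 !mxE.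
case: i => -[|[|//]] Hi /=.
  by rewrite (_ : Ordinal Hi = 0); [ring|exact/val_inj].
by rewrite (_ : Ordinal Hi = 1); [ring|exact/val_inj].
Qed.

Lemma gamvD t v w : gamv (t *: v + w) = t *: gamv v + gamv w.
Proof.
rewrite /gamv scaler_sumr -big_split; apply: eq_bigr => a _.
by rewrite !mxE scalerDl scalerA.
Qed.

Definition symp x y : R := x 0 0 * y 1 0 - x 1 0 * y 0 0.

(** The gamma matrices are traceless, and sl(2) is the Lie algebra preserving the area form. *)
Lemma symp_gamv v x y : symp (gamv v *m x) y = - symp x (gamv v *m y).
Proof. by rewrite gamvE /symp !mxE !sum2 !mxE /=; ring. Qed.

Lemma cV2_basis : basis_of fullv [seq (delta_mx k 0 : 'cV[R]_2) | k <- enum 'I_2].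
Proof.
rewrite basisEdim size_map size_enum_ord dimvf /dim /= leqnn andbT.
apply/subvP => v _; rewrite {1}[v]matrix_sum_delta; apply: rpred_sum => i _.
rewrite big_ord1; apply: rpredZ; apply: memv_span; apply/mapP; exists i => //.
by rewrite mem_enum.
Qed.

(* [x] and its image under the rotation [gam 2] span the plane. *)
Lemma rotation_irreducible (W : {vspace 'cV[R]_2}) :
  (forall x, x \in W -> gamv (delta_mx 0 2%:R) *m x \in W) -> W = 0%VS \/ W = fullv.
Proof.
move=> HW; have [->|W0] := eqVneq W 0%VS; [by left|right].
have xW := memv_pick W; have x0 : vpick W != 0 by rewrite vpick0.
move: (vpick W) xW x0 => x xW x0.
pose n := x 0 0 ^+ 2 + x 1 0 ^+ 2.
have n0 : n != 0.
  apply/negP; rewrite /n paddr_eq0 ?sqr_ge0 // !sqrf_eq0 => /andP[/eqP a0 /eqP b0].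
  move/eqP: x0; apply; apply/colP => -[[|[|//]] Hi]; rewrite [RHS]mxE.
    by rewrite -[RHS]a0; congr (x _ _); apply/val_inj.
  by rewrite -[RHS]b0; congr (x _ _); apply/val_inj.
apply/vspaceP => y; rewrite memvf; apply/idP.
(* The vectors x and gam 2 x are Euclidean orthogonal with the same squared length n, so the
   coefficients are orthogonal projections. *)
have -> : y = ((y 0 0 * x 0 0 + y 1 0 * x 1 0) / n) *: x
   + ((y 0 0 * x 1 0 - y 1 0 * x 0 0) / n) *: (gamv (delta_mx 0 2%:R) *m x).
  apply/colP => i; rewrite gamvE !mxE !sum2 !mxE /=.
  case: i => -[|[|//]] Hi /=.
    rewrite (_ : Ordinal Hi = 0) /=; last exact/val_inj.
    by rewrite /n in n0 *; field.
  rewrite (_ : Ordinal Hi = 1) /=; last exact/val_inj.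
  by rewrite /n in n0 *; field.
by apply: rpredD; apply: rpredZ => //; exact: HW.
Qed.

End GammaMatrices.

Section TrivialSpinorBundle.
Context {R : realType} {M : lorentz3 R}.
Variable e : 'I_3 -> form1 M.
Hypotheses (se : forall a, smooth_form1 setT (e a)) (oe : forall p, orthonormal_at e p).

(** Closed by [Defined], so that the fibres reduce to column vectors in the computations below. *)
Definition trivial_vbundle : vbundle M 2.
Proof.
refine (@VBundle R M 2 (fun _ => 'cV[R]_2) unit (fun _ => setT)
  (fun _ _ k => delta_mx k 0) _ _ _ _).
- by move=> _; exact: openT.
- by move=> p; exists tt.
- by move=> _ p _; exact: cV2_basis.
- move=> _ _; exists (fun _ => 1%:M); split=> [k l|p _ _ l].
    exact: smooth_on_cst.
  rewrite (bigD1 l) //= mxE eqxx scale1r big1 ?addr0 // => k kl.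
  by rewrite mxE (negbTE kl) scale0r.
Defined.

Definition coframe_coeff p (a : 'cV[R]_3) : 'rV[R]_3 :=
  \row_b (eta R b * cometric p a (e b p)).

Definition frame_cl p (a : 'cV[R]_3) (x : 'cV[R]_2) : 'cV[R]_2 :=
  gamv (coframe_coeff p a) *m x.

Lemma smooth_trivial_section U (s : M -> 'cV[R]_2) : open U ->
  @smooth_section R M 2 trivial_vbundle U s <-> (forall k, smooth_on U (fun p => s p k 0)).
Proof.
move=> oU; have UT : U `&` setT = U by rewrite setIT.
split=> [ss k|ss].
  have [x [sx E]] := ss tt; move: (sx k); rewrite /= UT; apply: smooth_on_eq => // p Up.
  rewrite (E p Up I) summxE (bigD1 k) //= !mxE !eqxx mulr1 big1 ?addr0 // => l lk.
  by rewrite !mxE eq_sym (negbTE lk) mulr0.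
move=> i; exists (fun k p => s p k 0); split=> [k|p Up _]; first by rewrite /= UT; exact: ss.
by rewrite {1}[s p]matrix_sum_delta; apply: eq_bigr => k _; rewrite big_ord1.
Qed.

Lemma coframe_coeffD p t a b :
  coframe_coeff p (t *: a + b) = t *: coframe_coeff p a + coframe_coeff p b.
Proof. by apply/rowP => i; rewrite !mxE cometricDl mulrDr mulrCA. Qed.

Lemma qstd_coeff p a : qstd (coframe_coeff p a) = cometric p a a.
Proof.
rewrite (cometric_components (oe p)) /qstd; apply: eq_bigr => i _.
by rewrite mxE expr2 !mulrA.
Qed.

Lemma coframe_coeff_coframe p a : coframe_coeff p (e a p) = delta_mx 0 a.
Proof.
apply/rowP => b; rewrite !mxE oe eta_mxE eqxx eq_sym /=.
by case: eqP => [->|_]; rewrite ?mulr1n ?eta_sq ?mulr0n ?mulr0.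
Qed.

Lemma smooth_coframe_coeff U (u : form1 M) a : open U -> smooth_form1 U u ->
  smooth_on U (fun p => coframe_coeff p (u p) 0 a).
Proof.
move=> oU su; apply: (@smooth_on_eq _ _ _ (fun p => eta R a * cometric p (u p) (e a p))) => //.
  by move=> p _; rewrite mxE.
apply: smooth_onZ => //; apply: smooth_cometric => // c i.
by apply: smooth_on_subset (se a c i) => q [_ ?]; split.
Qed.

Definition trivial_spinor_bundle : paired_spinor_bundle M.
Proof.
refine (@PairedSpinorBundle R M trivial_vbundle frame_cl (fun _ => symp) _ _ _ _ _ _ _ _ _ _).
- by move=> p t a b x; rewrite /frame_cl coframe_coeffD gamvD mulmxDl scalemxAl.
- by move=> p t a x y; rewrite /frame_cl mulmxDr scalemxAr.
- by move=> p a x; rewrite /frame_cl gamv_sq qstd_coeff.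
(* Invariance under the timelike covector e 2, which acts as a rotation, is enough. *)
- move=> p W HW; apply: rotation_irreducible => x /(HW (e 2%:R p)).
  by rewrite /frame_cl coframe_coeff_coframe.
- move=> U u s oU su ss; apply/(smooth_trivial_section _ oU) => k.
  have {}ss := (smooth_trivial_section s oU).1 ss.
  apply: (@smooth_on_eq _ _ _ (fun p =>
      \sum_l (\sum_a coframe_coeff p (u p) 0 a * gam R a k l) * s p l 0)) => //.
    move=> p _; rewrite /frame_cl mxE; apply: eq_bigr => l _; congr (_ * _).
    by rewrite /gamv summxE; apply: eq_bigr => a _; rewrite [RHS]mxE.
  apply: smooth_on_sum => // l; apply: smooth_onM => //; apply: smooth_on_sum => // a.
  by apply: smooth_onM => //; [exact: smooth_coframe_coeff|exact: smooth_on_cst].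
- by move=> p t x y z; rewrite /symp !mxE; ring.
- by move=> p x y; rewrite /symp; ring.
- move=> p x H; have H0 := H (delta_mx 0 0); have H1 := H (delta_mx 1 0).
  move: H0 H1; rewrite /symp !mxE /= !mulr0 !mulr1 sub0r subr0 => /eqP.
  rewrite oppr_eq0 => /eqP x1 x0; apply/colP => -[[|[|//]] Hi]; rewrite [RHS]mxE.
    by rewrite -[RHS]x0; congr (x _ _); apply/val_inj.
  by rewrite -[RHS]x1; congr (x _ _); apply/val_inj.
- move=> U s t oU ss st.
  have {}ss := (smooth_trivial_section s oU).1 ss.
  have {}st := (smooth_trivial_section t oU).1 st.
  apply: (@smooth_on_eq _ _ _ (fun p => s p 0 0 * t p 1 0 + - (s p 1 0 * t p 0 0))) => //.
  by apply: smooth_onD => //; [|apply: smooth_onN => //]; exact: smooth_onM.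
- by move=> p a x y; exact: symp_gamv.
Defined.

Let S := trivial_spinor_bundle.

Lemma trivial_adapted : adapted_frame setT e (fun k p => delta_mx k 0 : S p).
Proof.
split; first by split=> // p a b _; exact: oe.
- split=> [k|p _]; last exact: cV2_basis.
  by apply/(smooth_trivial_section _ openT) => l; apply: smooth_on_cst.
- exists (gam R) => p a l _; rewrite /cl /= /frame_cl coframe_coeff_coframe.
  rewrite -colE; have -> : gamv (delta_mx 0 a) = gam R a.
    rewrite /gamv (bigD1 a) //= mxE !eqxx scale1r big1 ?addr0 // => b ba.
    by rewrite mxE (negbTE ba) scale0r.
  rewrite {1}[col l _]matrix_sum_delta; apply: eq_bigr => k _.
  by rewrite big_ord1 mxE.
- by exists (\matrix_(k, l) symp (delta_mx k 0) (delta_mx l 0)) => p k l _; rewrite mxE.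
Qed.

Variables (u : form1 M) (f : M -> R).
Hypothesis sf : smooth_on setT f.
Hypothesis uE : forall p, u p = e 0 p + e 2%:R p.
Hypothesis nu : forall p, nabla u p = f p *: hodge1 u p.

(* The factor -2 inverts [f = - torsion_density / 2], see
   [nabla_dirac_current_adapted]. *)
Definition torsion_form : form3 M := fun p x y z => (-2 * f p) * vol p x y z.

Lemma smooth_torsion_form : smooth_form3 torsion_form.
Proof.
split=> [p a v v' w x|p v w x|p v w x|c i j k].
- by rewrite /torsion_form !volE !rdetE !mxE; ring.
- by rewrite /torsion_form !volE !rdetE; ring.
- by rewrite /torsion_form !volE !rdetE; ring.
have oc : open (cdom c) by exact: cdom_open.
pose r : R := rdet (delta_mx 0 i) (delta_mx 0 j) (delta_mx 0 k).
apply: (@smooth_on_eq _ _ _ (fun p =>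
    (-2 * r) * (f p * Num.sqrt (- \det (coord_metric c p))))) => //.
  move=> p dp; rewrite /torsion_form volE !rowE rdet_mulmx sqrt_det_coord_metric // -/r; ring.
apply: smooth_onZ => //; apply: smooth_onM => //; last exact: smooth_sqrt_det.
exact: smooth_on_subset sf.
Qed.

Lemma torsion_formE p : torsion_density torsion_form p = -2 * f p.
Proof.
rewrite /torsion_density /torsion_form volE rdet_delta mulr1 mulrK // unitfE gt_eqF //.
exact: sqrt_det_metric_gt0.
Qed.

Let eps p : S p := delta_mx 0 0.

(* The covariant constancy of [u = e^0 + e^2] for the connection with torsion,
   in terms of its connection forms [th]. *)
Lemma connection_null p w b (th := fun c d => conn_form e p w c d + 2^-1 *
    (torsion_density torsion_form p * (coframe_sign e p *
      rdet (w *m coframe_mx e p) (delta_mx 0 c) (delta_mx 0 d)))) :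
  th 0 b = th 2%:R b.
Proof.
have oT : open [set: M] := openT.
(* The components of u in the coframe are constant, so its covariant derivative involves connection
   forms only. *)
pose k (a : 'I_3) : R := if a == 1 then 0 else 1.
have ukE q : [set: M] q -> u q = \sum_a k a *: e a q.
  by move=> _; rewrite sum3 uE /k /= !scale1r scale0r addr0.
have := nabla_along_sum w oT (I : setT p) se (fun a => smooth_on_cst setT (k a)) ukE.
rewrite /nabla_along nu -scalemxAr.
have -> : (f p *: (w *m hodge1 u p))^T = f p *: (w *m hodge1 u p)^T.
  by apply/matrixP => i j; rewrite !mxE.
rewrite (hodge_coframe (oe p) w (ukE p I)).
under [X in _ = X -> _]eq_bigr do rewrite deriv_along_cst scale0r add0r -/(nabla_along _ _
    _) (nabla_coframe (I : setT p) (fun q _ => oe q)).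
set F := fun b : 'I_3 => f p * (coframe_sign e p * rdet (\row_a (eta R a * k a)) (w *m
    coframe_mx e p) (delta_mx 0 b)).
set G := fun b : 'I_3 => - \sum_a k a * (eta R a * conn_form e p w a b).
have -> : f p *: (coframe_sign e p *: \sum_b0 rdet (\row_a (eta R a * k a)) (w *m
    coframe_mx e p) (delta_mx 0 b0) *: e b0 p)
    = \sum_b F b *: e b p.
  by rewrite !scaler_sumr; apply: eq_bigr => c _; rewrite !scalerA /F mulrA.
have -> : \sum_i k i *: - (\sum_b0 (eta R i * conn_form e p w i b0) *: e b0 p) =
    \sum_b G b *: e b p.
  under eq_bigr do rewrite scalerN scaler_sumr -sumrN.
  rewrite exchange_big; apply: eq_bigr => c _; rewrite /G -sumrN scaler_suml.
  by apply: eq_bigr => a _; rewrite scalerA scaleNr.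
move=> FG.
(* Pairing with e b, corrected by eta b, extracts the coefficient of e b on each side. *)
have : F b = G b.
  have := congr1 (fun v => eta R b * cometric p v (e b p)) FG.
  have sel (h : 'I_3 -> R) : eta R b * cometric p (\sum_i h i *: e i p) (e b p) = h b.
    rewrite cometric_suml (bigD1 b) //= oe eta_mxE eqxx mulr1n big1 ?addr0.
      by rewrite mulrCA eta_sq mulr1.
    by move=> i ib; rewrite oe eta_mxE (negbTE ib) mulr0n mulr0.
  by rewrite !sel.
rewrite /F /G /th torsion_formE !rdetE sum3 /k /= !mxE /= eta0 eta1 eta2.
move: (conn_form e p w 0 b) (conn_form e p w 2%:R b) (conn_form e p w 1 b) => c0 c2 c1 H.
move: H; case: b => -[|[|[|//]]] Hb /= H; lra.
Qed.

Lemma trivial_parallel : skew_torsion_parallel_spinor eps.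
Proof.
split; first by apply/(smooth_trivial_section _ openT) => k; exact: smooth_on_cst.
  have [p _] := @mfd_nonempty _ M; exists p; apply/eqP => /colP/(_ 0).
  by rewrite !mxE /= => /eqP; rewrite oner_eq0.
exists torsion_form; first exact: smooth_torsion_form.
move=> p w.
(* [eps] has constant coordinates in the global adapted frame, so the derivative term of its spin
   derivative vanishes. *)
pose x (k : 'I_2) (_ : M) : R := if k == 0 then 1 else 0.
pose s (k : 'I_2) p : S p := delta_mx k 0.
exists (\sum_k deriv_along (x k) p w *: s k p
  + 4^-1 *: \sum_a \sum_b conn_form e p w a b *: cl (e a p) (cl (e b p) (eps p))).
  exists setT, e, s, x; split=> //.
  - by split=> //; exact: openT.
  - exact: trivial_adapted.
  - by move=> k; exact: smooth_on_cst.
  - by move=> q _; rewrite sum2 /x /= scale1r scale0r addr0.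
rewrite [X in X + _ + _]big1 ?add0r; last by move=> k _; rewrite deriv_along_cst scale0r.
rewrite (cl2_torsion w (eps p) (oe p) smooth_torsion_form) -scalerDr.
pose th c d := conn_form e p w c d + 2^-1 * (torsion_density torsion_form p *
  (coframe_sign e p * rdet (w *m coframe_mx e p) (delta_mx 0 c) (delta_mx 0 d))).
have thE b : th 0 b = th 2%:R b by exact: connection_null.
have th_skew a b : th a b = - th b a.
  rewrite /th (conn_form_skew openT (I : setT p) se (fun q _ => oe q)) opprD; congr (_ + _).
  by rewrite !rdetE; ring.
rewrite (_ : _ + _ = \sum_a \sum_b th a b *: cl (e a p) (cl (e b p) (eps p))); last first.
  rewrite scaler_sumr -big_split; apply: eq_bigr => a _ /=.
  rewrite scaler_sumr -big_split; apply: eq_bigr => b _ /=.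
  by rewrite scalerA -scalerDl.
(* Skewness and th 0 b = th 2 b leave a single free entry, t = th 2 1. The sum becomes 2 t (gam 0 +
   gam 2) gam 1; gam 1 fixes the first basis vector and gam 0 + gam 2 kills it. *)
have t00 : th 0 0 = 0 by have := th_skew 0 0; lra.
have t11 : th 1 1 = 0 by have := th_skew 1 1; lra.
have t22 : th 2%:R 2%:R = 0 by have := th_skew 2%:R 2%:R; lra.
have t02 : th 0 2%:R = 0 by rewrite thE.
have t20 : th 2%:R 0 = 0 by rewrite th_skew t02 oppr0.
have t01 : th 0 1 = th 2%:R 1 by rewrite thE.
have t10 : th 1 0 = - th 2%:R 1 by rewrite th_skew t01.
have t12 : th 1 2%:R = - th 2%:R 1 by rewrite th_skew.
rewrite !sum3 t00 t11 t22 t02 t20 t01 t10 t12 !scale0r.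
rewrite /cl /= /frame_cl !coframe_coeff_coframe !gamvE /eps.
move: (th 2%:R 1) => t.
apply/colP => i; rewrite !mxE !sum2 !mxE !sum2 !mxE /=.
by case: i => -[|[|//]] Hi /=; ring.
Qed.

End TrivialSpinorBundle.

Theorem proposition4p1 (R : realType) (M : lorentz3 R)
    (hM : strongly_spin M) :
  admits_skew_torsion_parallel_spinor M <->
  exists u : form1 M,
    [/\ smooth_form1 setT u,
        forall p : M, u p <> 0,
        isotropic u &
        exists2 f : M -> R, smooth_on setT f &
          forall p : M, nabla u p = f p *: hodge1 u p].
Proof.
split=> [[S [eps par]]|[u [su u0 uu [f sf nu]]]].
  exact: skew_torsion_current par.
have [e [se oe uE]] := null_coframe su u0 uu.
exists (trivial_spinor_bundle se oe), (fun=> delta_mx 0 0 : 'cV[R]_2).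
exact: (trivial_parallel se oe sf uE nu).
Qed.
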